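(* Let $X=\mathbb{R}^n\times T^n$ with symplectic form $\omega=\sum_i dx_i\wedge d\theta_i$, and for $k\in\mathbb{N}$ let $\phi^k\colon C_c^\infty(X)\to\mathbb{B}(\mathcal{H}_k)$ be the adjoint-preserving linear map whose value $\phi^k(f)$ has matrix coefficients $\langle\psi_b^k,\phi^k(f)\psi_c^k\rangle=\int_{T^n}e^{-\sqrt{-1}k\langle b-c,\theta\rangle}f\left(\tfrac{b+c}{2},\theta\right)d'\theta$ for $b,c\in B_k=\frac{1}{k}\mathbb{Z}^n$. Then $\{\phi^k\}_{k\in\mathbb{N}}$ is a strict deformation quantization of $(X,\omega)$; that is, for all $f,g\in C_c^\infty(X)$, (1) $\|\phi^k(f)\|\to\|f\|_{C^0}$ as $k\to\infty$, and (2) $\left\|[\phi^k(f),\phi^k(g)]+\frac{\sqrt{-1}}{k}\phi^k(\{f,g\})\right\|=O\left(\frac{1}{k^2}\right)$ as $k\to\infty$.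
   Context: $T=\mathbb{R}/2\pi\mathbb{Z}$, with coordinates $(x,\theta)$ on $X=\mathbb{R}^n\times T^n$, and $\mu\colon X\to\mathbb{R}^n$, $\mu(x,\theta)=x$, with fibers $X_b=\mu^{-1}(b)$. $d'\theta=(2\pi)^{-n}d\theta$ is the normalized (total mass one) measure on $T^n$. Functions are complex valued; $\mathbb{N}$ is the set of positive integers; $\|f\|_{C^0}$ is the sup norm. The Poisson bracket is $\{f,g\}=\sum_i\left(\partial_{x_i}f\,\partial_{\theta_i}g-\partial_{\theta_i}f\,\partial_{x_i}g\right)$. The prequantum line bundle is the trivial hermitian line bundle $L=\underline{\mathbb{C}}$ with connection $\nabla=d-\sqrt{-1}\sum_i x_i d\theta_i$. The Hilbert space $\mathcal{H}_k=\bigoplus_{b\in B_k}H^0(X_b;L^k\otimes|\Lambda|^{1/2}X_b)$ (Hilbert direct sum of spaces of parallel sections over the fibers, where $|\Lambda|^{1/2}X_b$ is the half-density bundle with its canonical flat connection) has orthonormal basis $\{\psi_b^k\}_{b\in B_k}$, $B_k=\frac1k\mathbb{Z}^n$, $\psi^k_b=e^{\sqrt{-1}k\langle b,\theta\rangle}\sqrt{d'\theta}$ on $X_b$. $\mathbb{B}(\mathcal{H})$ is the algebra of bounded operators and $\|\cdot\|$ the operator norm; for $f\in C_c^\infty(X)$ the matrix with entries $\int_{T^n}e^{-\sqrt{-1}k\langle b-c,\theta\rangle}f\left(\tfrac{b+c}{2},\theta\right)d'\theta$, $b,c\in B_k$, with respect to the orthonormal basis $\{\psi_b^k\}_{b\in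 B_k}$, defines a bounded operator on $\mathcal{H}_k$. Adjoint-preserving means $\phi^k(\bar f)=\phi^k(f)^*$. Inner products are conjugate-linear in the first variable. *)

(* Defs.v *)
From HB Require Import structures.
From mathcomp Require Import all_boot all_order all_algebra.
From mathcomp Require Import all_classical all_reals all_analysis.
From mathcomp Require Import complex ring.

Set Implicit Arguments.
Unset Strict Implicit.
Unset Printing Implicit Defensive.

Import Order.TTheory GRing.Theory Num.Theory.
Import numFieldNormedType.Exports.
Local Open Scope classical_set_scope.
Local Open Scope ring_scope.
Local Open Scope complex_scope.

Section SmoothFunctions.
Variables (R : realType) (V : normedModType R).
Implicit Types (f g : V -> R) (u w : V -> R[i]) (s : seq V).

Definition iter_derive f s : V -> R := foldr (fun v h => 'D_v h) f s.

(* Iterated directional derivatives are taken along arbitrary vectors; on the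
   finite dimensional spaces used here this is the usual class C^infinity. *)
Definition smooth f :=
  forall s, continuous (iter_derive f s) /\
            forall x v, derivable (iter_derive f s) x v.

Definition csmooth u := smooth (@complex.Re R \o u) /\ smooth (@complex.Im R \o u).

Definition cderive (v : V) u (x : V) : R[i] :=
  'D_v (@complex.Re R \o u) x +i* 'D_v (@complex.Im R \o u) x.

Let Ck m f := forall s, (size s <= m)%N ->
  continuous (iter_derive f s) /\ forall x v, derivable (iter_derive f s) x v.

Let CkS m f : Ck m.+1 f <-> Ck 0 f /\ forall v, Ck m ('D_v f).
Proof.
split=> [Cf|[C0 CD] s].
  split=> [[]// _|v s sm]; first exact: (Cf [::]).
  have := Cf (rcons s v); rewrite size_rcons ltnS => /(_ sm).
  by rewrite /iter_derive foldr_rcons.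
case/lastP: s => [_|s v]; first exact: (C0 [::]).
rewrite size_rcons ltnS => /CD; by rewrite /iter_derive foldr_rcons.
Qed.

Let CkW m f : Ck m.+1 f -> Ck m f.
Proof. by move=> Cf s sm; apply: Cf; rewrite (leq_trans sm). Qed.

Let Ck0 f : Ck 0 f <-> continuous f /\ forall x v, derivable f x v.
Proof.
split=> [Cf|Cf s]; first exact: (Cf [::] isT).
by rewrite leqn0 size_eq0 => /eqP ->.
Qed.

Let smoothE f : smooth f <-> forall m, Ck m f.
Proof.
split=> [Sf m s _|Cf s]; first exact: Sf.
exact: (Cf (size s)).
Qed.

Let CkD m f g : Ck m f -> Ck m g -> Ck m (f + g).
Proof.
elim: m f g => [|m IH] f g.
  move=> /Ck0[cf df] /Ck0[cg dg]; apply/Ck0; split.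
    by move=> x; apply: continuousD; [exact: cf|exact: cg].
  by move=> x v; apply: derivableD.
move=> /CkS[/Ck0[cf df] Df] /CkS[/Ck0[cg dg] Dg]; apply/CkS; split.
  apply/Ck0; split.
    by move=> x; apply: continuousD; [exact: cf|exact: cg].
  by move=> x v; apply: derivableD.
move=> v; rewrite (_ : 'D_v (f + g) = 'D_v f + 'D_v g); first exact: IH.
by apply/funext => x; rewrite deriveD.
Qed.

Let CkZ m (a : R) f : Ck m f -> Ck m (a \*: f).
Proof.
elim: m f => [|m IH] f.
  move=> /Ck0[cf df]; apply/Ck0; split.
    by move=> x; apply: continuousM; [exact: cst_continuous|exact: cf].
  by move=> x v; apply: derivableZ.
move=> /CkS[/Ck0[cf df] Df]; apply/CkS; split.
  apply/Ck0; split.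
    by move=> x; apply: continuousM; [exact: cst_continuous|exact: cf].
  by move=> x v; apply: derivableZ.
move=> v; rewrite (_ : 'D_v (a \*: f) = a \*: 'D_v f); first exact: IH.
by apply/funext => x; rewrite deriveZ.
Qed.

Let CkM m f g : Ck m f -> Ck m g -> Ck m (f * g).
Proof.
elim: m f g => [|m IH] f g.
  move=> /Ck0[cf df] /Ck0[cg dg]; apply/Ck0; split.
    by move=> x; apply: continuousM; [exact: cf|exact: cg].
  by move=> x v; apply: derivableM.
move=> Cf Cg; have /CkS[/Ck0[cf df] Df] := Cf; have /CkS[/Ck0[cg dg] Dg] := Cg.
apply/CkS; split.
  apply/Ck0; split.
    by move=> x; apply: continuousM; [exact: cf|exact: cg].
  by move=> x v; apply: derivableM.
move=> v; rewrite (_ : 'D_v (f * g) = f * 'D_v g + g * 'D_v f).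
  exact: CkD (IH _ _ (CkW Cf) (Dg v)) (IH _ _ (CkW Cg) (Df v)).
by apply/funext => x; rewrite deriveM.
Qed.

Lemma smoothD f g : smooth f -> smooth g -> smooth (f + g).
Proof. by rewrite !smoothE => Cf Cg m; exact: CkD. Qed.

Lemma smoothZ (a : R) f : smooth f -> smooth (a \*: f).
Proof. by rewrite !smoothE => Cf m; exact: CkZ. Qed.

Lemma smoothM f g : smooth f -> smooth g -> smooth (f * g).
Proof. by rewrite !smoothE => Cf Cg m; exact: CkM. Qed.

Lemma smooth_derive f v : smooth f -> smooth ('D_v f).
Proof. by move=> Sf s; have := Sf (rcons s v); rewrite /iter_derive foldr_rcons. Qed.

Lemma smooth_derivable f x v : smooth f -> derivable f x v.
Proof. by move=> /(_ [::])[_]; apply. Qed.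

Lemma smooth_continuous f : smooth f -> continuous f.
Proof. by move=> /(_ [::])[]. Qed.

Lemma smooth0 : smooth (0 : V -> R).
Proof.
have D0 s : iter_derive 0 s = 0.
  by elim: s => //= v s ->; apply/funext => x; exact: (derive_cst 0).
move=> s; rewrite D0; split; first exact: cst_continuous.
by move=> x v; exact: (derivable_cst 0).
Qed.

Lemma csmooth0 : csmooth (0 : V -> R[i]).
Proof. by split; exact: smooth0. Qed.

Let ReZ (a : R[i]) u : @complex.Re R \o (a *: u) =
  (complex.Re a) \*: (@complex.Re R \o u) + (- complex.Im a) \*: (@complex.Im R \o u).
Proof.
apply/funext => x /=; rewrite -[RHS]/(_ * _ + _ * _) /=.
by case: a => a b /=; rewrite -[(_ *: u) x]/(_ * u x); case: (u x) => c d /=; rewrite mulNr.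
Qed.

Let ImZ (a : R[i]) u : @complex.Im R \o (a *: u) =
  (complex.Re a) \*: (@complex.Im R \o u) + (complex.Im a) \*: (@complex.Re R \o u).
Proof.
apply/funext => x /=; rewrite -[RHS]/(_ * _ + _ * _) /=.
by case: a => a b /=; rewrite -[(_ *: u) x]/(_ * u x); case: (u x) => c d /=.
Qed.

Let ReD u w : @complex.Re R \o (u + w) = (@complex.Re R \o u) + (@complex.Re R \o w).
Proof.
apply/funext => x; rewrite -[RHS]/(complex.Re (u x) + complex.Re (w x)) /=.
by rewrite -[(u + w) x]/(u x + w x); case: (u x) (w x) => [? ?] [].
Qed.

Let ImD u w : @complex.Im R \o (u + w) = (@complex.Im R \o u) + (@complex.Im R \o w).
Proof.
apply/funext => x; rewrite -[RHS]/(complex.Im (u x) + complex.Im (w x)) /=.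
by rewrite -[(u + w) x]/(u x + w x); case: (u x) (w x) => [? ?] [].
Qed.

Lemma csmoothZ (a : R[i]) u : csmooth u -> csmooth (a *: u).
Proof.
by move=> [Su Tu]; split; rewrite ?ReZ ?ImZ; apply: smoothD; apply: smoothZ.
Qed.

Lemma csmoothD u w : csmooth u -> csmooth w -> csmooth (u + w).
Proof.
by move=> [Su Tu] [Sw Tw]; split; rewrite ?ReD ?ImD; apply: smoothD.
Qed.

Lemma csmoothM u w : csmooth u -> csmooth w -> csmooth (u * w).
Proof.
move=> [Su Tu] [Sw Tw]; split.
  rewrite (_ : _ \o _ = (@complex.Re R \o u) * (@complex.Re R \o w)
                        + (-1) \*: ((@complex.Im R \o u) * (@complex.Im R \o w))).
    by apply: smoothD; [exact: smoothM|apply: smoothZ; exact: smoothM].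
  apply/funext => x; rewrite -[RHS]/(complex.Re (u x) * complex.Re (w x) + -1 * (complex.Im (u x) * complex.Im (w x))) /=.
  by rewrite -[(u * w) x]/(u x * w x); case: (u x) (w x) => [? ?] [? ?] /=; rewrite mulN1r.
rewrite (_ : _ \o _ = (@complex.Re R \o u) * (@complex.Im R \o w) + (@complex.Im R \o u) * (@complex.Re R \o w)).
  by apply: smoothD; exact: smoothM.
apply/funext => x; rewrite -[RHS]/(complex.Re (u x) * complex.Im (w x) + complex.Im (u x) * complex.Re (w x)) /=.
by rewrite -[(u * w) x]/(u x * w x); case: (u x) (w x) => [? ?] [? ?].
Qed.

Lemma csmooth_cderive u v : csmooth u -> csmooth (cderive v u).
Proof. by move=> [Su Tu]; split; apply: smooth_derive. Qed.

Lemma csmooth_conj u : csmooth u -> csmooth (fun x => (u x)^*).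
Proof.
move=> [Su Tu]; split.
  by rewrite (_ : _ \o _ = @complex.Re R \o u)//; apply/funext => x /=; case: (u x).
rewrite (_ : _ \o _ = (-1) \*: (@complex.Im R \o u)); first exact: smoothZ.
by apply/funext => x /=; rewrite -[RHS]/(-1 * complex.Im (u x)) mulN1r; case: (u x).
Qed.

Lemma cderiveD u w v x : csmooth u -> csmooth w ->
  cderive v (u + w) x = cderive v u x + cderive v w x.
Proof.
move=> [Su Tu] [Sw Tw]; rewrite /cderive ReD ImD !deriveD//; exact: smooth_derivable.
Qed.

Lemma cderiveZ (a : R[i]) u v x : csmooth u ->
  cderive v (a *: u) x = a * cderive v u x.
Proof.
move=> [Su Tu]; rewrite /cderive ReZ ImZ.
rewrite !deriveD; do ?[exact/derivableZ/smooth_derivable].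
rewrite !deriveZ; do ?[exact/smooth_derivable].
by case: a => a b /=; rewrite -![_ *: _]/(_ * _) mulNr.
Qed.

Lemma cderive_near0 u v x : (\forall y \near x, u y = 0) -> cderive v u x = 0.
Proof.
move=> u0; rewrite /cderive.
rewrite (@near_eq_derive _ _ _ _ (cst 0)) ?derive_cst; last first.
  by apply: filterS u0 => y /= ->.
rewrite (@near_eq_derive _ _ _ _ (cst 0)) ?derive_cst//.
by apply: filterS u0 => y /= ->.
Qed.

End SmoothFunctions.

Section FlatSections.
Variable R : realType.

Definition dotp n (u v : 'rV[R]_n) : R := \sum_(i < n) u 0 i * v 0 i.

Definition expi (t : R) : R[i] := cos t +i* sin t.

(* Functions on T^n are functions of th : 'rV[R]_n invariant under 2 pi Z^n. *)
Definition torus_periodic n (u : 'rV[R]_n -> R[i]) :=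
  forall th (m : 'rV[int]_n), u (th + (2 * pi) *: map_mx intr m) = u th.

(* Integral over the cube [0, 2 pi]^n, one variable at a time, normalized to
   total mass one. *)
Fixpoint torus_int n : ('rV[R]_n -> R) -> R :=
  match n with
  | 0 => fun g => g 0
  | m.+1 => fun g => (2 * pi)^-1 *
      \int[lebesgue_measure]_(t in `[0, 2 * pi])
        torus_int (fun th : 'rV[R]_m => g (row_mx (t%:M : 'rV[R]_1) th))
  end.

Definition ctorus_int n (u : 'rV[R]_n -> R[i]) : R[i] :=
  torus_int (@complex.Re R \o u) +i* torus_int (@complex.Im R \o u).

(* nabla = d - sqrt(-1) sum_i x_i d theta_i on L induces
   d - sqrt(-1) k sum_i b_i d theta_i on the restriction of L^k to X_b. *)
Definition cov_derive n (k : nat) (b : 'rV[R]_n) (v : 'rV[R]_n)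
    (s : 'rV[R]_n -> R[i]) (th : 'rV[R]_n) : R[i] :=
  cderive v s th - 'i%C * (k%:R * dotp b v)%:C * s th.

(* The section s sqrt(d'theta) of L^k (x) |Lambda|^{1/2} X_b is represented by
   the function s; as sqrt(d'theta) is parallel, only s is differentiated. *)
Definition flat_section n k (b : 'rV[R]_n) (s : 'rV[R]_n -> R[i]) :=
  [/\ csmooth s, torus_periodic s & forall v th, cov_derive k b v s th = 0].

Definition section_dot n (s t : 'rV[R]_n -> R[i]) : R[i] :=
  ctorus_int (fun th => (s th)^* * t th).

Lemma dotpDr n (u v w : 'rV[R]_n) : dotp u (v + w) = dotp u v + dotp u w.
Proof. by rewrite -big_split; apply: eq_bigr => i _; rewrite mxE mulrDr. Qed.

Lemma dotpZr n a (u v : 'rV[R]_n) : dotp u (a *: v) = a * dotp u v.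
Proof. by rewrite mulr_sumr; apply: eq_bigr => i _; rewrite mxE mulrCA. Qed.

Lemma dotpZl n a (u v : 'rV[R]_n) : dotp (a *: u) v = a * dotp u v.
Proof. by rewrite mulr_sumr; apply: eq_bigr => i _; rewrite mxE mulrA. Qed.

Lemma expi0 : expi 0 = 1.
Proof. by rewrite /expi cos0 sin0. Qed.

Lemma expi_conj_mul t : (expi t)^* * expi t = 1.
Proof.
rewrite /expi /=; congr (_ +i* _); last by rewrite mulNr mulrC subrr.
by rewrite mulNr opprK -!expr2 cos2Dsin2.
Qed.

Lemma expiD2pi t (z : int) : expi (t + 2 * pi * z%:~R) = expi t.
Proof.
have cn x m : cos (x + (pi *+ 2) *+ m) = cos x :> R := periodicn (@cosD2pi R) m x.
have sn x m : sin (x + (pi *+ 2) *+ m) = sin x :> R := periodicn (@sinD2pi R) m x.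
have nat_case x m : expi (x + 2 * pi * m%:R) = expi x.
  by rewrite (_ : 2 * pi * m%:R = pi *+ 2 *+ m) ?mulr_natr ?mulr_natl// /expi cn sn.
case: z => m; first exact: nat_case.
by rewrite NegzE mulrNz mulrN -[in RHS](subrK (2 * pi * m.+1%:R) t) nat_case.
Qed.

Lemma torus_int_cst n (c : R) : torus_int (fun _ : 'rV[R]_n => c) = c.
Proof.
elim: n => //= n ->; rewrite Rintegral_cst//= lebesgue_measure_itv/= lte_fin.
have p2 : 0 < 2 * pi :> R by rewrite mulr_gt0// pi_gt0.
by rewrite p2 sube0 /= mulrCA mulVf ?mulr1// gt_eqF.
Qed.

Lemma ctorus_int_cst n (c : R[i]) : ctorus_int (fun _ : 'rV[R]_n => c) = c.
Proof. by rewrite /ctorus_int (torus_int_cst n (complex.Re c)) (torus_int_cst n (complex.Im c)); case: c. Qed.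

Lemma derive_line (V : normedModType R) (f : V -> R) (v : V) (t : R) :
  derivable f (t *: v) v -> is_derive t 1 (fun t => f (t *: v)) ('D_v f (t *: v)).
Proof.
move=> df; have E : (fun h : R => h^-1 *: (((fun t => f (t *: v)) \o shift t) (h *: 1) - f (t *: v)))
  = (fun h : R => h^-1 *: ((f \o shift (t *: v)) (h *: v) - f (t *: v))).
  by apply/funext => h /=; rewrite scalerDl -[h *: 1]/(h * 1) mulr1.
by split; rewrite /derivable /derive E.
Qed.

Lemma flat_sectionE n k (b : 'rV[R]_n) s : flat_section k b s ->
  forall th, s th = s 0 * expi (k%:R * dotp b th).
Proof.
case=> [[Su Tu] _ cov th]; set c := k%:R * dotp b th.
pose u t := complex.Re (s (t *: th)); pose w t := complex.Im (s (t *: th)).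
have D t : complex.Re (cderive th s (t *: th)) = - c * w t /\
           complex.Im (cderive th s (t *: th)) = c * u t.
  have /eqP := cov th (t *: th); rewrite subr_eq0 => /eqP ->; rewrite -/c /u /w.
  case: (s (t *: th)) => x y /=.
  by split; ring.
have du (t : R) : is_derive t 1 u (- c * w t).
  by rewrite -(D t).1; apply: derive_line; exact: smooth_derivable.
have dw (t : R) : is_derive t 1 w (c * u t).
  by rewrite -(D t).2; apply: derive_line; exact: smooth_derivable.
have dl (t : R) : is_derive t 1 ( *%R c) c.
  have := @is_deriveZ _ _ _ id c t 1 1 _; rewrite -[_ *: _]/(_ * _) mulr1; exact.
have dc (t : R) : is_derive t 1 (cos \o ( *%R c)) (- sin (c * t) * c).
  exact: is_derive1_comp.
have ds (t : R) : is_derive t 1 (sin \o ( *%R c)) (cos (c * t) * c).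
  exact: is_derive1_comp.
pose h1 := u * (cos \o ( *%R c)) + w * (sin \o ( *%R c)).
pose h2 := w * (cos \o ( *%R c)) - u * (sin \o ( *%R c)).
have h1E : h1 1 = h1 0.
  apply: (@is_derive_0_is_cst R h1 1 0) => t.
  have := is_deriveD (is_deriveM (du t) (dc t)) (is_deriveM (dw t) (ds t)).
  by move/is_derive_eq; apply; rewrite /= -![_ *: _]/(_ * _) /=; ring.
have h2E : h2 1 = h2 0.
  apply: (@is_derive_0_is_cst R h2 1 0) => t.
  have := is_deriveB (is_deriveM (dw t) (dc t)) (is_deriveM (du t) (ds t)).
  by move/is_derive_eq; apply; rewrite /= -![_ *: _]/(_ * _) /=; ring.
have e1 : u 1 * cos c + w 1 * sin c = u 0.
  have : u 1 * cos (c * 1) + w 1 * sin (c * 1) = u 0 * cos (c * 0) + w 0 * sin (c * 0) := h1E.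
  by rewrite mulr1 mulr0 cos0 sin0 mulr0 mulr1 addr0.
have e2 : w 1 * cos c - u 1 * sin c = w 0.
  have : w 1 * cos (c * 1) - u 1 * sin (c * 1) = w 0 * cos (c * 0) - u 0 * sin (c * 0) := h2E.
  by rewrite mulr1 mulr0 cos0 sin0 mulr0 mulr1 subr0.
have cs : cos c ^+ 2 + sin c ^+ 2 = 1 by exact: cos2Dsin2.
have sE : s th = u 1 +i* w 1 by rewrite /u /w scale1r; case: (s th).
have s0E : s 0 = u 0 +i* w 0 by rewrite /u /w scale0r; case: (s 0).
rewrite sE s0E /expi -e1 -e2; congr (_ +i* _).
  rewrite -[LHS]mulr1 -cs; ring.
rewrite -[LHS]mulr1 -cs; ring.
Qed.

Lemma section_dot_flat n k (b : 'rV[R]_n) s t :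
  flat_section k b s -> flat_section k b t -> section_dot s t = (s 0)^* * t 0.
Proof.
move=> /flat_sectionE sE /flat_sectionE tE; rewrite /section_dot -[RHS](ctorus_int_cst n).
congr ctorus_int; apply/funext => th; rewrite sE tE rmorphM/=.
by rewrite mulrACA expi_conj_mul mulr1.
Qed.

Lemma flat_sectionD n k (b : 'rV[R]_n) (a : R[i]) s t :
  flat_section k b s -> flat_section k b t -> flat_section k b (a *: s + t).
Proof.
move=> [Ss Ps Cs] [St Pt Ct]; split.
- exact: csmoothD (csmoothZ _ Ss) St.
- move=> th m; rewrite -[LHS]/(a * s _ + t _) Ps Pt//.
move=> v th; rewrite /cov_derive (cderiveD v th (csmoothZ a Ss) St) (cderiveZ a v th Ss).
have /eqP := Cs v th; rewrite subr_eq0 => /eqP ->.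
have /eqP := Ct v th; rewrite subr_eq0 => /eqP ->.
rewrite -[(a *: s + t) th]/(a * s th + t th).
by rewrite mulrDr mulrCA subrr.
Qed.

Lemma flat_section0 n k (b : 'rV[R]_n) : flat_section k b 0.
Proof.
split=> [|th m|v th]; first exact: csmooth0.
  exact: erefl.
rewrite /cov_derive -[(0 : 'rV[R]_n -> R[i]) th]/(0 : R[i]) mulr0 subr0.
apply: cderive_near0.
by apply: (@filterE _ (nbhs th) (@nbhs_filter _ th)) => y; exact: erefl.
Qed.

Lemma flat_section_expi n k (b : 'rV[R]_n) (m : 'rV[int]_n) :
  k%:R *: b = map_mx intr m ->
  flat_section k b (fun th => expi (k%:R * dotp b th)).
Proof.
move=> kb; set l := fun th => k%:R * dotp b th.
have lD x y : l (x + y) = l x + l y by rewrite /l dotpDr mulrDr.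
have lZ a x : l (a *: x) = a * l x by rewrite /l dotpZr mulrCA.
pose F (p q : R) th := p * cos (l th) + q * sin (l th).
have cl : continuous l.
  have addc : continuous (fun z : R * R => z.1 + z.2) by exact: add_continuous.
  have cm i : continuous ((cst (b 0 i) : 'rV[R]_n -> R) * (fun y => y 0 i)).
    by move=> x; apply: continuousM; [exact: cst_continuous|exact: coord_continuous].
  have cd : continuous (dotp b).
    by apply: (continuous_big addc) => i _; exact: cm.
  have -> : l = cst k%:R * dotp b by [].
  by move=> x; apply: continuousM; [exact: cst_continuous|exact: cd].
have cF p q : continuous (F p q).
  have -> : F p q = p \*: (cos \o l) + q \*: (sin \o l) by [].
  move=> x; apply: continuousD; apply: continuousM; try exact: cst_continuous.
    by apply: continuous_comp; [exact: cl|exact: continuous_cos].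
  by apply: continuous_comp; [exact: cl|exact: continuous_sin].
have dF p q x v : derivable (F p q) x v /\ 'D_v (F p q) x = F (q * l v) (- p * l v) x.
  pose a h := l x + h * l v.
  have da : is_derive (0 : R) 1 a (l v).
    have -> : a = cst (l x) + (l v) \*: id.
      by apply/funext => h; rewrite /a mulrC.
    by apply: is_derive_eq; rewrite add0r -[LHS]/(_ * _) mulr1.
  have dc : is_derive (0 : R) 1 (cos \o a) (- sin (a 0) * l v).
    exact: is_derive1_comp.
  have ds : is_derive (0 : R) 1 (sin \o a) (cos (a 0) * l v).
    exact: is_derive1_comp.
  have dG : is_derive (0 : R) 1 (p \*: (cos \o a) + q \*: (sin \o a))
      (F (q * l v) (- p * l v) x).
    apply: is_derive_eq; rewrite /F /a mul0r addr0 -![_ *: _]/(_ * _); ring.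
  have E : (fun h : R => h^-1 *: ((F p q \o shift x) (h *: v) - F p q x)) =
    (fun h : R => h^-1 *: (((p \*: (cos \o a) + q \*: (sin \o a)) \o shift 0) (h *: 1) -
       (p \*: (cos \o a) + q \*: (sin \o a)) 0)).
    apply/funext => h; congr (_ *: _).
    rewrite /= -[(_ + _ : R -> R) _]/(p * cos (a _) + q * sin (a _)).
    rewrite -[(_ + _ : R -> R) 0]/(p * cos (a 0) + q * sin (a 0)).
    by rewrite /F lD lZ /a mul0r !addr0 -[h *: 1]/(h * 1) mulr1 (addrC (h * _)).
  by split; [rewrite /derivable E; case: dG|rewrite /derive E; case: dG].
have iF p q s : exists p' q', iter_derive (F p q) s = F p' q'.
  elim: s => [|v s [p' [q' IH]]]; first by exists p, q.
  exists (q' * l v), (- p' * l v); rewrite /= IH.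
  by apply/funext => x; exact: (dF _ _ _ _).2.
have sF p q : smooth (F p q).
  move=> s; have [p' [q' ->]] := iF p q s; split; first exact: cF.
  by move=> x v; exact: (dF _ _ _ _).1.
have RF : @complex.Re R \o (fun th => expi (l th)) = F 1 0.
  by apply/funext => th; rewrite /F /= mul1r mul0r addr0.
have IF : @complex.Im R \o (fun th => expi (l th)) = F 0 1.
  by apply/funext => th; rewrite /F /= mul1r mul0r add0r.
split.
- by split; rewrite ?RF ?IF.
- move=> th p; rewrite -/(l _) lD lZ.
  rewrite [l (map_mx _ _)](_ : _ = (\sum_(i < n) m 0 i * p 0 i)%:~R).
    exact: expiD2pi.
  rewrite /l -dotpZl kb rmorph_sum; apply: eq_bigr => i _.
  by rewrite !mxE rmorphM.
move=> v th; rewrite /cov_derive /cderive RF IF !(dF _ _ _ _).2 /F /expi /=.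
apply/eqP; rewrite eq_complex /= -/(l v) -/(l th); apply/andP; split; apply/eqP; ring.
Qed.
End FlatSections.

Section Summation.
Variables (R : realType) (I : choiceType).

(* Sum of a summable family, in no particular order. *)
Definition usum (f : I -> R) : R :=
  fine (\esum_(i in [set: I]) (Num.max (f i) 0)%:E) -
  fine (\esum_(i in [set: I]) (Num.max (- f i) 0)%:E).

Definition cusum (f : I -> R[i]) : R[i] :=
  usum (@complex.Re R \o f) +i* usum (@complex.Im R \o f).

Lemma usum_ge0E (f : I -> R) : (forall i, 0 <= f i) ->
  usum f = fine (\esum_(i in [set: I]) (f i)%:E).
Proof.
move=> f0; rewrite /usum [X in _ - fine X]esum1 ?subr0; last first.
  by move=> i _; rewrite max_r// oppr_le0.
by congr fine; apply: eq_esum => i _; rewrite max_l.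
Qed.

Lemma le_esumZ (c : R) (f : I -> R) : 0 <= c -> (forall i, 0 <= f i) ->
  (\esum_(i in [set: I]) (c * f i)%:E <= c%:E * \esum_(i in [set: I]) (f i)%:E)%E.
Proof.
move=> c0 f0; apply: ub_ereal_sup => _ [A [fA _] <-].
rewrite [leLHS](_ : _ = (c%:E * \sum_(i \in A) (f i)%:E)%E); last first.
  by rewrite ge0_mule_fsumr// => i; rewrite lee_fin.
apply: lee_wpmul2l; first by rewrite lee_fin.
by apply: ereal_sup_ubound; exists A.
Qed.

End Summation.

Section HilbertSpace.
Variables (R : realType) (n k : nat).

Definition bs_points : set 'rV[R]_n :=
  [set b | exists m : 'rV[int]_n, b = k%:R^-1 *: map_mx intr m].

Implicit Types s t : bs_points -> 'rV[R]_n -> R[i].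

Definition hilb_pred s :=
  (forall b, flat_section k (\val b) (s b)) /\
  summable [set: bs_points] (fun b => (complex.Re (section_dot (s b) (s b)))%:E).

Definition family_dot s t : R[i] := cusum (fun b => section_dot (s b) (t b)).

Definition family_norm s : R := Num.sqrt (complex.Re (family_dot s s)).

Let N2 (z : R[i]) : R := complex.Re z ^+ 2 + complex.Im z ^+ 2.

Let N2_ge0 z : 0 <= N2 z.
Proof. by rewrite addr_ge0 ?sqr_ge0. Qed.

Let N2ZD (a x y : R[i]) : N2 (a * x + y) <= (2 * N2 a) * N2 x + 2 * N2 y.
Proof.
rewrite /N2 -subr_ge0; case: a x y => [a b] [c d] [e f] /=.
rewrite [leRHS](_ : _ = (a * c - b * d - e) ^+ 2 + (a * d + b * c - f) ^+ 2).
  by rewrite addr_ge0 ?sqr_ge0.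
ring.
Qed.

Let Re_dot s b : flat_section k (\val b) (s b) ->
  complex.Re (section_dot (s b) (s b)) = N2 (s b 0).
Proof.
move=> sb; rewrite (section_dot_flat sb sb) /N2.
by case: (s b 0) => x y /=; ring.
Qed.

Let summableE s : (forall b, flat_section k (\val b) (s b)) ->
  summable [set: bs_points] (fun b => (complex.Re (section_dot (s b) (s b)))%:E) <->
  (\esum_(b in [set: bs_points]) (N2 (s b 0))%:E < +oo)%E.
Proof.
move=> fs; rewrite /summable (_ : \esum_(_ in _) _ = \esum_(b in [set: bs_points]) (N2 (s b 0))%:E)//.
by apply: eq_esum => b _; rewrite Re_dot// gee0_abs ?lee_fin.
Qed.

Let esumZD (a : R[i]) s t :
  (\esum_(b in [set: bs_points]) (N2 (a * s b 0 + t b 0))%:E <=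
   (2 * N2 a)%:E * (\esum_(b in [set: bs_points]) (N2 (s b 0))%:E)
   + 2%:E * \esum_(b in [set: bs_points]) (N2 (t b 0))%:E)%E.
Proof.
have c0 : 0 <= 2 * N2 a by rewrite mulr_ge0.
have H1 := le_esumZ c0 (fun b : bs_points => N2_ge0 (s b 0)).
have H2 := le_esumZ (ler0n R 2) (fun b : bs_points => N2_ge0 (t b 0)).
apply: (le_trans _ (leeD H1 H2)).
rewrite -esumD; do ?[by move=> b _; rewrite lee_fin mulr_ge0].
by apply: le_esum => b _; rewrite -EFinD lee_fin.
Qed.

Definition hilb_set : {pred bs_points -> 'rV[R]_n -> R[i]} :=
  fun s => `[< hilb_pred s >].

Fact hilb_submod_closed : submod_closed hilb_set.
Proof.
split=> [|a s t].
  apply/asboolP; split=> [b|]; first exact: flat_section0.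
  apply/(summableE (s := 0)) => [b|]; first exact: flat_section0.
  rewrite esum1// => b _; congr EFin.
  by rewrite /N2 /= -!/(0 : R) !expr0n addr0.
move=> /asboolP[fs ss] /asboolP[ft st]; apply/asboolP.
have fst b : flat_section k (\val b) ((a *: s + t) b) by exact: flat_sectionD.
split=> //; apply/summableE => //.
move: ss st => /(summableE fs) ss /(summableE ft) st.
apply: le_lt_trans (esumZD a s t) _.
by rewrite lte_add_pinfty// lte_mul_pinfty// lee_fin mulr_ge0.
Qed.

HB.instance Definition _ :=
  GRing.isSubmodClosed.Build R[i] (bs_points -> 'rV[R]_n -> R[i]) hilb_set
    hilb_submod_closed.

(* Hilbert direct sum of the spaces of parallel sections over X_b. *)
Record hilb := Hilb {
  hilb_val :> bs_points -> 'rV[R]_n -> R[i] ;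
  _ : hilb_val \in hilb_set }.

HB.instance Definition _ := [isSub for hilb_val].
HB.instance Definition _ := [Choice of hilb by <:].
HB.instance Definition _ := [SubChoice_isSubLmodule of hilb by <:].

Definition hdot (s t : hilb) : R[i] := family_dot s t.
Definition hnorm (s : hilb) : R := family_norm s.

Let hilbP (s : hilb) : hilb_pred s.
Proof. by case: s => s /= /asboolP. Qed.

Let hnorm2 (s : hilb) :
  (hnorm s ^+ 2)%:E = \esum_(b in [set: bs_points]) (N2 (s b 0))%:E.
Proof.
have [fs /(summableE fs) ss] := hilbP s.
have E0 : (0 <= \esum_(b in [set: bs_points]) (N2 (s b 0))%:E)%E.
  by apply: esum_ge0 => b _; rewrite lee_fin.
rewrite /hnorm /family_norm /family_dot /cusum /=.
rewrite (_ : _ \o _ = fun b => N2 (s b 0)).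
  by rewrite usum_ge0E// sqr_sqrtr ?fine_ge0// fineK// ge0_fin_numE.
by apply/funext => b; exact: Re_dot.
Qed.

Let hnormZD a (s t : hilb) :
  hnorm (a *: s + t) ^+ 2 <= 2 * N2 a * hnorm s ^+ 2 + 2 * hnorm t ^+ 2.
Proof.
rewrite -lee_fin EFinD (EFinM (2 * N2 a)) (EFinM 2 (_ ^+ 2)) !hnorm2.
exact: (esumZD a (s : bs_points -> _) t).
Qed.

Lemma hnorm_ge0 (s : hilb) : 0 <= hnorm s.
Proof. exact: sqrtr_ge0. Qed.

Lemma hnorm0 : hnorm 0 = 0.
Proof.
have : (hnorm 0 ^+ 2)%:E = 0%E.
  by rewrite hnorm2 esum1// => b _; rewrite /N2 /= expr0n addr0.
by move=> [] /eqP; rewrite sqrf_eq0 => /eqP.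
Qed.

Definition bounded_operator (A : hilb -> hilb) :=
  linear A /\ exists M : R, forall s : hilb, hnorm (A s) <= M * hnorm s.

Definition bop_set : {pred hilb -> hilb} := fun A => `[< bounded_operator A >].

Fact bop_submod_closed : submod_closed bop_set.
Proof.
split=> [|a A B].
  apply/asboolP; split=> [a x y|]; first by rewrite -[LHS]/(0 : hilb) scaler0 addr0.
  by exists 0 => x; rewrite -[(0 : hilb -> hilb) x]/(0 : hilb) hnorm0 mul0r.
move=> /asboolP[lA [M hM]] /asboolP[lB [P hP]]; apply/asboolP; split.
  move=> c x y; rewrite -![(a *: A + B) _]/(a *: A _ + B _) lA lB.
  by rewrite !scalerDr !scalerA (mulrC a) addrACA.
exists (Num.sqrt (2 * N2 a * M ^+ 2 + 2 * P ^+ 2)) => x.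
have S0 : 0 <= 2 * N2 a * M ^+ 2 + 2 * P ^+ 2.
  by apply: addr_ge0; apply: mulr_ge0; rewrite ?sqr_ge0//; apply: mulr_ge0.
rewrite -(@ler_pXn2r _ 2)// ?nnegrE ?mulr_ge0 ?sqrtr_ge0 ?hnorm_ge0//.
rewrite exprMn (sqr_sqrtr S0).
rewrite -[(a *: A + B) x]/(a *: A x + B x).
apply: (le_trans (hnormZD a (A x) (B x))).
have sq (p q : R) : 0 <= p -> p <= q -> p ^+ 2 <= q ^+ 2.
  by move=> p0 pq; rewrite ler_pXn2r// nnegrE (le_trans p0).
have HA := sq _ _ (hnorm_ge0 (A x)) (hM x).
have HB := sq _ _ (hnorm_ge0 (B x)) (hP x).
rewrite [leRHS](_ : _ = 2 * N2 a * (M * hnorm x) ^+ 2 + 2 * (P * hnorm x) ^+ 2); last by ring.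
by apply: lerD; apply: ler_wpM2l => //; rewrite mulr_ge0.
Qed.

HB.instance Definition _ :=
  GRing.isSubmodClosed.Build R[i] (hilb -> hilb) bop_set bop_submod_closed.

Record bop := Bop { bop_val :> hilb -> hilb ; _ : bop_val \in bop_set }.

HB.instance Definition _ := [isSub for bop_val].
HB.instance Definition _ := [Choice of bop by <:].
HB.instance Definition _ := [SubChoice_isSubLmodule of bop by <:].

Fact bop_comp_subproof (A B : bop) : (A : hilb -> hilb) \o B \in bop_set.
Proof.
case: A B => A /= /asboolP[lA [M hM]] [B /= /asboolP[lB [P hP]]].
apply/asboolP; split=> [a x y|]; first by rewrite /= lB lA.
exists (`|M| * P) => x; apply: le_trans (hM _) _.
rewrite -mulrA; apply: le_trans (_ : `|M| * hnorm (B x) <= _).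
  by rewrite ler_wpM2r ?hnorm_ge0 ?ler_norm.
by rewrite ler_wpM2l.
Qed.

Definition bop_comp (A B : bop) : bop := Bop (bop_comp_subproof A B).

Definition commutator (A B : bop) : bop := bop_comp A B - bop_comp B A.

Definition is_adjoint (A B : bop) := forall s t : hilb, hdot (A s) t = hdot s (B t).

Definition opnorm (A : bop) : R := sup [set hnorm (A s) |
  s in [set s : hilb | hnorm s <= 1]].

Fact psi_subproof (b : bs_points) :
  (fun (c : bs_points) th => if c == b then expi (k%:R * dotp (\val b) th) else 0)
    \in hilb_set.
Proof.
have fl (c : bs_points) : flat_section k (\val c)
    (fun th => if c == b then expi (k%:R * dotp (\val b) th) else 0).
  have [->|_] := eqVneq c b; last exact: flat_section0.
  case: b => b /= /set_mem[m bE].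
  have [k0|k0] := eqVneq k 0%N.
    apply: (@flat_section_expi _ _ _ _ 0); apply/rowP => i.
    by rewrite !mxE k0 mul0r.
  apply: (@flat_section_expi _ _ _ _ m).
  by rewrite bE scalerA mulfV ?scale1r// pnatr_eq0.
apply/asboolP; split=> //; apply/summableE => //.
rewrite (_ : \esum_(_ in _) _ = \esum_(c in [set: bs_points])
    (if c \in [set b] then (1 : \bar R)%E else 0%E)).
  by rewrite -esum_mkcond esum_set1// ltry.
apply: eq_esum => c _; rewrite /dotp big1 => [|i _]; last by rewrite !mxE mulr0.
rewrite mulr0 expi0; have [->|cb] := eqVneq c b.
  by rewrite mem_set// /N2 /= expr1n expr0n addr0.
by rewrite memNset ?/N2 /= ?expr0n ?addr0// => /eqP; rewrite (negPf cb).
Qed.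

(* psi_b^k = e^{sqrt(-1) k <b, theta>} sqrt(d'theta) on X_b. *)
Definition psi (b : bs_points) : hilb := Hilb (psi_subproof b).

End HilbertSpace.

Arguments bs_points R n k : clear implicits.

Section Observables.
Variables (R : realType) (n : nat).
Local Notation X := ('rV[R]_n * 'rV[R]_n)%type.

(* C_c^infinity(R^n x T^n); as T^n is compact, a function has compact support
   when it vanishes off K x T^n for some compact K. *)
Definition ccinf_pred (f : X -> R[i]) :=
  [/\ csmooth f,
      forall x, torus_periodic (fun th => f (x, th)) &
      exists2 K : set 'rV[R]_n, compact K & forall x th, ~ K x -> f (x, th) = 0].

Definition ccinf_set : {pred X -> R[i]} := fun f => `[< ccinf_pred f >].

Fact ccinf_submod_closed : submod_closed ccinf_set.
Proof.
split=> [|a f g].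
  apply/asboolP; split=> [|//|]; first exact: csmooth0.
  by exists set0 => //; exact: compact0.
move=> /asboolP[Sf Pf [K cK Kf]] /asboolP[Sg Pg [L cL Lg]]; apply/asboolP; split.
- exact: csmoothD (csmoothZ a Sf) Sg.
- move=> x th m; have := Pf x th m; have := Pg x th m => /= Eg Ef.
  by rewrite -[LHS]/(a * f _ + g _) Ef Eg.
exists (K `|` L); first exact: compactU.
move=> x th KLx; rewrite -[LHS]/(a * f _ + g _) Kf ?Lg ?mulr0 ?addr0//.
  by move=> Lx; apply: KLx; right.
by move=> Kx; apply: KLx; left.
Qed.

HB.instance Definition _ :=
  GRing.isSubmodClosed.Build R[i] (X -> R[i]) ccinf_set ccinf_submod_closed.

Record ccinf := CcInf { ccinf_val :> X -> R[i] ; _ : ccinf_val \in ccinf_set }.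

HB.instance Definition _ := [isSub for ccinf_val].
HB.instance Definition _ := [Choice of ccinf by <:].
HB.instance Definition _ := [SubChoice_isSubLmodule of ccinf by <:].

Fact ccinf_conj_subproof (f : ccinf) : (fun p => (f p)^*) \in ccinf_set.
Proof.
case: f => f /= /asboolP[Sf Pf [K cK Kf]]; apply/asboolP; split.
- exact: csmooth_conj.
- by move=> x th m; have /= -> := Pf x th m.
by exists K => // x th Kx; rewrite Kf// rmorph0.
Qed.

Definition ccinf_conj (f : ccinf) : ccinf := CcInf (ccinf_conj_subproof f).

(* d/dx_i and d/dtheta_i *)
Definition dx (i : 'I_n) (f : X -> R[i]) : X -> R[i] := cderive (delta_mx 0 i, 0) f.
Definition dth (i : 'I_n) (f : X -> R[i]) : X -> R[i] := cderive (0, delta_mx 0 i) f.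

Definition poisson_fun (f g : X -> R[i]) : X -> R[i] :=
  \sum_(i < n) (dx i f * dth i g - dth i f * dx i g).

Let ccinf_cderive f v : ccinf_pred f -> ccinf_pred (cderive v f).
Proof.
move=> [Sf Pf [K cK Kf]]; split.
- exact: csmooth_cderive.
- move=> x th m; set q : X := (0, (2 * pi) *: map_mx intr m).
  have fq p : f (p + q) = f p.
    case: p => y et; rewrite -[RHS](Pf y et m) /=; congr (f (_, _)).
    by rewrite /= addr0.
  have D (h : X -> R) : (forall p, h (p + q) = h p) -> forall p, 'D_v h (p + q) = 'D_v h p.
    move=> hq p.
    have E : (fun t : R => t^-1 *: ((h \o shift (p + q)) (t *: v) - h (p + q))) =
             (fun t : R => t^-1 *: ((h \o shift p) (t *: v) - h p)).
      by apply/funext => t /=; rewrite addrA !hq.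
    by rewrite /derive E.
  have -> : (x, th + (2 * pi) *: map_mx intr m) = (x, th) + q :> X.
    by congr (_, _); rewrite /= addr0.
  by rewrite /cderive !D// => p /=; rewrite fq.
exists K => // x th Kx; apply: cderive_near0.
have cl : closed K by exact: (compact_closed (@norm_hausdorff _ _) cK).
have oK : nbhs (x, th) ((~` K) `*` setT).
  exists (~` K, setT) => //; split=> /=; last exact: (@filterT _ (nbhs th) (@nbhs_filter _ th)).
  by apply: open_nbhs_nbhs; split => //; exact: closed_openC.
by apply: filterS oK => -[y et] [/= Ky _]; exact: Kf.
Qed.

Let ccinf_mul f g : ccinf_pred f -> ccinf_pred g -> ccinf_pred (f * g).
Proof.
move=> [Sf Pf [K cK Kf]] [Sg Pg [L cL Lg]]; split; first exact: csmoothM.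
  move=> x th m; have := Pf x th m; have := Pg x th m => /= Eg Ef.
  by rewrite -[LHS]/(f _ * g _) Ef Eg.
by exists K => // x th Kx; rewrite -[LHS]/(f _ * g _) Kf// mul0r.
Qed.

Fact poisson_subproof (f g : ccinf) : poisson_fun f g \in ccinf_set.
Proof.
case: f g => f /= /asboolP Tf [g /= /asboolP Tg].
rewrite /poisson_fun; apply: rpred_sum => i _; apply: rpredB; apply/asboolP;
  by apply: ccinf_mul; apply: ccinf_cderive.
Qed.

Definition poisson (f g : ccinf) : ccinf := CcInf (poisson_subproof f g).

Definition sup_norm (f : ccinf) : R := sup [set Normc.normc (f p) | p in [set: X]].

Definition weyl_coef k (f : ccinf) (b c : 'rV[R]_n) : R[i] :=
  ctorus_int (fun th => expi (- (k%:R * dotp (b - c) th)) * f (2^-1 *: (b + c), th)).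

Definition adjoint_preserving k (phi : ccinf -> bop R n k) :=
  forall f, is_adjoint (phi (ccinf_conj f)) (phi f).

Definition weyl_coefficients k (phi : ccinf -> bop R n k) :=
  forall f (b c : bs_points R n k),
    hdot (psi b) (phi f (psi c)) = weyl_coef k f (\val b) (\val c).

(* The index set N consists of the k > 0. *)
Definition strict_deformation_quantization
    (phi : forall k, {linear ccinf -> bop R n k}) :=
  [/\ forall k, (0 < k)%N -> adjoint_preserving (phi k),
      forall f, opnorm (phi k f) @[k --> \oo] --> sup_norm f &
      forall f g,
        (fun k => opnorm (commutator (phi k f) (phi k g) +
                          ('i%C * (k%:R^-1)%:C) *: phi k (poisson f g)))
        =O_\oo (fun k => k%:R ^- 2 : R)].

End Observables.

(* Main.v *)
Require Import Defs.
From HB Require Import structures.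
From mathcomp Require Import all_boot all_order all_algebra.
From mathcomp Require Import all_classical all_reals all_analysis.
From mathcomp Require Import complex.
From mathcomp Require Import finmap zify ring lra.

(** In the basis psi_b, with b = p/k, the operator phi^k(f) is the matrix whose
    (p, q) entry is F_f(p - q, (p + q)/2k), where F_f(m, x) is the m-th Fourier
    coefficient of f(x, .).  Integration by parts makes F_f and its Taylor
    remainders in x smaller than any power of w(m) = prod_i 1/(1 + m_i^2), so
    every error term below is controlled by Schur's test.

    Commutator: with l = p - q, m = p - r and x = (p + r)/2k, the (p, r) entry
    of phi^k(f) phi^k(g) is
      sum_l F_f(l, x + (m - l)/2k) F_g(m - l, x - l/2k),
    and exchanging f and g changes the signs of both displacements.  Hence the
    terms of order 0 and 2 cancel in the commutator, and the terms of order 1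
    are the Fourier coefficients of the Poisson bracket, by the convolution
    theorem.

    Norm: averaging over the translates of a box of side L changes the matrix
    by O(1/L); on each box the base point may be frozen at the cost of O(L/k);
    the frozen matrix is a Toeplitz matrix with symbol f(x, .), hence has norm
    at most sup |f|.  Conversely, testing against the plane wave
    q |-> e^(-i q theta0) cut off to a box of side L near k x0 recovers
    f(x0, theta0) up to O(1/L + L/k).  Let k, then L, tend to infinity. *)

Import Order.TTheory GRing.Theory Num.Theory.
Import numFieldNormedType.Exports.
Local Open Scope classical_set_scope.
Local Open Scope ring_scope.
Local Open Scope complex_scope.

Set Implicit Arguments.
Unset Strict Implicit.
Unset Printing Implicit Defensive.

(** Smoothness is given through directional derivatives and the torus integral is iterated one
    variable at a time. Derivatives are therefore handled by one device: expand to first order with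
    a remainder at most [C t^2], uniform by compact support, and compare terms as [t] tends to 0
    ([eq0_of_quadratic]). This yields additivity of the derivative in the direction, integration by
    parts (from translation invariance of the integral) and the passage of x-derivatives through
    Fourier coefficients, with no interchange of mixed partial derivatives. Fourier inversion, for
    absolutely summable coefficients, reduces to uniqueness, which is proved on the circle and
    carried to the torus by induction. The estimates concern finite sesquilinear forms ([mxbound]),
    which pass to [opnorm] in both directions; a bounded operator is determined by its matrix
    coefficients, so the result holds for every family having the prescribed ones. Powers of [wt]
    are a budget: an estimate asks for as many as it loses to displacements, one more for summation
    and, for the commutator, one for Peetre's inequality. *)

Local Notation nc := (@Normc.normc _).

(** * Modulus of complex numbers and unit exponentials *)

Section ComplexModulus.
Variable R : realType.
Implicit Types (z u : R[i]) (r : R).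

Lemma nc_ge0 z : 0 <= nc z.
Proof. by case: z => a b; exact: sqrtr_ge0. Qed.

Lemma nc0 : nc (0 : R[i]) = 0. Proof. exact: Normc.normc0. Qed.

Lemma nc1 : nc (1 : R[i]) = 1. Proof. exact: Normc.normc1. Qed.

Lemma ncM z u : nc (z * u) = nc z * nc u.
Proof. exact: Normc.normcM. Qed.

Lemma ler_ncD z u : nc (z + u) <= nc z + nc u.
Proof. exact: le_normcD. Qed.

Lemma ncN z : nc (- z) = nc z.
Proof. exact: normcN. Qed.

Lemma ler_ncB z u : nc (z - u) <= nc z + nc u.
Proof. by rewrite -(ncN u); exact: ler_ncD. Qed.

Lemma ncBC z u : nc (z - u) = nc (u - z).
Proof. by rewrite -ncN opprB. Qed.

Lemma nc_sqr z : nc z ^+ 2 = complex.Re z ^+ 2 + complex.Im z ^+ 2.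
Proof. by case: z => a b /=; rewrite sqr_sqrtr// addr_ge0 ?sqr_ge0. Qed.

Lemma nc_real r : nc (r%:C) = `|r|.
Proof. by rewrite /= expr0n/= addr0 sqrtr_sqr. Qed.

Lemma nc_conj z : nc (z^*) = nc z.
Proof. by case: z => a b /=; rewrite sqrrN. Qed.

Lemma nc_i : nc ('i%C : R[i]) = 1.
Proof. by rewrite /= expr0n /= expr1n add0r sqrtr1. Qed.

Lemma nc_expi r : nc (expi r) = 1.
Proof. by rewrite /= cos2Dsin2 sqrtr1. Qed.

Lemma normr_Re_le z : `|complex.Re z| <= nc z.
Proof.
by case: z => a b /=; rewrite -sqrtr_sqr ler_sqrt ?lerDl ?addr_ge0 ?sqr_ge0.
Qed.

Lemma normr_Im_le z : `|complex.Im z| <= nc z.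
Proof.
by case: z => a b /=; rewrite -sqrtr_sqr ler_sqrt ?lerDr ?addr_ge0 ?sqr_ge0.
Qed.

Lemma nc_le_ReIm z : nc z <= `|complex.Re z| + `|complex.Im z|.
Proof.
have -> : z = (complex.Re z)%:C + 'i%C * (complex.Im z)%:C.
  by case: z => a b; apply/eqP; rewrite eq_complex /=; apply/andP; split; apply/eqP; ring.
apply: le_trans (ler_ncD _ _) _; rewrite ncM nc_i !nc_real mul1r.
by case: z => a b /=; rewrite !(mul0r, mulr0, mul1r, addr0, add0r, subr0, oppr0).
Qed.

Lemma ler_nc_sum (I : Type) (s : seq I) (P : pred I) (F : I -> R[i]) :
  nc (\sum_(i <- s | P i) F i) <= \sum_(i <- s | P i) nc (F i).
Proof.
elim/big_ind2 : _ => [|x1 x2 y1 y2 h1 h2|//]; first by rewrite nc0.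
by apply: le_trans (ler_ncD _ _) _; exact: lerD.
Qed.

Lemma nc_eq0 z : nc z <= 0 -> z = 0.
Proof.
by move=> z0; apply: Normc.eq0_normc; apply/eqP; rewrite eq_le z0 nc_ge0.
Qed.

Lemma nc_eq_eps z u : (forall e, 0 < e -> nc (z - u) <= e) -> z = u.
Proof.
move=> h; apply/eqP; rewrite -subr_eq0; apply/eqP/nc_eq0.
by apply/ler_addgt0Pl => e e0; rewrite addr0; exact: h.
Qed.

Lemma Re_sum (I : Type) (s : seq I) (P : pred I) (F : I -> R[i]) :
  complex.Re (\sum_(i <- s | P i) F i) = \sum_(i <- s | P i) complex.Re (F i).
Proof. by apply: (big_morph (@complex.Re R)) => [[? ?] [? ?]|]. Qed.

Lemma expiD r (t : R) : expi (r + t) = expi r * expi t.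
Proof.
by rewrite /expi cosD sinD; apply/eqP; rewrite eq_complex /=; apply/andP; split; apply/eqP; ring.
Qed.

Lemma expiN r : expi (- r) = (expi r)^*.
Proof. by rewrite /expi cosN sinN. Qed.

Lemma expiNK r : expi (- r) * expi r = 1.
Proof. by rewrite -expiD addNr expi0. Qed.

End ComplexModulus.

(** * Sums over finite sets and their tails *)

Section FsetSums.
Variables (R : realType) (I : choiceType).
Implicit Types (X Y : {fset I}).

Lemma sum_fsetU_disjoint (V : nmodType) (X Y : {fset I}) (h : I -> V) :
  [disjoint X & Y]%fset ->
  \sum_(i <- (X `|` Y)%fset) h i = \sum_(i <- X) h i + \sum_(i <- Y) h i.
Proof.
move=> dXY; rewrite (big_fsetID _ (mem X)) /=.
rewrite (_ : [fset x in (X `|` Y)%fset | x \in X]%fset = X); last first.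
  by apply/fsetP => i; rewrite !inE; case: (i \in X); rewrite ?andbF.
rewrite (_ : [fset x in (X `|` Y)%fset | x \notin X]%fset = Y)//.
apply/fsetP => i; rewrite !inE; case iX: (i \in X); rewrite ?andbT ?andbF//=.
by apply/esym/negbTE; exact: (fdisjointP dXY).
Qed.

Lemma fsetUDK (X Y : {fset I}) : (X `<=` Y)%fset -> (X `|` (Y `\` X))%fset = Y.
Proof.
move=> XY; apply/fsetP => i; rewrite !inE.
by case iX: (i \in X) => //=; rewrite (fsubsetP XY).
Qed.

Lemma sum_fset_sub (X Y : {fset I}) (h : I -> R) : (forall i, 0 <= h i) ->
  (X `<=` Y)%fset -> \sum_(i <- X) h i <= \sum_(i <- Y) h i.
Proof.
move=> h0 XY; rewrite -(fsetUDK XY) sum_fsetU_disjoint ?lerDl ?sumr_ge0//.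
by apply/fdisjointP => i iX; rewrite !inE iX.
Qed.

Lemma sum_fsetD (V : zmodType) (X Y : {fset I}) (h : I -> V) : (X `<=` Y)%fset ->
  \sum_(i <- Y) h i - \sum_(i <- X) h i = \sum_(i <- (Y `\` X)%fset) h i.
Proof.
move=> XY; rewrite -[in LHS](fsetUDK XY) sum_fsetU_disjoint; first by rewrite addrAC subrr add0r.
by apply/fdisjointP => i iX; rewrite !inE iX.
Qed.

(** A finite sum within [e] of the supremum of all finite sums leaves at most [e] for any disjoint
    finite set. *)
Lemma fset_tail (h : I -> R) (B : R) : (forall i, 0 <= h i) ->
  (forall X, \sum_(i <- X) h i <= B) ->
  forall e, 0 < e -> exists X, forall Y, [disjoint X & Y]%fset ->
    \sum_(i <- Y) h i <= e.
Proof.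
move=> h0 hB e e0.
have hs : has_sup [set \sum_(i <- X) h i | X in [set: {fset I}]].
  split; first by exists (\sum_(i <- fset0%fset) h i); exists fset0%fset.
  by exists B => _ [X _ <-].
have [_ [X _ <-] Xe] := sup_adherent e0 hs.
exists X => Y XY.
have le := sup_upper_bound hs.
have {le} : \sum_(i <- X) h i + \sum_(i <- Y) h i <= sup [set \sum_(i <- X) h i | X in [set: {fset I}]].
  by apply: le; exists ((X `|` Y)%fset) => //; rewrite sum_fsetU_disjoint.
lra.
Qed.

End FsetSums.

(** * Unconditional convergence *)

Section UnconditionalSums.
Variables (R : realType) (I : choiceType).
Implicit Types (g h : I -> R[i]) (G H : R[i]) (X Y : {fset I}).

(* Convergence along the directed set of finite subsets of the index set. *)
Definition hsum g G := forall e : R, 0 < e ->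
  exists X, forall Y, (X `<=` Y)%fset -> nc (\sum_(i <- Y) g i - G) <= e.

Definition absbnd g (B : R) := forall X, \sum_(i <- X) nc (g i) <= B.

Lemma eq_hsum g h G : g =1 h -> hsum g G -> hsum h G.
Proof. by move=> /funext ->. Qed.

Lemma hsum_uniq g G H : hsum g G -> hsum g H -> G = H.
Proof.
move=> gG gH; apply: nc_eq_eps => e e0; have e2 : 0 < e / 2 by rewrite divr_gt0.
have [X hX] := gG _ e2; have [Y hY] := gH _ e2.
have := hX ((X `|` Y)%fset) (fsubsetUl _ _); have := hY ((X `|` Y)%fset) (fsubsetUr _ _).
set S := \sum_(i <- _) _ => h1 h2.
have -> : G - H = (S - H) - (S - G) by ring.
apply: le_trans (ler_ncB _ _) _; rewrite [e]splitr; exact: lerD.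
Qed.

Lemma hsumD g h G H : hsum g G -> hsum h H -> hsum (fun i => g i + h i) (G + H).
Proof.
move=> gG hH e e0; have e2 : 0 < e / 2 by rewrite divr_gt0.
have [X hX] := gG _ e2; have [Y hY] := hH _ e2.
exists ((X `|` Y)%fset) => Z XYZ; rewrite big_split /=.
have -> (a b : R[i]) : a + b - (G + H) = (a - G) + (b - H) by ring.
apply: le_trans (ler_ncD _ _) _; rewrite [e]splitr; apply: lerD.
  by apply: hX; apply: fsubset_trans XYZ; exact: fsubsetUl.
by apply: hY; apply: fsubset_trans XYZ; exact: fsubsetUr.
Qed.

Lemma hsumZ (a : R[i]) g G : hsum g G -> hsum (fun i => a * g i) (a * G).
Proof.
move=> gG e e0; have a0 : 0 < nc a + 1 by rewrite ltr_wpDl ?nc_ge0.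
have [X hX] := gG (e / (nc a + 1)) (divr_gt0 e0 a0); exists X => Y /hX le.
rewrite -mulr_sumr -mulrBr ncM.
apply: (@le_trans _ _ ((nc a + 1) * (e / (nc a + 1)))).
  by apply: ler_pM; rewrite ?nc_ge0// lerDl.
by rewrite mulrCA mulfV ?mulr1// gt_eqF.
Qed.

Lemma hsumB g h G H : hsum g G -> hsum h H -> hsum (fun i => g i - h i) (G - H).
Proof.
move=> gG hH; rewrite -[- H]mulN1r (_ : (fun i => _) = fun i => g i + (-1) * h i).
  by apply: hsumD => //; exact: hsumZ.
by apply/funext => i; rewrite mulN1r.
Qed.

Lemma hsum0 : hsum (fun _ => 0) 0.
Proof. by move=> e e0; exists fset0%fset => Y _; rewrite big1// subr0 nc0 ltW. Qed.

Lemma hsum_sum (J : Type) (s : seq J) (g : J -> I -> R[i]) (G : J -> R[i]) :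
  (forall j, hsum (g j) (G j)) ->
  hsum (fun i => \sum_(j <- s) g j i) (\sum_(j <- s) G j).
Proof.
move=> gG; elim: s => [|j s IH].
  rewrite big_nil (_ : (fun i => _) = fun _ => 0); first exact: hsum0.
  by apply/funext => i; rewrite big_nil.
rewrite big_cons (_ : (fun i => _) = fun i => g j i + \sum_(j <- s) g j i).
  exact: hsumD.
by apply/funext => i; rewrite big_cons.
Qed.

Lemma hsum_le g G (B : R) : (forall X, nc (\sum_(i <- X) g i) <= B) ->
  hsum g G -> nc G <= B.
Proof.
move=> gB gG; apply/ler_addgt0Pr => e e0; have [X /(_ X (fsubset_refl _)) hX] := gG _ e0.
have -> : G = \sum_(i <- X) g i - (\sum_(i <- X) g i - G) by ring.
by apply: le_trans (ler_ncB _ _) _; exact: lerD.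
Qed.

Lemma hsum_abs_le g G (B : R) : absbnd g B -> hsum g G -> nc G <= B.
Proof.
by move=> gB; apply: hsum_le => X; apply: le_trans (ler_nc_sum _ _ _) _; exact: gB.
Qed.

(** The set [X] is read off the tails alone. If the moduli of the terms do not depend on a
    parameter, one [X] serves all its values; this is how Fourier series will converge uniformly. *)
Lemma hsum_tail_le g G X (e : R) : hsum g G ->
  (forall Y, [disjoint X & Y]%fset -> \sum_(i <- Y) nc (g i) <= e) ->
  forall Y, (X `<=` Y)%fset -> nc (\sum_(i <- Y) g i - G) <= e.
Proof.
move=> gG tl Y XY; apply/ler_addgt0Pr => d d0; have [Z hZ] := gG _ d0.
have := hZ ((Y `|` Z)%fset) (fsubsetUr _ _) => h1.
have -> : \sum_(i <- Y) g i - G = (\sum_(i <- (Y `|` Z)%fset) g i - G) -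
   (\sum_(i <- (Y `|` Z)%fset) g i - \sum_(i <- Y) g i) by ring.
apply: le_trans (ler_ncB _ _) _; rewrite addrC; apply: lerD => //.
rewrite sum_fsetD ?fsubsetUl//; apply: le_trans (ler_nc_sum _ _ _) _; apply: tl.
by apply/fdisjointP => i iX; rewrite !inE (fsubsetP XY).
Qed.

Lemma hsum_fin g X : (forall i, i \notin X -> g i = 0) -> hsum g (\sum_(i <- X) g i).
Proof.
move=> g0 e e0; exists X => Y XY; rewrite -[in X in X <= _](fsetUDK XY).
rewrite sum_fsetU_disjoint; last by apply/fdisjointP => i iX; rewrite !inE iX.
have -> : \sum_(i <- (Y `\` X)%fset) g i = 0.
  rewrite big_seq big1// => i.
  by rewrite !inE => /andP[iX _]; exact: g0.
by rewrite addr0 subrr nc0 ltW.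
Qed.

Lemma sum_le_esum (h : I -> R) X :
  (\esum_(i in [set: I]) (h i)%:E < +oo)%E -> (forall i, 0 <= h i) ->
  \sum_(i <- X) h i <= fine (\esum_(i in [set: I]) (h i)%:E).
Proof.
move=> hoo h0; have E0 : (0 <= \esum_(i in [set: I]) (h i)%:E)%E.
  by apply: esum_ge0 => i _; rewrite lee_fin.
rewrite -lee_fin fineK ?ge0_fin_numE//; apply: ereal_sup_ubound => /=; exists [set` X]; first by split.
by rewrite fsbig_finite//= set_fsetK sumEFin.
Qed.

Lemma esum_le_bound (h : I -> R) (B : R) : (forall X, \sum_(i <- X) h i <= B) ->
  (\esum_(i in [set: I]) (h i)%:E <= B%:E)%E.
Proof.
move=> hB; apply: ge_ereal_sup => _ [A [fA _] <-].
by rewrite fsbig_finite//= sumEFin lee_fin.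
Qed.

Lemma esum_hsum (h : I -> R) (B : R) : (forall i, 0 <= h i) ->
  (forall X, \sum_(i <- X) h i <= B) ->
  hsum (fun i => (h i)%:C) (fine (\esum_(i in [set: I]) (h i)%:E))%:C.
Proof.
move=> h0 hB e e0; have [X tlX] := fset_tail h0 hB e0; exists X => Y XY.
have fin := le_lt_trans (esum_le_bound hB) (ltry _).
have le := sum_le_esum Y fin h0.
have : (\esum_(i in [set: I]) (h i)%:E <= (\sum_(i <- Y) h i + e)%:E)%E.
  apply: esum_le_bound => Z; apply: (@le_trans _ _ (\sum_(i <- (Z `|` Y)%fset) h i)).
    by apply: sum_fset_sub => //; exact: fsubsetUl.
  rewrite -(subrK (\sum_(i <- Y) h i) (\sum_(i <- (_ `|` _)%fset) h i)) addrC lerD2l.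
  rewrite sum_fsetD ?fsubsetUr//; apply: tlX.
  by apply/fdisjointP => i iX; rewrite !inE (fsubsetP XY).
rewrite -[X in (X <= _)%E]fineK ?lee_fin => [ge|]; last first.
  by rewrite ge0_fin_numE//; apply: esum_ge0 => i _; rewrite lee_fin.
by rewrite -rmorph_sum -rmorphB nc_real ler_norml; apply/andP; split; lra.
Qed.

(** Bridge from [usum], a difference of two extended-real suprema, to convergence along finite sets:
    both the positive and the negative part are dominated by [|h i|], so neither supremum is
    infinite. *)
Lemma hsum_usum (h : I -> R) (B : R) :
  (forall X, \sum_(i <- X) `|h i| <= B) -> hsum (fun i => (h i)%:C) (usum h)%:C.
Proof.
move=> hB; rewrite /usum rmorphB.
rewrite (_ : (fun i => _) = fun i => (Num.max (h i) 0)%:C - (Num.max (- h i) 0)%:C).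
  apply: hsumB; apply: (@esum_hsum _ B) => [i|X]; rewrite ?le_max ?lexx ?orbT//;
    apply: le_trans (hB X); apply: ler_sum => i _; rewrite ge_max normr_ge0 andbT.
    exact: ler_norm.
  by rewrite -normrN ler_norm.
apply/funext => i; rewrite -rmorphB; congr (_%:C).
by rewrite !maxEle; case: ifP; case: ifP; lra.
Qed.

Lemma hsum_cusum g (B : R) : absbnd g B -> hsum g (cusum g).
Proof.
move=> gB.
have -> : cusum g = (usum (@complex.Re R \o g))%:C + 'i%C * (usum (@complex.Im R \o g))%:C.
  by apply/eqP; rewrite eq_complex /=; apply/andP; split; apply/eqP; ring.
apply: (@eq_hsum (fun i => (complex.Re (g i))%:C + 'i%C * (complex.Im (g i))%:C)) => [i|].
  case: (g i) => a b.
  by apply/eqP; rewrite eq_complex /=; apply/andP; split; apply/eqP; ring.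
apply: hsumD; last apply: hsumZ; apply: (@hsum_usum _ B) => X;
    apply: le_trans (gB X); apply: ler_sum => i _.
    exact: normr_Re_le.
  exact: normr_Im_le.
Qed.

Lemma cusumE g G (B : R) : absbnd g B -> hsum g G -> cusum g = G.
Proof. by move=> gB; apply: hsum_uniq; exact: (hsum_cusum gB). Qed.

End UnconditionalSums.

Lemma hsum_bij (R : realType) (I J : choiceType) (u : I -> J) (v : J -> I)
    (g : J -> R[i]) (G : R[i]) : cancel u v -> cancel v u ->
  hsum g G -> hsum (g \o u) G.
Proof.
move=> uv vu gG e e0; have [X hX] := gG e e0.
exists (v @` X)%fset => Y XY; have := hX (u @` Y)%fset.
rewrite big_imfset/=; last by move=> x y _ _; exact: (can_inj uv).
apply; apply/fsubsetP => j jX; apply/imfsetP; exists (v j) => //=.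
by apply: (fsubsetP XY); exact: in_imfset.
Qed.

(** * The weight [wt] and its summability *)

Section Weight.
Variables (R : realType) (n : nat).
Implicit Types (m l : 'rV[int]_n).

(** This is the Fourier multiplier of the product over [i] of [1 - (d/dtheta_i)^2]. The product form
    makes sums over cubes factor into one-dimensional sums. *)
Definition iwt m : R := \prod_(i < n) (1 + (m 0 i)%:~R ^+ 2).
Definition wt m : R := (iwt m)^-1.

Lemma iwt_ge1 m : 1 <= iwt m.
Proof.
rewrite /iwt; elim/big_rec : _ => // i x _ x1.
apply: (le_trans x1); apply: ler_peMl; first exact: le_trans ler01 x1.
by rewrite lerDl sqr_ge0.
Qed.

Lemma iwt_gt0 m : 0 < iwt m. Proof. exact: lt_le_trans ltr01 (iwt_ge1 m). Qed.

Lemma wt_gt0 m : 0 < wt m. Proof. by rewrite invr_gt0 iwt_gt0. Qed.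

Lemma wt_ge0 m : 0 <= wt m. Proof. exact/ltW/wt_gt0. Qed.

Lemma wt_le1 m : wt m <= 1.
Proof. by rewrite invf_le1 ?iwt_gt0 ?iwt_ge1. Qed.

Lemma iwtK m : wt m * iwt m = 1.
Proof. by rewrite mulVf// gt_eqF// iwt_gt0. Qed.

Lemma coord_le_iwt m i : `|(m 0 i)%:~R| <= iwt m.
Proof.
rewrite /iwt (bigD1 i)//=; apply: (@le_trans _ _ (1 + (m 0 i)%:~R ^+ 2)).
  rewrite -[_ ^+ 2]ger0_norm ?sqr_ge0// normrX.
  set x := `|_|; have : 0 <= (x - 1) ^+ 2 by exact: sqr_ge0.
  have : 0 <= x by exact: normr_ge0.
  by rewrite !expr2; lra.
apply: ler_peMr; first by rewrite addr_ge0 ?sqr_ge0.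
elim/big_rec : _ => // j x _ x1.
apply: (le_trans x1); apply: ler_peMl; first exact: le_trans ler01 x1.
by rewrite lerDl sqr_ge0.
Qed.

Lemma l1norm_le_iwt m : \sum_(i < n) `|(m 0 i)%:~R| <= n%:R * iwt m.
Proof.
apply: le_trans (ler_sum _ (fun i _ => coord_le_iwt m i)) _.
by rewrite sumr_const card_ord mulr_natl.
Qed.

Lemma iwtN m : iwt (- m) = iwt m.
Proof. by apply: eq_bigr => i _; rewrite mxE rmorphN sqrrN. Qed.

Lemma iwt_peetre m l : iwt (m + l) <= 2 ^+ n * (iwt m * iwt l).
Proof.
rewrite /iwt -big_split /= -[in 2 ^+ n](card_ord n) -prodr_const -big_split /=.
apply: ler_prod => i _; rewrite addr_ge0 ?sqr_ge0//= mxE rmorphD /=.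
set a := _%:~R; set b := _%:~R.
rewrite -subr_ge0 (_ : _ - _ = 1 + (a - b) ^+ 2 + 2 * (a * b) ^+ 2); last by ring.
by have := sqr_ge0 (a - b); have := sqr_ge0 (a * b); lra.
Qed.

(* Peetre's inequality: it turns the decay of a product of two coefficients
   into decay in the total frequency m. *)
Lemma wt_peetre m l : wt l * wt (m - l) <= 2 ^+ n * wt m.
Proof.
rewrite -[leLHS]mulr1 -(iwtK m) mulrCA mulrC ler_pM2r ?wt_gt0//.
have := iwt_peetre l (m - l); rewrite addrC subrK => h.
apply: le_trans (ler_wpM2l _ h) _; first by rewrite mulr_ge0 ?wt_ge0.
rewrite [leLHS](_ : _ = 2 ^+ n * ((wt l * iwt l) * (wt (m - l) * iwt (m - l)))); last by ring.
by rewrite !iwtK !mulr1.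
Qed.

Definition boxv (L : nat) (z : int) (j : {ffun 'I_n -> 'I_L}) : 'rV[int]_n :=
  \row_i (z + (j i : nat)%:Z).

Lemma boxv_inj L z : injective (@boxv L z).
Proof.
move=> j j' /rowP h; apply/ffunP => i; apply: val_inj; apply/eqP.
by have := h i; rewrite !mxE => /addrI/eqP; rewrite eqz_nat.
Qed.

Lemma fset_box (X : {fset 'rV[int]_n}) : exists N : nat, forall m, m \in X ->
  exists j, m = @boxv N.*2.+1 (- N%:Z) j.
Proof.
pose N := (\max_(m <- X) \max_(i < n) absz (m 0%R i))%N; exists N => m mX.
have le i : (absz (m 0%R i) <= N)%N.
  apply: (@leq_trans (\max_(i < n) absz (m 0%R i))); first exact: leq_bigmax.
  by rewrite /N (big_fsetD1 m)//= leq_maxl.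
have [bl bu] : (forall i, - N%:Z <= m 0 i) /\ (forall i, m 0 i <= N%:Z).
  by split => i; have := le i; lia.
exists [ffun i => inord (absz (m 0 i + N%:Z))]; apply/rowP => i.
by rewrite mxE ffunE inordK; have := bl i; have := bu i; lia.
Qed.

(* Comparison with the telescoping sum of g(x) = x / (1 + |x|). *)
Lemma sum_inv_sqr (M : nat) (z : int) :
  \sum_(t < M) (1 + (z + (t : nat)%:Z)%:~R ^+ 2)^-1 <= 8 :> R.
Proof.
pose g (x : R) := x / (1 + `|x|).
have g1 x : `|g x| <= 1.
  rewrite /g normrM normfV [X in _ / X]ger0_norm ?addr_ge0//.
  by rewrite ler_pdivrMr ?mul1r ?lerDr// ltr_pwDl.
(* As [y] is an integer, [y] and [y + 1] lie on the same side of 0, so both absolute values in [g]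
   resolve at once. The factor 4 here and the oscillation 2 of [g] give the final 8. *)
have st (y : int) : (1 + y%:~R ^+ 2)^-1 <= 4 * (g (y + 1)%:~R - g y%:~R).
  rewrite /g rmorphD /=; have [y0|y0] : 0 <= (y%:~R : R) \/ (y%:~R : R) <= -1.
    have [?|?] := leP 0 y; [left; rewrite ler0z//|right].
    by rewrite -[-1]/((-1)%:~R) ler_int; lia.
  - rewrite !ger0_norm ?addr_ge0//; set x : R := _%:~R in y0 *.
    rewrite (_ : 4 * _ = 4 / ((1 + x) * (2 + x))); last first.
      by field; apply/andP; split; apply/eqP; lra.
    rewrite -[leLHS]mul1r ler_pdivrMr; last by have := sqr_ge0 x; lra.
    rewrite mulrAC ler_pdivlMr; last by rewrite mulr_gt0//; lra.
    by rewrite expr2; nra.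
  - set x : R := _%:~R in y0 *; rewrite !ler0_norm; [|lra|lra].
    rewrite (_ : 4 * _ = 4 / (- x * (1 - x))); last first.
      by field; apply/and3P; split; apply/eqP; lra.
    rewrite -[leLHS]mul1r ler_pdivrMr; last by have := sqr_ge0 x; lra.
    rewrite mulrAC ler_pdivlMr; last by rewrite mulr_gt0//; lra.
    by rewrite expr2; nra.
apply: (@le_trans _ _ (\sum_(t < M) 4 * (g (z + (t.+1 : nat)%:Z)%:~R - g (z + (t : nat)%:Z)%:~R))).
  apply: ler_sum => t _; apply: le_trans (st _) _.
  by rewrite -addrA -PoszD addn1.
rewrite -mulr_sumr -(big_mkord xpredT (fun t => g (z + (t.+1 : nat)%:Z)%:~R - g (z + (t : nat)%:Z)%:~R)).
rewrite telescope_sumr//; have := g1 (z + (M : nat)%:Z)%:~R; have := g1 (z + (0 : nat)%:Z)%:~R.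
rewrite !ler_norml => /andP[? ?] /andP[? ?]; lra.
Qed.

(** Enlarge the finite set to a cube centred at 0; there the sum of products is the product of [n]
    one-dimensional sums, each at most 8. *)
Lemma wt_summable (X : {fset 'rV[int]_n}) : \sum_(m <- X) wt m <= 8 ^+ n.
Proof.
have [N hN] := fset_box X.
apply: (@le_trans _ _ (\sum_(m <- [fset (@boxv N.*2.+1 (- N%:Z) j) | j in {ffun 'I_n -> 'I_N.*2.+1}]%fset) wt m)).
  apply: sum_fset_sub; first exact: wt_ge0.
  by apply/fsubsetP => m /hN [j ->]; exact: in_imfset.
rewrite big_imfset /=; last by move=> j j' _ _; exact: boxv_inj.
rewrite big_enum /=.
under eq_bigr do rewrite /wt /iwt -prodfV.
under eq_bigr do under eq_bigr do rewrite mxE.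
rewrite -(bigA_distr_bigA (fun (i : 'I_n) (t : 'I_N.*2.+1) => (1 + (- N%:Z + (t : nat)%:Z)%:~R ^+ 2)^-1 : R)).
rewrite -[in 8 ^+ n](card_ord n) -prodr_const.
apply: ler_prod => i _; rewrite sum_inv_sqr andbT.
by apply: sumr_ge0 => t _; rewrite invr_ge0 addr_ge0 ?sqr_ge0.
Qed.

End Weight.

(** * The circle average *)

Lemma continuous_pair (U V W : topologicalType) (f : U -> V) (g : U -> W) :
  continuous f -> continuous g -> continuous (fun u => (f u, g u)).
Proof. by move=> cf cg u; exact: (cvg_pair (cf u) (cg u)). Qed.

Lemma continuous_scale (R : realType) (V : topologicalType) (c : R) (g : V -> R) :
  continuous g -> continuous (fun x => c * g x).
Proof. by move=> cg x; exact: (cvgM (@cst_continuous V R c x) (cg x)). Qed.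

Lemma continuous_addl (R : realType) (V : normedModType R) (a : V) :
  continuous (fun x => x + a).
Proof.
move=> x; apply: (@continuous_comp _ _ _ (fun x => (x, a)) (fun z : V * V => z.1 + z.2)).
  by apply: continuous_pair => y; [exact: cvg_id|exact: cst_continuous].
exact: add_continuous.
Qed.

Section CircleAverage.
Variable R : realType.
Implicit Types (G H : R -> R).

Lemma pi2_gt0 : 0 < 2 * pi :> R.
Proof. by rewrite mulr_gt0// pi_gt0. Qed.

Definition avg1 G : R :=
  (2 * pi)^-1 * \int[lebesgue_measure]_(t in `[0, 2 * pi]) G t.

Lemma continuous_integrable_itv G (a b : R) : continuous G ->
  lebesgue_measure.-integrable `[a, b] (EFin \o G).
Proof.
move=> cG; apply: continuous_compact_integrable; first exact: segment_compact.
exact: continuous_subspaceT.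
Qed.

Lemma avg1D G H : continuous G -> continuous H ->
  avg1 (fun t => G t + H t) = avg1 G + avg1 H.
Proof.
move=> cG cH; rewrite /avg1 -mulrDr RintegralD//; exact: continuous_integrable_itv.
Qed.

Lemma avg1Z (a : R) G : continuous G -> avg1 (fun t => a * G t) = a * avg1 G.
Proof.
move=> cG; rewrite /avg1 RintegralZl//; first by rewrite mulrCA.
exact: continuous_integrable_itv.
Qed.

Lemma avg1_cst (c : R) : avg1 (fun=> c) = c.
Proof.
rewrite /avg1 Rintegral_cst//= lebesgue_measure_itv/= lte_fin.
by rewrite pi2_gt0 sube0 /= mulrCA mulVf ?mulr1// gt_eqF// pi2_gt0.
Qed.

Lemma avg1_le G H : continuous G -> continuous H ->
  (forall t, 0 <= t <= 2 * pi -> G t <= H t) -> avg1 G <= avg1 H.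
Proof.
move=> cG cH le; rewrite /avg1 ler_pM2l ?invr_gt0 ?pi2_gt0//.
apply: le_Rintegral => //; do ?exact: continuous_integrable_itv.
Qed.

(** Compactness of [[0, 2 pi]] turns continuity of [F] at each [(u, t)] into one neighbourhood of
    [u] that serves all [t]. The parameter space is arbitrary so that the integral can be
    iterated. *)
Lemma avg1_continuous (U : topologicalType) (F : U * R -> R) : continuous F ->
  continuous (fun u => avg1 (fun t => F (u, t))).
Proof.
move=> cF u; apply/cvgrPdist_le => e e0.
have cFt v : continuous (fun t => F (v, t)).
  move=> t; apply: (@continuous_comp _ _ _ (fun t => (v, t)) F); last exact: cF.
  by apply: continuous_pair => x; [exact: cvg_cst|exact: cvg_id].
have near_all : \forall v \near u, `[0, 2 * pi]%classic `<=` [set t | `|F (u, t) - F (v, t)| <= e].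
  have /compact_near_coveringP K := @segment_compact R 0 (2 * pi).
  apply: (K _ (nbhs u) (fun v t => `|F (u, t) - F (v, t)| <= e)) => t _.
  have e2 : 0 < e / 2 by rewrite divr_gt0.
  have /cvgrPdist_le/(_ _ e2)[[/= A B] [At Bu] AB] := cF (u, t).
  exists (B, A); first by split.
  move=> [t' v] [/= Bt' Av]; rewrite [e]splitr.
  have h1 := AB (u, t') (conj (nbhs_singleton At) Bt').
  have h2 := AB (v, t') (conj Av Bt').
  rewrite (_ : F (u, t') - F (v, t') = (F (u, t) - F (v, t')) - (F (u, t) - F (u, t'))); last by ring.
  by apply: le_trans (ler_normB _ _) _; exact: lerD.
near=> v; have hv : `[0, 2 * pi]%classic `<=` [set t | `|F (u, t) - F (v, t)| <= e] by near: v.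
have cFB : continuous (fun t => F (u, t) - F (v, t)).
  by move=> t; apply: continuousB; exact: cFt.
have -> : avg1 (fun t => F (u, t)) - avg1 (fun t => F (v, t)) = avg1 (fun t => F (u, t) - F (v, t)).
  rewrite -[X in _ + X]mulN1r -avg1Z// -avg1D//.
    by congr avg1; apply/funext => t; rewrite mulN1r.
  by move=> t; apply: cvgM; [exact: cvg_cst|exact: cFt].
rewrite ler_norml; apply/andP; split.
  rewrite -[leLHS]avg1_cst; apply: avg1_le => //; first by move=> ?; exact: cvg_cst.
  by move=> t t2; have := hv t; rewrite /= in_itv /= => /(_ t2); rewrite ler_norml => /andP[].
rewrite -[leRHS]avg1_cst; apply: avg1_le => //; first by move=> ?; exact: cvg_cst.
by move=> t t2; have := hv t; rewrite /= in_itv /= => /(_ t2); rewrite ler_norml => /andP[].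
Unshelve. all: by end_near. Qed.

(** Integrating from a base point [M] gives a primitive to the right of [M] only. Taking [M]
    strictly to the left of every point of interest keeps those points interior and avoids one-sided
    derivatives. *)
Lemma primitive_gt (K : R -> R) (M : R) : continuous K ->
  exists P : R -> R, forall x, M < x -> is_derive x 1 P (K x).
Proof.
move=> cK; exists (fun x => \int[lebesgue_measure]_(t in `[M, x]) K t) => x Mx.
have xu : x < x + 1 by rewrite ltrDl.
have [d e] := continuous_FTC1_closed xu (continuous_integrable_itv M (x + 1) cK) Mx (cK x).
by split; [exact: d|rewrite -derive1E; exact: e].
Qed.

Lemma avg1_FTC (K P : R -> R) : continuous K ->
  (forall x : R, -1 < x -> is_derive x 1 P (K x)) ->
  avg1 K = (2 * pi)^-1 * (P (2 * pi) - P 0).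
Proof.
move=> cK dP; rewrite /avg1; congr (_ * _).
have cP (x : R) : -1 < x -> {for x, continuous P}.
  by move=> /dP[dx _]; apply: differentiable_continuous; exact/derivable1_diffP.
have m1 : -1 < 0 :> R by rewrite oppr_lt0.
have p1 : -1 < 2 * pi :> R by apply: lt_trans m1 pi2_gt0.
rewrite /Rintegral (@continuous_FTC2 R K P)//=.
- exact: pi2_gt0.
- exact: continuous_subspaceT.
- split.
  + by move=> x; rewrite in_itv /= => /andP[x0 _]; have [] := dP x (lt_trans m1 x0).
  + exact: cvg_at_right_filter (cP _ m1).
  + exact: cvg_at_left_filter (cP _ p1).
- move=> x; rewrite in_itv /= => /andP[x0 _].
  by have [_ <-] := dP x (lt_trans m1 x0); rewrite derive1E.
Qed.

(** For a primitive [P] of [K], the difference [D x = P (x + 2 pi) - P x] has derivative 0 by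
    periodicity; the two averages are [D a] and [D 0] up to the normalization. *)
Lemma avg1_shift (K : R -> R) (a : R) : continuous K ->
  (forall t, K (t + 2 * pi) = K t) -> avg1 (fun t => K (t + a)) = avg1 K.
Proof.
move=> cK pK; have [P dP] := primitive_gt (- (`|a| + 1)) cK.
have a1 (x : R) : -1 < x -> - (`|a| + 1) < x + a.
  by have := ler_norm (- a); rewrite normrN => ? ?; lra.
have x1 (x : R) : -1 < x -> - (`|a| + 1) < x.
  by have := normr_ge0 a => ? ?; lra.
have p0 := pi2_gt0.
have dsh (c x : R) : is_derive (x + c) 1 P (K (x + c)) -> is_derive x 1 (fun y => P (y + c)) (K (x + c)).
  move=> d; have ds : is_derive x 1 (fun y : R => y + c) 1.
    by apply: is_derive_eq; rewrite addr0.
  have := @is_derive1_comp R P (fun y => y + c) x (K (x + c)) 1 d ds.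
  by rewrite mulr1.
have cKa : continuous (fun t => K (t + a)).
  move=> x; apply: (@continuous_comp _ _ _ (fun t => t + a) K); last exact: cK.
  by apply: cvgD; [exact: cvg_id|exact: cvg_cst].
have dPa (x : R) : -1 < x -> is_derive x 1 (fun t => P (t + a)) (K (x + a)).
  by move=> /a1 h; exact/dsh/dP.
have dP1 (x : R) : -1 < x -> is_derive x 1 P (K x) by move=> /x1; exact: dP.
rewrite (avg1_FTC cKa dPa) (avg1_FTC cK dP1).
congr (_ * _); pose D x := P (x + 2 * pi) - P x.
have dD (x : R) : - (`|a| + 1) < x -> is_derive x 1 D 0.
  move=> xa; rewrite (_ : 0 = K (x + 2 * pi) - K x); last by rewrite pK subrr.
  apply: is_deriveB; last exact: dP.
  by apply/dsh/dP; rewrite (lt_le_trans xa)// lerDl ltW.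
have cD (x : R) : - (`|a| + 1) < x -> {for x, continuous D}.
  by move=> /dD[dx _]; apply: differentiable_continuous; exact/derivable1_diffP.
have Dc (u v : R) : - (`|a| + 1) < u -> u <= v -> D v = D u.
  move=> ua; rewrite le_eqVlt => /predU1P[->//|uv].
  have := @MVT R D (fun=> 0) u v uv; case.
  - by move=> x; rewrite in_itv /= => /andP[ux _]; apply: dD; exact: lt_trans ua ux.
  - apply: derivable_within_continuous => x; rewrite in_itv /= => /andP[ux _].
    by have [] := dD x (lt_le_trans ua ux).
  by move=> c _ /eqP; rewrite mul0r subr_eq0 => /eqP.
have : D a = D 0.
  have l0 : - (`|a| + 1) < 0 by have := normr_ge0 a; lra.
  have la : - (`|a| + 1) < a by have := a1 0; rewrite add0r; apply; lra.
  by have [/Dc|/ltW/Dc] := leP 0 a; [apply|move=> ->].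
by rewrite /D !add0r => <-; rewrite (addrC a).
Qed.

End CircleAverage.

(** * Integration over the torus *)

(** Componentwise, like [ctorus_int], so that statements on real integrals apply to each part
    directly. *)
Definition ccont (R : realType) (V : topologicalType) (u : V -> R[i]) :=
  continuous (@complex.Re R \o u) /\ continuous (@complex.Im R \o u).

Section ComplexContinuity.
Variables (R : realType) (V : topologicalType).
Implicit Types (u w : V -> R[i]).


Lemma ccont_comp (W : topologicalType) (u : V -> R[i]) (h : W -> V) :
  continuous h -> ccont u -> ccont (u \o h).
Proof.
move=> ch [cr ci]; split.
  by move=> x; exact: (continuous_comp (ch x) (cr (h x))).
by move=> x; exact: (continuous_comp (ch x) (ci (h x))).
Qed.

Lemma eq_ccont u w : u =1 w -> ccont u -> ccont w.
Proof. by move=> /funext ->. Qed.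

Lemma ccont_cst (c : R[i]) : ccont (fun _ : V => c).
Proof. by split=> x; exact: cvg_cst. Qed.

Lemma ccontD u w : ccont u -> ccont w -> ccont (fun x => u x + w x).
Proof.
move=> [cu du] [cw dw]; split=> x /=.
  rewrite (_ : _ \o _ = fun x => complex.Re (u x) + complex.Re (w x)).
    by apply: cvgD; [exact: cu|exact: cw].
  by apply/funext => y /=; case: (u y) (w y) => [? ?] [].
rewrite (_ : _ \o _ = fun x => complex.Im (u x) + complex.Im (w x)).
  by apply: cvgD; [exact: du|exact: dw].
by apply/funext => y /=; case: (u y) (w y) => [? ?] [].
Qed.

Lemma ccontM u w : ccont u -> ccont w -> ccont (fun x => u x * w x).
Proof.
move=> [cu du] [cw dw]; split=> x /=.
  rewrite (_ : _ \o _ = fun x => complex.Re (u x) * complex.Re (w x) - complex.Im (u x) * complex.Im (w x)).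
    by apply: cvgB; apply: cvgM; [exact: cu|exact: cw|exact: du|exact: dw].
  by apply/funext => y /=; case: (u y) (w y) => [? ?] [].
rewrite (_ : _ \o _ = fun x => complex.Re (u x) * complex.Im (w x) + complex.Im (u x) * complex.Re (w x)).
  by apply: cvgD; apply: cvgM; [exact: cu|exact: dw|exact: du|exact: cw].
by apply/funext => y /=; case: (u y) (w y) => [? ?] [].
Qed.

Lemma ccont_conj u : ccont u -> ccont (fun x => (u x)^*).
Proof.
move=> [cu du]; split=> x /=.
  rewrite (_ : _ \o _ = @complex.Re R \o u); first exact: cu.
  by apply/funext => y /=; case: (u y).
rewrite (_ : _ \o _ = fun x => - complex.Im (u x)); first by apply: cvgN; exact: du.
by apply/funext => y /=; case: (u y).
Qed.

Lemma ccontZ (a : R[i]) u : ccont u -> ccont (fun x => a * u x).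
Proof. by apply: ccontM; exact: ccont_cst. Qed.

Lemma ccontB u w : ccont u -> ccont w -> ccont (fun x => u x - w x).
Proof.
move=> cu cw; apply: (@eq_ccont (fun x => u x + (-1) * w x)) => [x|].
  by rewrite mulN1r.
by apply: ccontD => //; exact: ccontZ.
Qed.

Lemma ccont_sum (I : Type) (s : seq I) (F : I -> V -> R[i]) :
  (forall i, ccont (F i)) -> ccont (fun x => \sum_(i <- s) F i x).
Proof.
move=> cF; elim: s => [|i s IH].
  by apply: (@eq_ccont (fun _ : V => 0)) => [x|]; [rewrite big_nil|exact: ccont_cst].
apply: (@eq_ccont (fun x => F i x + \sum_(i <- s) F i x)) => [x|].
  by rewrite big_cons.
exact: ccontD.
Qed.

Lemma ccont_real (h : V -> R) : continuous h -> ccont (fun x => (h x)%:C).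
Proof. by move=> ch; split=> x /=; [exact: ch|exact: cvg_cst]. Qed.

Lemma ccont_expi (h : V -> R) : continuous h -> ccont (fun x => expi (h x)).
Proof.
move=> ch; split=> x /=.
  exact: (continuous_comp (ch x) (@continuous_cos R (h x))).
exact: (continuous_comp (ch x) (@continuous_sin R (h x))).
Qed.

Lemma ccont_nc_sqr u : ccont u -> continuous (fun x => nc (u x) ^+ 2).
Proof.
move=> [cu du]; rewrite (_ : (fun _ => _) = fun x => complex.Re (u x) ^+ 2 + complex.Im (u x) ^+ 2).
  by move=> x; apply: cvgD; apply: (cvgM (cu x) (cu x)) || apply: (cvgM (du x) (du x)).
by apply/funext => x; rewrite nc_sqr.
Qed.

End ComplexContinuity.

Section TorusIntegral.
Variable R : realType.

Definition consr n (t : R) (th : 'rV[R]_n) : 'rV[R]_n.+1 := row_mx (t%:M : 'rV[R]_1) th.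

Lemma consr0 n t (th : 'rV[R]_n) : consr t th 0 0 = t.
Proof.
transitivity (consr t th 0 (lshift n (0 : 'I_1))); first by congr (consr t th _ _); exact: val_inj.
have := @row_mxEl R 1 1 n t%:M th 0 0.
by rewrite [X in _ = X]mxE mulr1n.
Qed.

Lemma consrS n t (th : 'rV[R]_n) i : consr t th 0 (lift ord0 i) = th 0 i.
Proof.
transitivity (consr t th 0 (rshift 1 i)); first by congr (consr t th _ _); exact: val_inj.
exact: (@row_mxEr R 1 1 n t%:M th 0 i).
Qed.

Lemma consrP n (v : 'rV[R]_n.+1) : v = consr (v 0 0) (\row_i v 0 (lift ord0 i)).
Proof.
apply/rowP => i; case: (unliftP ord0 i) => [j ->|->]; last by rewrite consr0.
by rewrite consrS mxE.
Qed.

Lemma consrD n t s (th et : 'rV[R]_n) : consr t th + consr s et = consr (t + s) (th + et).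
Proof.
apply/rowP => i; case: (unliftP ord0 i) => [j ->|->]; rewrite mxE ?consrS ?consr0//.
by rewrite mxE.
Qed.

Lemma consr_continuous n : continuous (fun p : R * 'rV[R]_n => consr p.1 p.2).
Proof.
move=> [t th]; apply/cvg_ballP => e e0; near=> p => /=.
split=> // i j; rewrite !ord1 => {i}.
have [p1 p2] : `|t - p.1| < e /\ ball th e p.2.
  near: p; exists (ball t e, ball th e) => /=.
    by split; exact: nbhsx_ballx.
  by move=> [x y] [/= hx hy]; split.
case: (unliftP ord0 j) => [k ->|->]; last by rewrite !consr0.
by rewrite !consrS; exact: p2.2.
Unshelve. all: by end_near. Qed.

(** The induction needs every parameter space at once: the first torus variable is moved into the
    parameter, from [U] to [U * R], before the induction hypothesis is applied. *)
Lemma torus_int_continuous n (U : topologicalType) (F : U * 'rV[R]_n -> R) :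
  continuous F -> continuous (fun u => torus_int (fun th => F (u, th))).
Proof.
elim: n U F => [|n IH] U F cF /=.
  move=> u; apply: (@continuous_comp _ _ _ (fun u : U => (u, 0 : 'rV[R]_0)) F); last exact: cF.
  by apply: continuous_pair => x; [exact: cvg_id|exact: cvg_cst].
pose F' (q : (U * R) * 'rV[R]_n) := F (q.1.1, consr q.1.2 q.2).
have cF' : continuous F'.
  move=> q; apply: (@continuous_comp _ _ _ (fun q : (U * R) * 'rV[R]_n => (q.1.1, consr q.1.2 q.2)) F); last exact: cF.
  apply: continuous_pair => x.
    by apply: (continuous_comp (@cvg_fst _ _ _ _ _) (@cvg_fst _ _ _ _ _)).
  apply: (@continuous_comp _ _ _ (fun q : (U * R) * 'rV[R]_n => (q.1.2, q.2)) (fun p => consr p.1 p.2)); last exact: consr_continuous.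
  apply: continuous_pair => y; last exact: cvg_snd.
  by apply: (continuous_comp (@cvg_fst _ _ _ _ _) (@cvg_snd _ _ _ _ _)).
exact: (@avg1_continuous R U (fun p => torus_int (fun th => F' (p, th))) (IH _ _ cF')).
Qed.

Lemma consr_cont_slice n (g : 'rV[R]_n.+1 -> R) t : continuous g ->
  continuous (fun th => g (consr t th)).
Proof.
move=> cg x; apply: (@continuous_comp _ _ _ (fun th => consr t th) g); last exact: cg.
apply: (@continuous_comp _ _ _ (fun th : 'rV[R]_n => (t, th)) (fun p => consr p.1 p.2)).
  by apply: continuous_pair => y; [exact: cst_continuous|exact: cvg_id].
exact: consr_continuous.
Qed.

Lemma torus_int_slice_cont n (g : 'rV[R]_n.+1 -> R) : continuous g ->
  continuous (fun t => torus_int (fun th => g (consr t th))).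
Proof.
move=> cg; apply: (@torus_int_continuous n R (fun p => g (consr p.1 p.2))).
by move=> x; apply: continuous_comp; [exact: consr_continuous|exact: cg].
Qed.

Lemma torus_intD n (g h : 'rV[R]_n -> R) : continuous g -> continuous h ->
  torus_int (fun th => g th + h th) = torus_int g + torus_int h.
Proof.
elim: n g h => [//|n IH] g h cg ch /=.
rewrite -/(avg1 _) -(avg1D (torus_int_slice_cont cg) (torus_int_slice_cont ch)).
by congr avg1; apply/funext => t; rewrite -IH//; exact: consr_cont_slice.
Qed.

Lemma torus_intZ n (a : R) (g : 'rV[R]_n -> R) : continuous g ->
  torus_int (fun th => a * g th) = a * torus_int g.
Proof.
elim: n g => [//|n IH] g cg /=.
rewrite -/(avg1 _) -(avg1Z a (torus_int_slice_cont cg)).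
by congr avg1; apply/funext => t; rewrite -IH//; exact: consr_cont_slice.
Qed.

Lemma torus_int_le n (g h : 'rV[R]_n -> R) : continuous g -> continuous h ->
  (forall th, g th <= h th) -> torus_int g <= torus_int h.
Proof.
elim: n g h => [|n IH] g h cg ch gh /=; first exact: gh.
apply: (avg1_le (torus_int_slice_cont cg) (torus_int_slice_cont ch)) => t _.
by apply: IH => //; exact: consr_cont_slice.
Qed.

Definition rperiodic n (g : 'rV[R]_n -> R) :=
  forall th (m : 'rV[int]_n), g (th + (2 * pi) *: map_mx intr m) = g th.

Lemma torus_int_shift n (g : 'rV[R]_n -> R) (a : 'rV[R]_n) : continuous g ->
  rperiodic g -> torus_int (fun th => g (th + a)) = torus_int g.
Proof.
elim: n g a => [|n IH] g a cg pg /=; first by congr g; apply/rowP => -[].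
rewrite -!/(avg1 _).
pose K t := torus_int (fun th => g (consr t th)).
transitivity (avg1 (fun t => K (t + a 0 0))).
  congr avg1; apply/funext => t; rewrite /K.
  pose a' := \row_i a 0 (lift ord0 i).
  rewrite -(IH (fun th => g (consr (t + a 0 0) th)) a'); first last.
  (* A period in the last coordinates becomes a period of [g] after a 0 is put in front of it. *)
  - move=> th m; pose m' : 'rV[int]_n.+1 := \row_i oapp (fun j => m 0 j) 0 (unlift ord0 i).
    rewrite -(pg (consr (t + a 0 0) th) m'); congr g; apply/rowP => i.
    case: (unliftP ord0 i) => [j ->|->].
      by rewrite consrS [RHS]mxE consrS [LHS]mxE; congr (_ + _); rewrite !mxE liftK.
    by rewrite consr0 [RHS]mxE consr0 !mxE unlift_none /= mulr0 addr0.
  - exact: consr_cont_slice.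
  by congr torus_int; apply/funext => th; rewrite {1}(consrP a) consrD.
apply: avg1_shift; first exact: torus_int_slice_cont.
move=> t; rewrite /K; congr torus_int; apply/funext => th.
pose m' : 'rV[int]_n.+1 := \row_i (if i == ord0 then 1 else 0).
rewrite -(pg (consr t th) m'); congr g; apply/rowP => i.
case: (unliftP ord0 i) => [j ->|->].
  by rewrite [LHS]consrS mxE consrS !mxE /= mulr0 addr0.
by rewrite consr0 mxE consr0 !mxE /= mulr1.
Qed.

End TorusIntegral.

(** * Fourier series on the torus *)

Section ComplexTorusIntegral.
Variables (R : realType) (n : nat).
Implicit Types (u w : 'rV[R]_n -> R[i]) (m l : 'rV[int]_n).

Lemma cintD u w : ccont u -> ccont w ->
  ctorus_int (fun th => u th + w th) = ctorus_int u + ctorus_int w.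
Proof.
move=> [cu du] [cw dw]; rewrite /ctorus_int; apply/eqP; rewrite eq_complex /=.
rewrite -(torus_intD cu cw) -(torus_intD du dw); apply/andP; split; apply/eqP;
  by congr torus_int; apply/funext => th /=; case: (u th) (w th) => [? ?] [].
Qed.

Lemma cintZ (a : R[i]) u : ccont u ->
  ctorus_int (fun th => a * u th) = a * ctorus_int u.
Proof.
move=> [cu du]; case: a => a b; rewrite /ctorus_int; apply/eqP; rewrite eq_complex /=.
have cZ c g := @continuous_scale R 'rV[R]_n c g.
rewrite -mulNr -(torus_intZ a cu) -(torus_intZ a du) -(torus_intZ (- b) du) -(torus_intZ b cu).
rewrite -(torus_intD (cZ a _ cu) (cZ (- b) _ du)) -(torus_intD (cZ a _ du) (cZ b _ cu)).
by apply/andP; split; apply/eqP; congr torus_int; apply/funext => th /=;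
  case: (u th) => [? ?] /=; rewrite ?mulNr.
Qed.

Lemma cintB u w : ccont u -> ccont w ->
  ctorus_int (fun th => u th - w th) = ctorus_int u - ctorus_int w.
Proof.
move=> cu cw; rewrite -[in RHS]mulN1r -cintZ// -cintD//; last exact: ccontZ.
by congr ctorus_int; apply/funext => th; rewrite mulN1r.
Qed.

Lemma cint_sum (I : Type) (s : seq I) (F : I -> 'rV[R]_n -> R[i]) :
  (forall i, ccont (F i)) ->
  ctorus_int (fun th => \sum_(i <- s) F i th) = \sum_(i <- s) ctorus_int (F i).
Proof.
move=> cF; elim: s => [|i s IH].
  rewrite big_nil -[RHS](ctorus_int_cst n); congr ctorus_int.
  by apply/funext => th; rewrite big_nil.
rewrite big_cons -IH -cintD//; last exact: ccont_sum.
by congr ctorus_int; apply/funext => th; rewrite big_cons.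
Qed.

(** Multiplying [u] by the conjugate of its integral [z] makes the integral equal to [|z|^2], so the
    triangle inequality reduces to monotonicity of the real integral. *)
Lemma cint_le u (h : 'rV[R]_n -> R) : ccont u -> continuous h ->
  (forall th, nc (u th) <= h th) -> nc (ctorus_int u) <= torus_int h.
Proof.
move=> cu ch uh; set z := ctorus_int u.
have h0 : 0 <= torus_int h.
  rewrite -(torus_int_cst n 0); apply: torus_int_le => //; first exact: cst_continuous.
  by move=> th; apply: le_trans (uh th); exact: nc_ge0.
have [z0|z0] := leP (nc z) 0; first exact: le_trans z0 h0.
rewrite -(ler_pM2l z0) -expr2 -torus_intZ//.
have -> : nc z ^+ 2 = complex.Re (z^* * z).
  by rewrite nc_sqr; case: (z) => a b /=; ring.
rewrite -[X in _ * X]/(ctorus_int u) -cintZ//=.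
apply: torus_int_le.
- exact: (ccontZ _ cu).1.
- exact: continuous_scale.
move=> th /=; apply: le_trans (ler_norm _) _; apply: le_trans (normr_Re_le _) _.
by rewrite ncM nc_conj ler_pM2l.
Qed.

Lemma cint_bound u (B : R) : ccont u -> (forall th, nc (u th) <= B) ->
  nc (ctorus_int u) <= B.
Proof.
move=> cu uB; rewrite -(torus_int_cst n B); apply: cint_le => //.
exact: cst_continuous.
Qed.

Lemma cint_shift u a : ccont u -> torus_periodic u ->
  ctorus_int (fun th => u (th + a)) = ctorus_int u.
Proof.
move=> [cu du] pu; rewrite /ctorus_int; congr (_ +i* _).
  rewrite -(torus_int_shift a cu)//.
  by move=> th m /=; rewrite pu.
rewrite -(torus_int_shift a du)//.
by move=> th m /=; rewrite pu.
Qed.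

Definition chr m (th : 'rV[R]_n) : R[i] := expi (dotp (map_mx intr m) th).

Lemma dotp_continuous (b : 'rV[R]_n) : continuous (dotp b).
Proof.
have addc : continuous (fun z : R * R => z.1 + z.2) by exact: add_continuous.
apply: (continuous_big addc) => i _.
by apply: continuous_scale; exact: coord_continuous.
Qed.

Lemma dotpNl (b th : 'rV[R]_n) : dotp (- b) th = - dotp b th.
Proof. by rewrite -scaleN1r dotpZl mulN1r. Qed.

Lemma dotpDl (b c th : 'rV[R]_n) : dotp (b + c) th = dotp b th + dotp c th.
Proof. by rewrite -big_split; apply: eq_bigr => i _; rewrite mxE mulrDl. Qed.

Lemma ccont_chr m : ccont (chr m).
Proof. by apply: ccont_expi; exact: dotp_continuous. Qed.

Lemma chrD m (th et : 'rV[R]_n) : chr m (th + et) = chr m th * chr m et.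
Proof. by rewrite /chr dotpDr expiD. Qed.

Lemma chrDl m l th : chr (m + l) th = chr m th * chr l th.
Proof. by rewrite /chr map_mxD dotpDl expiD. Qed.

Lemma chrN m th : chr (- m) th = (chr m th)^*.
Proof. by rewrite /chr map_mxN dotpNl expiN. Qed.

Lemma chr0 th : chr 0 th = 1.
Proof.
rewrite /chr [dotp _ _]big1 ?expi0// => i _.
by rewrite !mxE mul0r.
Qed.

Lemma nc_chr m th : nc (chr m th) = 1. Proof. exact: nc_expi. Qed.

Lemma chr_periodic m : torus_periodic (chr m).
Proof.
move=> th p; rewrite /chr dotpDr dotpZr.
rewrite [dotp _ (map_mx _ _)](_ : _ = (\sum_(i < n) m 0 i * p 0 i)%:~R).
  exact: expiD2pi.
by rewrite rmorph_sum; apply: eq_bigr => i _; rewrite !mxE rmorphM.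
Qed.

Lemma torus_periodicM u w : torus_periodic u -> torus_periodic w ->
  torus_periodic (fun th => u th * w th).
Proof. by move=> pu pw th m; rewrite pu pw. Qed.

Lemma torus_periodicB u w : torus_periodic u -> torus_periodic w ->
  torus_periodic (fun th => u th - w th).
Proof. by move=> pu pw th m; rewrite pu pw. Qed.

(** If some [m 0 i] is nonzero, translation by half a wavelength in that coordinate multiplies
    [chr m] by -1 but preserves the integral, which therefore equals its opposite. *)
Lemma cint_chr m : ctorus_int (chr m) = (m == 0)%:R.
Proof.
have [->|m0] := eqVneq m 0.
  rewrite -[RHS](ctorus_int_cst n); congr ctorus_int.
  by apply/funext => th; rewrite chr0.
have [i mi] : exists i, m 0 i != 0.
  by apply/existsP; apply: contraNT m0; rewrite negb_exists => /forallP h;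
    apply/eqP/rowP => i; rewrite mxE; apply/eqP; have := h i; rewrite negbK.
pose a : 'rV[R]_n := (pi / (m 0 i)%:~R) *: delta_mx 0 i.
have chra : chr m a = -1.
  rewrite /chr /a dotpZr [dotp _ _](bigD1 i)//= big1 => [|j ji]; last first.
    by rewrite !mxE (negPf ji) andbF mulr0.
  rewrite !mxE !eqxx mulr1 addr0 mulfVK ?intr_eq0//.
  by rewrite /expi cospi sinpi; apply/eqP; rewrite eq_complex /= oppr0 !eqxx.
have := cint_shift a (ccont_chr m) (chr_periodic m).
rewrite (_ : (fun th => _) = fun th => -1 * chr m th); last first.
  by apply/funext => th; rewrite chrD chra mulrC.
rewrite cintZ; last exact: ccont_chr.
rewrite mulN1r => /eqP; rewrite -subr_eq0 -opprD oppr_eq0 -mulr2n mulrn_eq0 /=.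
by move=> /eqP.
Qed.

Lemma parseval_fset (X : {fset 'rV[int]_n}) (x : 'rV[int]_n -> R[i]) :
  torus_int (fun th => nc (\sum_(p <- X) x p * chr p th) ^+ 2) =
  \sum_(p <- X) nc (x p) ^+ 2.
Proof.
have cS : ccont (fun th => \sum_(p <- X) x p * chr p th).
  by apply: ccont_sum => p; apply: ccontZ; exact: ccont_chr.
transitivity (complex.Re (ctorus_int (fun th =>
   (\sum_(p <- X) x p * chr p th)^* * \sum_(q <- X) x q * chr q th))).
  rewrite /ctorus_int /=; congr torus_int; apply/funext => th /=.
  by rewrite nc_sqr; case: (\sum_(p <- X) _) => a b /=; ring.
rewrite (_ : (fun th => _) = fun th => \sum_(p <- X) \sum_(q <- X)
    ((x p)^* * x q) * chr (q - p) th); last first.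
  apply/funext => th; rewrite rmorph_sum /= mulr_suml; apply: eq_bigr => p _.
  rewrite mulr_sumr; apply: eq_bigr => q _.
  by rewrite rmorphM /= chrDl chrN; ring.
have cc p q : ccont (fun th => ((x p)^* * x q) * chr (q - p) th).
  by apply: ccontZ; exact: ccont_chr.
rewrite cint_sum => [|p]; last by apply: ccont_sum.
rewrite Re_sum; apply: eq_big_seq => p pX.
rewrite cint_sum// (big_fsetD1 p)//= big_seq big1 => [|q]; last first.
  rewrite !inE => /andP[qp _]; rewrite cintZ ?cint_chr; last exact: ccont_chr.
  by rewrite subr_eq0 (negPf qp) mulr0.
rewrite cintZ ?cint_chr; last exact: ccont_chr.
by rewrite subrr eqxx mulr1 addr0 nc_sqr; case: (x p) => a b /=; ring.
Qed.

End ComplexTorusIntegral.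

(** * Uniqueness of Fourier coefficients *)

Section FourierUniqueness.
Variable R : realType.

Definition cavg1 (G : R -> R[i]) : R[i] :=
  avg1 (@complex.Re R \o G) +i* avg1 (@complex.Im R \o G).

Lemma ctorus_intS n (u : 'rV[R]_n.+1 -> R[i]) :
  ctorus_int u = cavg1 (fun t => ctorus_int (fun th => u (consr t th))).
Proof. by []. Qed.

Lemma cavg1D (G H : R -> R[i]) : ccont G -> ccont H ->
  cavg1 (fun t => G t + H t) = cavg1 G + cavg1 H.
Proof.
move=> [cu du] [cw dw]; rewrite /cavg1; apply/eqP; rewrite eq_complex /=.
rewrite -(avg1D cu cw) -(avg1D du dw); apply/andP; split; apply/eqP;
  by congr avg1; apply/funext => th /=; case: (G th) (H th) => [? ?] [].
Qed.

Lemma cavg1Z (a : R[i]) (G : R -> R[i]) : ccont G ->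
  cavg1 (fun t => a * G t) = a * cavg1 G.
Proof.
move=> [cu du]; case: a => a b; rewrite /cavg1; apply/eqP; rewrite eq_complex /=.
have cZ (c : R) (g : R -> R) : continuous g -> continuous (fun th => c * g th).
  by move=> cg x; apply: cvgM; [exact: cst_continuous|exact: cg].
rewrite -mulNr -(avg1Z a cu) -(avg1Z a du) -(avg1Z (- b) du) -(avg1Z b cu).
rewrite -(avg1D (cZ a _ cu) (cZ (- b) _ du)) -(avg1D (cZ a _ du) (cZ b _ cu)).
by apply/andP; split; apply/eqP; congr avg1; apply/funext => th /=;
  case: (G th) => [? ?] /=; rewrite ?mulNr.
Qed.

Lemma bernoulli_ineq (x : R) (N : nat) : 0 <= x -> 1 + N%:R * x <= (1 + x) ^+ N.
Proof.
move=> x0; elim: N => [|N IH]; first by rewrite mul0r addr0 expr0.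
have N0 : 0 <= N%:R * x * x by rewrite !mulr_ge0.
rewrite exprS; apply: le_trans (_ : (1 + x) * (1 + N%:R * x) <= _); last first.
  by rewrite ler_pM2l// ltr_pwDl.
rewrite -natr1 -subr_ge0 [leRHS](_ : _ = N%:R * x * x)//; ring.
Qed.

(** The integral over a subinterval is represented by an increment of one primitive, so the mean
    value theorem bounds each piece and the pieces add up by telescoping. *)
Lemma primitive_lower (P K : R -> R) (a b L : R) :
  (forall x : R, -1 < x -> is_derive x 1 P (K x)) -> 0 <= a -> a <= b ->
  (forall x, a <= x <= b -> L <= K x) -> L * (b - a) <= P b - P a.
Proof.
move=> dP a0; rewrite le_eqVlt => /predU1P[->|ab] LK; first by rewrite !subrr mulr0.
have m1 (x : R) : a <= x -> -1 < x by move=> ax; lra.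
have := @MVT R P K a b ab; case.
- by move=> x; rewrite in_itv /= => /andP[ax _]; apply/dP/m1/ltW.
- apply: derivable_within_continuous => x; rewrite in_itv /= => /andP[ax _].
  by have [] := dP x (m1 x ax).
move=> c; rewrite in_itv /= => /andP[ac cb] ->.
by apply: ler_wpM2r; [rewrite subr_ge0 ltW|apply: LK; rewrite !ltW].
Qed.

(* Rudin's kernel: Q is at least 1 on the delta-neighbourhood of t0, bounded by
   1 in modulus off it, and bounded below by some q0 > 1 near t0. *)
Lemma circle_moments_le0 (H : R -> R[i]) (t0 : R) : ccont H ->
  (forall l : int, cavg1 (fun t => H t * expi (l%:~R * t)) = 0) ->
  0 < t0 < 2 * pi -> complex.Re (H t0) <= 0.
Proof.
move=> cH mH /andP[t00 t0p]; rewrite leNgt; apply/negP => H0.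
have pi0 : 0 < pi :> R := pi_gt0 R.
have [d0 d00 nearH] : exists2 d0 : R, 0 < d0 & forall t, `|t - t0| < d0 ->
    complex.Re (H t0) / 2 <= complex.Re (H t).
  have h2 : 0 < complex.Re (H t0) / 2 by rewrite divr_gt0.
  have /cvgrPdist_le/(_ _ h2) := cH.1 t0.
  move=> /nbhs_ballP[d /= d0 sub]; exists d => // t td.
  have : ball t0 d t by rewrite /ball /= distrC.
  move=> /sub /=; rewrite ler_norml => /andP[_]; lra.
set c := complex.Re (H t0) / 2 in nearH.
have c0 : 0 < c by rewrite divr_gt0.
(* [d < d0] keeps [Re H] above [c] near [t0]; [d <= pi / 2] keeps the compared arguments where
   cosine decreases; the last two bounds keep the neighbourhood inside [[0, 2 pi]] and give
   [|t - t0| <= 2 pi - d] there, so that [cos (t - t0) <= cos d] off the neighbourhood. *)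
pose d := Num.min (Num.min (d0 / 2) (pi / 2)) (Num.min t0 (2 * pi - t0)).
have dgt0 : 0 < d by rewrite !lt_min !divr_gt0//= t00 subr_gt0.
have dd0 : d < d0.
  apply: (@le_lt_trans _ _ (d0 / 2)); last by lra.
  by rewrite !ge_min lexx.
have dpi : d <= pi / 2 by rewrite !ge_min lexx !orbT.
have dt0 : d <= t0 by rewrite !ge_min lexx !orbT.
have dt1 : d <= 2 * pi - t0 by rewrite !ge_min lexx !orbT.
have cosle (x y : R) : 0 <= x -> x <= y -> y <= pi -> cos y <= cos x.
  move=> x0; rewrite le_eqVlt => /predU1P[->//|xy] yp; apply/ltW.
  by rewrite ltr_cos// in_itv /=; apply/andP; split; lra.
pose Q (t : R) := 1 - cos d + cos (t - t0).
pose q := cos (d / 2) - cos d.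
have q_gt0 : 0 < q.
  by rewrite subr_gt0 ltr_cos ?in_itv /=; [lra|apply/andP; split; lra|apply/andP; split; lra].
have Q1 t : `|t - t0| <= d -> 1 <= Q t.
  move=> td; have : cos d <= cos `|t - t0| by apply: cosle => //; lra.
  by rewrite cos_norm /Q; lra.
have Q2 t : `|t - t0| <= d / 2 -> 1 + q <= Q t.
  move=> td; have : cos (d / 2) <= cos `|t - t0| by apply: cosle => //; lra.
  by rewrite cos_norm /Q /q; lra.
have Q3 t : 0 <= t -> t <= 2 * pi -> d <= `|t - t0| -> `|Q t| <= 1.
  move=> t1 t2 td; have : cos (t - t0) <= cos d.
    rewrite -cos_norm; have [yp|yp] := leP `|t - t0| pi; first by apply: cosle; lra.
    have y2 : `|t - t0| <= 2 * pi - d by rewrite ler_norml; apply/andP; split; lra.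
    rewrite -(cosN `|_|) -(cosD2pi (- `|t - t0|)) (_ : - _ + _ = 2 * pi - `|t - t0|).
      by apply: cosle; lra.
    by rewrite -[pi *+ 2]mulr_natl addrC.
  have := cos_geN1 (t - t0); have := cos_le1 d.
  by rewrite /Q ler_norml => ? ? ?; apply/andP; split; lra.
have cQ : continuous Q.
  move=> x; apply: cvgD; first exact: cvg_cst.
  apply: (@continuous_comp R R R (fun t : R => t - t0) (@cos R)); last exact: continuous_cos.
  by apply: cvgD; [exact: cvg_id|exact: cvg_cst].
have cQN N : continuous (fun t => Q t ^+ N).
  by move=> x; exact: (continuous_comp (cQ x) (@exprn_continuous R N (Q x))).
have clin (l : int) : ccont (fun t : R => expi (l%:~R * t)).
  by apply: ccont_expi => x; apply: cvgM; [exact: cvg_cst|exact: cvg_id].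
have cHQ N : ccont (fun t => H t * (Q t ^+ N)%:C).
  by apply: ccontM => //; apply: ccont_real.
(* [Q] combines 1, [expi t] and [expi (- t)], so each factor of [Q] only shifts the frequency [l] by
   at most 1 and all moments stay 0. *)
have mom N : forall l : int, cavg1 (fun t => H t * (Q t ^+ N)%:C * expi (l%:~R * t)) = 0.
  elim: N => [|N IH] l.
    rewrite -[RHS](mH l); congr cavg1; apply/funext => t.
    by rewrite expr0 mulr1.
  pose T (j : int) (t : R) := H t * (Q t ^+ N)%:C * expi (j%:~R * t).
  have cT j : ccont (T j) by apply: ccontM.
  rewrite (_ : (fun t => _) = fun t => (1 - cos d)%:C * T l t + (2^-1%:C * expi (- t0) * T (l + 1) t
      + 2^-1%:C * expi t0 * T (l - 1) t)); last first.
    apply/funext => t; rewrite /T exprSr rmorphM /Q rmorphD rmorphB !rmorphD /= !mulrDl !mul1r.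
    rewrite rmorphN /= mulN1r !expiD.
    have -> : (cos (t - t0))%:C = 2^-1%:C * (expi (- t0) * expi t + expi t0 * expi (- t)).
      rewrite -!expiD /expi (addrC (- t0)) -[t0 - t]opprB cosN sinN.
      by apply/eqP; rewrite eq_complex /=; apply/andP; split; apply/eqP; field.
    by ring.
  rewrite cavg1D; [|exact: ccontZ|by apply: ccontD; apply: ccontZ].
  rewrite cavg1D; [|exact: ccontZ|exact: ccontZ].
  by rewrite !cavg1Z// !IH !mulr0 !addr0.
pose K N t := complex.Re (H t) * Q t ^+ N.
have avgK N : avg1 (K N) = 0.
  have := mom N 0; rewrite /cavg1 => -[+ _] => <-; congr avg1; apply/funext => t /=.
  by rewrite mul0r expi0 mulr1 /K; case: (H t) => a b /=; rewrite mulr0 subr0.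
have cK N : continuous (K N).
  by move=> x; apply: cvgM; [exact: cH.1|exact: cQN].
have [B B0 HB] : exists2 B : R, 0 <= B & forall t, 0 <= t <= 2 * pi -> `|complex.Re (H t)| <= B.
  have cn : continuous (fun t => `|complex.Re (H t)|).
    by move=> x; exact: (continuous_comp (cH.1 x) (@norm_continuous _ R _)).
  have [s _ sm] := EVT_max (ltW (pi2_gt0 R)) (continuous_subspaceT cn).
  exists `|complex.Re (H s)| => //.
(* The integral of [K N] is 0. Cut it at [t0 - d / 2] and [t0 + d / 2]: the middle piece is at least
   [c * (1 + q) ^+ N * d], and the outer ones are at least [- B] times their lengths. The resulting
   bound does not depend on [N], while the left side grows geometrically. *)
have key N : c * (1 + q) ^+ N * d <= 2 * pi * B.
  have [P dP] := primitive_gt (-1) (cK N).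
  have PE : P (2 * pi) - P 0 = 0.
    have /eqP := avg1_FTC (cK N) dP; rewrite avgK eq_sym mulf_eq0 invr_eq0.
    by rewrite gt_eqF ?pi2_gt0//= => /eqP.
  have lowB t : 0 <= t -> t <= 2 * pi -> - B <= K N t.
    move=> t1 t2; have hB := HB t; rewrite t1 t2 in hB; have {}hB := hB isT.
    have [td|td] := leP `|t - t0| d.
      apply: (@le_trans _ _ 0); first by rewrite oppr_le0.
      apply: mulr_ge0; last by apply: exprn_ge0; have := Q1 t td; lra.
      by apply: le_trans (ltW c0) _; apply: nearH; exact: le_lt_trans td dd0.
    suff : `|K N t| <= B by rewrite ler_norml => /andP[].
    rewrite /K normrM normrX -[B]mulr1; apply: ler_pM => //.
    by apply: exprn_ile1 => //; apply: Q3 => //; exact: ltW.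
  have midL t : t0 - d / 2 <= t <= t0 + d / 2 -> c * (1 + q) ^+ N <= K N t.
    move=> /andP[t1 t2]; have td : `|t - t0| <= d / 2.
      by rewrite ler_norml; apply/andP; split; lra.
    apply: ler_pM; [exact: ltW|by apply: exprn_ge0; lra| |].
      by apply: nearH; lra.
    by rewrite lerXn2r ?nnegrE; [|lra|have := Q1 t; lra|exact: Q2].
  have l1 := @primitive_lower P (K N) 0 (t0 - d / 2) (- B) dP (lexx _).
  have l2 := @primitive_lower P (K N) (t0 - d / 2) (t0 + d / 2) (c * (1 + q) ^+ N) dP.
  have l3 := @primitive_lower P (K N) (t0 + d / 2) (2 * pi) (- B) dP.
  have {}l1 : - B * (t0 - d / 2 - 0) <= P (t0 - d / 2) - P 0.
    by apply: l1 => [|x /andP[? ?]]; [lra|apply: lowB; lra].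
  have {}l2 : c * (1 + q) ^+ N * (t0 + d / 2 - (t0 - d / 2)) <= P (t0 + d / 2) - P (t0 - d / 2).
    by apply: l2 => //; lra.
  have {}l3 : - B * (2 * pi - (t0 + d / 2)) <= P (2 * pi) - P (t0 + d / 2).
    by apply: l3 => [||x /andP[? ?]]; [lra|lra|apply: lowB; lra].
  have e2 : t0 + d / 2 - (t0 - d / 2) = d by field.
  rewrite e2 in l2; have : 0 <= B * d by rewrite mulr_ge0// ltW.
  have : P (2 * pi) - P 0 = (P (t0 - d / 2) - P 0) + (P (t0 + d / 2) - P (t0 - d / 2)) + (P (2 * pi) - P (t0 + d / 2)) by ring.
  rewrite PE => E ?.
  have E1 : - B * (t0 - d / 2 - 0) + - B * (2 * pi - (t0 + d / 2)) = - (2 * pi * B) + B * d by field.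
  by lra.
have pB0 : 0 <= 2 * pi * B by rewrite mulr_ge0// ltW// pi2_gt0.
have cdq0 : 0 < c * d * q by rewrite !mulr_gt0.
have [] := archi_boundP (divr_ge0 pB0 (ltW cdq0)).
set N := Num.bound _ => hN.
have := key N; apply/negP; rewrite -ltNge.
move: hN; rewrite ltr_pdivrMr// => hN; apply: lt_le_trans hN _.
have b := bernoulli_ineq N (ltW q_gt0).
have cd0 : 0 < c * d by rewrite mulr_gt0.
rewrite [leRHS](_ : _ = c * d * (1 + q) ^+ N); last by ring.
apply: le_trans (_ : c * d * (1 + N%:R * q) <= _); last by rewrite ler_pM2l.
rewrite [leLHS](_ : _ = c * d * (N%:R * q)); last by ring.
by rewrite ler_pM2l// lerDr.
Qed.

(** Multiplying [H] by the constant [(H t0)^*] preserves the vanishing moments and makes the real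
    part at [t0] equal to [|H t0|^2]. *)
Lemma circle_uniq (H : R -> R[i]) (t0 : R) : ccont H ->
  (forall l : int, cavg1 (fun t => H t * expi (l%:~R * t)) = 0) ->
  0 < t0 < 2 * pi -> H t0 = 0.
Proof.
move=> cH mH t0p; apply: nc_eq0; rewrite -(@ler_pXn2r _ 2)// ?nnegrE ?nc_ge0//.
rewrite expr0n /=.
have -> : nc (H t0) ^+ 2 = complex.Re ((H t0)^* * H t0).
  by rewrite nc_sqr; case: (H t0) => a b /=; ring.
apply: (@circle_moments_le0 (fun t => (H t0)^* * H t)) => //; first exact: ccontZ.
move=> l; rewrite -[RHS](mulr0 ((H t0)^*)) -(mH l) -cavg1Z; last first.
  apply: ccontM => //; apply: ccont_expi => x.
  by apply: cvgM; [exact: cvg_cst|exact: cvg_id].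
by congr cavg1; apply/funext => t; rewrite mulrA.
Qed.

Lemma chr_consr n (p : 'rV[int]_n.+1) t (th : 'rV[R]_n) :
  chr p (consr t th) =
  expi ((p 0 0)%:~R * t) * chr (\row_i p 0 (lift ord0 i)) th.
Proof.
rewrite /chr -expiD; congr expi; rewrite /dotp big_ord_recl mxE consr0; congr (_ + _).
by apply: eq_bigr => i _; rewrite consrS !mxE.
Qed.

(** For each character of the last variables, the partial integral is a function on the circle with
    vanishing moments, hence is 0 at the first coordinate of [th]; the induction hypothesis then
    applies to that slice. The restriction to interior points comes from the circle case. *)
Lemma torus_uniq n (u : 'rV[R]_n -> R[i]) : ccont u ->
  (forall m, ctorus_int (fun th => u th * chr m th) = 0) ->
  forall th : 'rV[R]_n, (forall i, 0 < th 0 i < 2 * pi) -> u th = 0.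
Proof.
elim: n u => [|n IH] u cu mu th th0.
  transitivity (ctorus_int (fun _ : 'rV[R]_0 => u th)); first by rewrite ctorus_int_cst.
  rewrite -[RHS](mu 0); congr ctorus_int; apply/funext => et.
  by rewrite chr0 mulr1; congr u; apply/rowP => -[].
have csl t : ccont (fun th => u (consr t th)).
  by split; apply: (@consr_cont_slice R n (_ \o u)); [exact: cu.1|exact: cu.2].
rewrite (consrP th); apply: (IH (fun th' => u (consr (th 0 0) th'))) => //; last first.
  by move=> i; rewrite mxE.
move=> m; pose F t th' := u (consr t th') * chr m th'.
apply: (@circle_uniq (fun t => ctorus_int (F t))) => //.
  have cF : ccont (fun p : R * 'rV[R]_n => F p.1 p.2).
    apply: ccontM.
      by apply: (@ccont_comp R _ _ u (fun p => consr p.1 p.2)); [exact: consr_continuous|].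
    apply: (@ccont_comp R _ _ (chr m) (fun p : R * 'rV[R]_n => p.2)); last exact: ccont_chr.
    by move=> p; exact: cvg_snd.
  split.
    exact: (@torus_int_continuous R n R (fun p => complex.Re (F p.1 p.2)) cF.1).
  exact: (@torus_int_continuous R n R (fun p => complex.Im (F p.1 p.2)) cF.2).
move=> l; pose p : 'rV[int]_n.+1 := \row_i oapp (fun j => m 0 j) l (unlift ord0 i).
rewrite -[RHS](mu p) ctorus_intS; congr cavg1; apply/funext => t.
rewrite mulrC -cintZ; last by apply: ccontM => //; exact: ccont_chr.
congr ctorus_int; apply/funext => et; rewrite chr_consr /F.
rewrite mxE unlift_none /= (_ : \row_i p 0 (lift ord0 i) = m); first by ring.
by apply/rowP => i; rewrite !mxE liftK.
Qed.

(** A translation moves [th] to [(pi, ..., pi)], an interior point; it multiplies the moment against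
    [chr m] by a constant of modulus 1 only. *)
Lemma fourier_uniq n (u : 'rV[R]_n -> R[i]) : ccont u -> torus_periodic u ->
  (forall m, ctorus_int (fun th => u th * chr m th) = 0) -> forall th, u th = 0.
Proof.
move=> cu pu mu th; pose a : 'rV[R]_n := th - \row_i pi.
have cua : ccont (fun et : 'rV[R]_n => u (et + a)).
  apply: (@ccont_comp R _ _ u (fun et : 'rV[R]_n => et + a)) => //.
  exact: (@continuous_addl R 'rV[R]_n a).
have -> : th = \row_i pi + a by rewrite addrC subrK.
apply: (torus_uniq cua) => [m|i]; last first.
  by rewrite mxE pi_gt0 /= ltr_pMl ?pi_gt0// ltr1n.
have ch := @ccont_chr R n.
rewrite (_ : (fun th0 => _) = fun th0 => chr m (- a) * (u (th0 + a) * chr m (th0 + a))).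
  have cum : ccont (fun x => u x * chr m x) by exact: ccontM.
  rewrite cintZ; last first.
    apply: (@ccont_comp R _ _ (fun x => u x * chr m x) (fun et : 'rV[R]_n => et + a)) => //.
    exact: (@continuous_addl R 'rV[R]_n a).
  rewrite (@cint_shift R n (fun x => u x * chr m x))// ?mu ?mulr0//.
  by apply: torus_periodicM => //; exact: chr_periodic.
apply/funext => et; rewrite mulrCA -chrD; congr (_ * chr _ _).
by rewrite addrCA addNr addr0.
Qed.

End FourierUniqueness.

(** * Directional derivatives of compactly supported functions *)

Section DirectionalTaylor.
Variables (R : realType) (V : normedModType R).
Implicit Types (g : V -> R) (u : V -> R[i]) (x v : V).

Lemma derive_segment g x v (t : R) : derivable g (x + t *: v) v ->
  is_derive t 1 (fun t => g (x + t *: v)) ('D_v g (x + t *: v)).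
Proof.
move=> dg; have E : (fun h : R => h^-1 *: (((fun t => g (x + t *: v)) \o shift t) (h *: 1) - g (x + t *: v)))
  = (fun h : R => h^-1 *: ((g \o shift (x + t *: v)) (h *: v) - g (x + t *: v))).
  apply/funext => h /=; rewrite scalerDl -[h *: 1]/(h * 1) mulr1.
  by rewrite addrCA.
by split; rewrite /derivable /derive E.
Qed.

Lemma derive_scale g x v (a : R) : (forall y w, derivable g y w) ->
  'D_(a *: v) g x = a * 'D_v g x.
Proof.
move=> dg.
have d1 := @derive_segment g x (a *: v) 0 (dg _ _).
have d2 : is_derive (0 : R) 1 (fun t : R => a * t) a.
  by have := @is_deriveZ _ _ _ id a (0 : R) 1 1 _; rewrite -[_ *: _]/(_ * _) mulr1; exact.
have d3 := @derive_segment g x v (a * 0) (dg _ _).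
have d4 := @is_derive1_comp R (fun t => g (x + t *: v)) (fun t => a * t) 0 _ _ d3 d2.
have := @derive_val _ _ _ _ _ _ _ d1; have := @derive_val _ _ _ _ _ _ _ d4.
rewrite (_ : (fun t => g (x + t *: v)) \o (fun t => a * t) = fun t => g (x + t *: (a *: v))); last first.
  by apply/funext => t /=; rewrite scalerA mulrC.
by rewrite mulr0 !scale0r addr0 => -> <-; rewrite mulrC.
Qed.

Lemma mvt_line g x v : (forall y w, derivable g y w) ->
  exists c : R, g (x + v) - g x = 'D_v g (x + c *: v).
Proof.
move=> dg; have dl (t : R) : is_derive t 1 (fun t => g (x + t *: v)) ('D_v g (x + t *: v)).
  exact: derive_segment.
have [|c _] := @MVT R (fun t => g (x + t *: v)) (fun t => 'D_v g (x + t *: v)) 0 1 ltr01 (fun t _ => dl t).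
  by apply: derivable_within_continuous => t _; have [] := dl t.
by rewrite scale1r scale0r addr0 subr0 mulr1 => ->; exists c.
Qed.

Lemma taylor1_real g x v (B : R) : (forall y w, derivable g y w) ->
  (forall y, `|'D_v g y| <= B) -> `|g (x + v) - g x| <= B.
Proof. by move=> dg gB; have [c ->] := mvt_line x v dg. Qed.

(** The mean value theorem is applied twice along the segment. Since [B] bounds the second
    derivative everywhere, the position of the second intermediate point is irrelevant, and the
    factor 1/2 is given up. *)
Lemma taylor2_real g x v (B : R) : (forall y w, derivable g y w) ->
  (forall y w, derivable ('D_v g) y w) ->
  (forall y, `|'D_v ('D_v g) y| <= B) -> `|g (x + v) - g x - 'D_v g x| <= B.
Proof.
move=> dg d2g gB; have dl (t : R) : is_derive t 1 (fun t => g (x + t *: v)) ('D_v g (x + t *: v)).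
  exact: derive_segment.
have [|c] := @MVT R (fun t => g (x + t *: v)) (fun t => 'D_v g (x + t *: v)) 0 1 ltr01 (fun t _ => dl t).
  by apply: derivable_within_continuous => t _; have [] := dl t.
rewrite in_itv /= => /andP[c0 c1]; rewrite scale1r scale0r addr0 subr0 mulr1 => ->.
have [d ->] := mvt_line x (c *: v) d2g.
rewrite derive_scale// normrM ger0_norm ?(ltW c0)//.
apply: le_trans (gB (x + d *: (c *: v))); rewrite ler_piMl// ltW//.
Qed.

Lemma csmooth_derivable u : csmooth u ->
  (forall y w, derivable (@complex.Re R \o u) y w) /\ (forall y w, derivable (@complex.Im R \o u) y w).
Proof. by move=> [sr si]; split=> y w; exact: smooth_derivable. Qed.

Lemma cderive_scale u x v (a : R) : csmooth u ->
  cderive (a *: v) u x = a%:C * cderive v u x.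
Proof.
move=> /csmooth_derivable[dr di]; rewrite /cderive !derive_scale//.
by apply/eqP; rewrite eq_complex /=; apply/andP; split; apply/eqP; ring.
Qed.

(** The factor 2 pays for treating real and imaginary parts separately, as their intermediate points
    differ. *)
Lemma taylor1 u x v (B : R) : csmooth u -> (forall y, nc (cderive v u y) <= B) ->
  nc (u (x + v) - u x) <= 2 * B.
Proof.
move=> /csmooth_derivable[dr di] uB; apply: le_trans (nc_le_ReIm _) _.
rewrite mulr2n mulrDl mul1r; apply: lerD.
  rewrite [X in `|X|](_ : _ = complex.Re (u (x + v)) - complex.Re (u x)).
    apply: (taylor1_real x dr) => y; apply: le_trans (uB y).
    exact: (normr_Re_le (cderive v u y)).
  by case: (u (x + v)) (u x) => [? ?] [].
rewrite [X in `|X|](_ : _ = complex.Im (u (x + v)) - complex.Im (u x)).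
  apply: (taylor1_real x di) => y; apply: le_trans (uB y).
  exact: (normr_Im_le (cderive v u y)).
by case: (u (x + v)) (u x) => [? ?] [].
Qed.

Lemma taylor2 u x v (B : R) : csmooth u ->
  (forall y, nc (cderive v (cderive v u) y) <= B) ->
  nc (u (x + v) - u x - cderive v u x) <= 2 * B.
Proof.
move=> su uB; have /csmooth_derivable[dr di] := su.
have d2r y w : derivable ('D_v (@complex.Re R \o u)) y w.
  by apply: smooth_derivable; exact: smooth_derive su.1.
have d2i y w : derivable ('D_v (@complex.Im R \o u)) y w.
  by apply: smooth_derivable; exact: smooth_derive su.2.
apply: le_trans (nc_le_ReIm _) _; rewrite mulr2n mulrDl mul1r; apply: lerD.
  rewrite [X in `|X|](_ : _ = complex.Re (u (x + v)) - complex.Re (u x) - 'D_v (@complex.Re R \o u) x).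
    apply: (taylor2_real x dr d2r) => y; apply: le_trans (uB y).
    exact: (normr_Re_le (cderive v (cderive v u) y)).
  by rewrite /cderive; case: (u (x + v)) (u x) => [? ?] [].
rewrite [X in `|X|](_ : _ = complex.Im (u (x + v)) - complex.Im (u x) - 'D_v (@complex.Im R \o u) x).
  apply: (taylor2_real x di d2i) => y; apply: le_trans (uB y).
  exact: (normr_Im_le (cderive v (cderive v u) y)).
by rewrite /cderive; case: (u (x + v)) (u x) => [? ?] [].
Qed.

Lemma taylor2_scaled u x v (t B : R) : csmooth u -> 0 < t ->
  (forall y, nc (cderive v (cderive v u) y) <= B) ->
  nc (u (x + t *: v) - u x - t%:C * cderive v u x) <= 2 * (B * t ^+ 2).
Proof.
move=> su t0 hB; rewrite -cderive_scale//; apply: taylor2 => // y.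
rewrite (_ : cderive (t *: v) (cderive (t *: v) u) y = (t%:C * t%:C) * cderive v (cderive v u) y).
  by rewrite !ncM !nc_real gtr0_norm// -expr2 mulrC ler_wpM2r// sqr_ge0.
rewrite cderive_scale; last exact: csmooth_cderive.
rewrite (_ : cderive (t *: v) u = t%:C *: cderive v u).
  by rewrite cderiveZ; [rewrite mulrA|exact: csmooth_cderive].
by apply/funext => z; rewrite cderive_scale.
Qed.

Lemma csmooth_ccont u : csmooth u -> ccont u.
Proof. by move=> [sr si]; split; [exact: smooth_continuous sr|exact: smooth_continuous si]. Qed.

End DirectionalTaylor.

(* Comparison of first-order terms: replaces differentiation at t = 0. *)
Lemma eq0_of_quadratic (R : realType) (z : R[i]) (C : R) :
  (forall t : R, 0 < t -> nc (t%:C * z) <= C * t ^+ 2) -> z = 0.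
Proof.
move=> h; apply: nc_eq0; apply/ler_addgt0Pr => e e0; rewrite add0r.
have C0 : 0 < `|C| + 1 by rewrite ltr_wpDl.
have t0 : 0 < e / (`|C| + 1) by rewrite divr_gt0.
have := h _ t0; rewrite ncM nc_real gtr0_norm// expr2 mulrCA ler_pM2l// => le.
apply: le_trans le _; rewrite mulrA ler_pdivrMr// mulrC ler_pM2l//.
by apply: le_trans (ler_norm _) _; rewrite lerDl.
Qed.

(** * Boundedness and linearity of derivatives in the direction *)

Section CompactlySupported.
Variables (R : realType) (n : nat).
Local Notation X := ('rV[R]_n * 'rV[R]_n)%type.
Implicit Types (f g : X -> R[i]) (m : 'rV[int]_n) (x v th : 'rV[R]_n).

Lemma ccinfP (f : ccinf R n) : ccinf_pred f.
Proof. by case: f => f /= /asboolP. Qed.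

Lemma ccinf_predD f g : ccinf_pred f -> ccinf_pred g -> ccinf_pred (f + g).
Proof.
move=> /asboolP hf /asboolP hg; apply/asboolP.
exact: (@rpredD _ (@ccinf_set R n) f g hf hg).
Qed.

Lemma ccinf_predZ (a : R[i]) f : ccinf_pred f -> ccinf_pred (a *: f).
Proof.
move=> /asboolP hf; apply/asboolP; exact: (@rpredZ _ _ (@ccinf_set R n) a f hf).
Qed.

Lemma ccinf_predB f g : ccinf_pred f -> ccinf_pred g -> ccinf_pred (f - g).
Proof.
move=> /asboolP hf /asboolP hg; apply/asboolP.
exact: (@rpredB _ (@ccinf_set R n) f g hf hg).
Qed.

Lemma derive_translation_invariant (h : X -> R) (q p v : X) :
  (forall p, h (p + q) = h p) -> 'D_v h (p + q) = 'D_v h p.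
Proof.
move=> hq; have E : (fun t : R => t^-1 *: ((h \o shift (p + q)) (t *: v) - h (p + q))) =
    (fun t : R => t^-1 *: ((h \o shift p) (t *: v) - h p)).
  by apply/funext => t /=; rewrite addrA !hq.
by rewrite /derive E.
Qed.

Lemma ccinf_pred_cderive f (v : X) : ccinf_pred f -> ccinf_pred (cderive v f).
Proof.
move=> [Sf Pf [K cK Kf]]; split; first exact: csmooth_cderive.
- move=> x th m; pose q : X := (0, (2 * pi) *: map_mx intr m).
  have fq p : f (p + q) = f p.
    by case: p => y et; rewrite -[RHS](Pf y et m) /=; congr (f (_, _)); rewrite /= addr0.
  have -> : (x, th + (2 * pi) *: map_mx intr m) = (x, th) + q :> X.
    by congr (_, _); rewrite /= addr0.
  by rewrite /cderive !derive_translation_invariant// => p /=; rewrite fq.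
exists K => // x th Kx; apply: cderive_near0.
have oK : nbhs (x, th) ((~` K) `*` setT).
  exists (~` K, setT) => //; split=> /=; last exact: (@filterT _ (nbhs th) (@nbhs_filter _ th)).
  apply: open_nbhs_nbhs; split => //; apply: closed_openC.
  exact: (compact_closed (@norm_hausdorff _ _) cK).
by apply: filterS oK => -[y et] [/= Ky _]; exact: Kf.
Qed.

Lemma ccinf_pred_mul f g : ccinf_pred f -> ccinf_pred g -> ccinf_pred (f * g).
Proof.
move=> [Sf Pf [K cK Kf]] [Sg Pg [L cL Lg]]; split; first exact: csmoothM.
  by move=> x; exact: (torus_periodicM (Pf x) (Pg x)).
by exists K => // x th Kx; rewrite -[LHS]/(f _ * g _) Kf// mul0r.
Qed.

Lemma torus_reduce th : exists m, forall i, 0 <= (th + (2 * pi) *: map_mx intr m) 0 i <= 2 * pi.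
Proof.
have p0 : 0 < 2 * pi :> R := pi2_gt0 R.
exists (\row_i - Num.floor (th 0 i / (2 * pi))) => i; rewrite !mxE rmorphN /= mulrN.
set y := th 0 i; have := floor_itv (y / (2 * pi)).
rewrite ler_pdivlMr// ltr_pdivrMr// rmorphD /= => /andP[h1 h2].
by rewrite [_ * (_%:~R)]mulrC subr_ge0 lerBlDr h1 /=; lra.
Qed.

(** Periodicity brings [th] into the cube [[0, 2 pi]^n], so only the compact product of [K] and the
    cube matters. *)
Lemma ccinf_bounded f : ccinf_pred f -> exists B : R, forall p, nc (f p) <= B.
Proof.
move=> [Sf Pf [K cK Kf]]; have [cr ci] := csmooth_ccont Sf.
pose Q := [set th : 'rV[R]_n | forall i, `[0, 2 * pi]%classic (th 0 i)].
have cQ : compact Q by exact: (@rV_compact R n (fun=> `[0, 2 * pi]%classic) (fun i => @segment_compact R 0 (2 * pi))).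
have bnd (h : X -> R) : continuous h -> exists B : R, forall p, (K `*` Q) p -> `|h p| <= B.
  move=> ch; have cKQ : compact (K `*` Q) by exact: compact_setX.
  have : compact (h @` (K `*` Q)).
    by apply: continuous_compact => //; exact: continuous_subspaceT.
  move=> /compact_bounded[M [_ hM]]; exists (M + 1) => p Kp.
  have M1 : M < M + 1 by rewrite ltrDl.
  exact: (hM _ M1 (h p) (ex_intro2 _ _ p Kp erefl)).
have [B1 hB1] := bnd _ cr; have [B2 hB2] := bnd _ ci.
exists (Num.max 0 (B1 + B2)) => -[x th]; rewrite le_max; apply/orP.
have [Kx|Kx] := pselect (K x); last by left; rewrite Kf// nc0.
right; have [m hm] := torus_reduce th; rewrite -(Pf x th m).
have KQ : (K `*` Q) (x, th + (2 * pi) *: map_mx intr m).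
  by split => //= i; rewrite in_itv /=; exact: hm.
by apply: le_trans (nc_le_ReIm _) _; apply: lerD; [exact: hB1|exact: hB2].
Qed.

(** The increment along [t (v + w)] is compared with a step [t v] followed by a step [t w]. The
    second step is expanded at [p + t v], and [e4] brings its derivative back to [p] at cost [O(t)];
    all errors are then quadratic in [t]. *)
Lemma cderive_vD f (p v w : X) : ccinf_pred f ->
  cderive (v + w) f p = cderive v f p + cderive w f p.
Proof.
move=> cf; have sf : csmooth f by case: cf.
have [B1 h1] := ccinf_bounded (ccinf_pred_cderive (v + w) (ccinf_pred_cderive (v + w) cf)).
have [B2 h2] := ccinf_bounded (ccinf_pred_cderive v (ccinf_pred_cderive v cf)).
have [B3 h3] := ccinf_bounded (ccinf_pred_cderive w (ccinf_pred_cderive w cf)).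
have [B4 h4] := ccinf_bounded (ccinf_pred_cderive v (ccinf_pred_cderive w cf)).
apply/eqP; rewrite -subr_eq0; apply/eqP.
apply: (@eq0_of_quadratic R _ (2 * B1 + 2 * B2 + 2 * B3 + 2 * B4)) => t t0.
have T u q B := @taylor2_scaled R _ f q u t B sf t0.
have e1 := T (v + w) p _ h1; have e2 := T v p _ h2; have e3 := T w (p + t *: v) _ h3.
have e4 : nc (cderive w f (p + t *: v) - cderive w f p) <= 2 * (B4 * t).
  apply: taylor1 => [|y]; first exact: csmooth_cderive.
  rewrite cderive_scale; last exact: csmooth_cderive.
  by rewrite ncM nc_real gtr0_norm// mulrC ler_pM2r.
rewrite (_ : p + t *: v + t *: w = p + t *: (v + w)) in e3; last by rewrite scalerDr addrA.
set a := f (p + t *: (v + w)) in e1 e3; set b := f (p + t *: v) in e2 e3.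
set A := cderive (v + w) f p in e1 *; set D1 := cderive v f p in e2 *.
set D2 := cderive w f p in e4 *; set D3 := cderive w f _ in e3 e4.
have -> : t%:C * (A - (D1 + D2)) = - (a - f p - t%:C * A) + (b - f p - t%:C * D1)
   + (a - b - t%:C * D3) + t%:C * (D3 - D2) by ring.
have e5 : nc (t%:C * (D3 - D2)) <= 2 * B4 * t ^+ 2.
  rewrite ncM nc_real gtr0_norm//; apply: le_trans (ler_wpM2l (ltW t0) e4) _.
  by rewrite (_ : t * _ = 2 * B4 * t ^+ 2)//; ring.
apply: le_trans (ler_ncD _ _) _; rewrite mulrDl; apply: lerD => //.
apply: le_trans (ler_ncD _ _) _; rewrite mulrDl; apply: lerD; last by rewrite -mulrA.
apply: le_trans (ler_ncD _ _) _; rewrite mulrDl ncN -!mulrA; exact: lerD.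
Qed.

End CompactlySupported.

(** * Decay of Fourier coefficients *)

Section FourierCoefficients.
Variables (R : realType) (n : nat).
Local Notation X := ('rV[R]_n * 'rV[R]_n)%type.
Implicit Types (f g : X -> R[i]) (m l : 'rV[int]_n) (x v th : 'rV[R]_n).

Definition FC f m x : R[i] := ctorus_int (fun th => chr (- m) th * f (x, th)).

Lemma weyl_coefE k (f : ccinf R n) (p q : 'rV[int]_n) : (0 < k)%N ->
  weyl_coef k f (k%:R^-1 *: map_mx intr p) (k%:R^-1 *: map_mx intr q) =
  FC f (p - q) (2^-1 *: (k%:R^-1 *: map_mx intr p + k%:R^-1 *: map_mx intr q)).
Proof.
move=> k0; rewrite /weyl_coef /FC; congr ctorus_int; apply/funext => th.
congr (_ * _); rewrite /chr map_mxN dotpNl; congr (expi (- _)).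
rewrite -scalerBr dotpZl mulrA mulfV ?mul1r ?pnatr_eq0 ?gt_eqF//.
by rewrite map_mxB.
Qed.

Lemma ccont_slice f x : ccinf_pred f -> ccont (fun th => f (x, th)).
Proof.
move=> [/csmooth_ccont cf _ _].
apply: (@ccont_comp R _ _ f (fun th : 'rV[R]_n => (x, th))) => //.
by apply: continuous_pair => y; [exact: cst_continuous|exact: cvg_id].
Qed.

Lemma ccont_FC f m x : ccinf_pred f -> ccont (fun th => chr (- m) th * f (x, th)).
Proof. by move=> cf; apply: ccontM; [exact: ccont_chr|exact: ccont_slice]. Qed.

Lemma FC_bound f m x (B : R) : ccinf_pred f -> (forall p, nc (f p) <= B) ->
  nc (FC f m x) <= B.
Proof.
move=> cf fB; apply: cint_bound; first exact: ccont_FC.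
by move=> th; rewrite ncM nc_chr mul1r.
Qed.

Lemma FCD f g m x : ccinf_pred f -> ccinf_pred g ->
  FC (f + g) m x = FC f m x + FC g m x.
Proof.
move=> cf cg; rewrite /FC -cintD; [|exact: ccont_FC|exact: ccont_FC].
by congr ctorus_int; apply/funext => th; rewrite -mulrDr.
Qed.

Lemma FCZ (a : R[i]) f m x : ccinf_pred f -> FC (a *: f) m x = a * FC f m x.
Proof.
move=> cf; rewrite /FC -cintZ; last exact: ccont_FC.
by congr ctorus_int; apply/funext => th; rewrite mulrCA.
Qed.

Lemma FCB f g m x : ccinf_pred f -> ccinf_pred g ->
  FC (f - g) m x = FC f m x - FC g m x.
Proof.
move=> cf cg; rewrite -[in LHS]scaleN1r FCD//; last exact: ccinf_predZ.
by rewrite FCZ// mulN1r.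
Qed.

Lemma ccinf_pred0 : ccinf_pred (0 : X -> R[i]).
Proof. by apply/asboolP; exact: (@rpred0 _ (@ccinf_set R n)). Qed.

Lemma FC0 m x : FC 0 m x = 0.
Proof. by rewrite -(scale0r (0 : X -> R[i])) FCZ ?mul0r//; exact: ccinf_pred0. Qed.

Lemma ccinf_pred_sum (I : Type) (s : seq I) (F : I -> X -> R[i]) :
  (forall i, ccinf_pred (F i)) -> ccinf_pred (\sum_(i <- s) F i).
Proof.
move=> cF; elim/big_rec: _ => [|i f _ cf]; first exact: ccinf_pred0.
exact: ccinf_predD.
Qed.

Lemma FC_sum (I : Type) (s : seq I) (F : I -> X -> R[i]) m x :
  (forall i, ccinf_pred (F i)) ->
  FC (\sum_(i <- s) F i) m x = \sum_(i <- s) FC (F i) m x.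
Proof.
move=> cF; elim: s => [|i s IH]; first by rewrite !big_nil FC0.
by rewrite !big_cons FCD ?IH//; exact: ccinf_pred_sum.
Qed.

(** The character [chr m] is the parallel section [expi (k <b, th>)] for [k = 1] and [b = m]; its
    derivative is read off the vanishing of [cov_derive]. *)
Lemma cderive_chr m v th :
  cderive v (chr m) th = 'i%C * (dotp (map_mx intr m) v)%:C * chr m th.
Proof.
have E : (fun th : 'rV[R]_n => expi (1%:R * dotp (map_mx intr m) th)) = chr m.
  by apply/funext => et; rewrite mul1r.
have [_ _] := @flat_section_expi R n 1 (map_mx intr m) m (scale1r _).
by rewrite E => /(_ v th) /eqP; rewrite /cov_derive subr_eq0 mul1r => /eqP.
Qed.

Lemma csmooth_chr m : csmooth (@chr R n m).
Proof.
have [+ _ _] := @flat_section_expi R n 1 (map_mx intr m) m (scale1r _).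
by rewrite (_ : (fun th => _) = chr m)//; apply/funext => et; rewrite mul1r.
Qed.

Lemma chr_taylor m v (t : R) : 0 < t ->
  nc (chr m (t *: v) - 1 - t%:C * ('i%C * (dotp (map_mx intr m) v)%:C))
    <= 2 * (dotp (map_mx intr m) v ^+ 2 * t ^+ 2).
Proof.
move=> t0; set a := dotp _ v.
have := @taylor2_scaled R _ (chr m) 0 v t (a ^+ 2) (csmooth_chr m) t0.
rewrite add0r cderive_chr -/a.
have -> : chr m (0 : 'rV[R]_n) = 1.
  by rewrite /chr [dotp _ _]big1 ?expi0// => i _; rewrite !mxE mulr0.
rewrite mulr1; apply => y.
have -> : cderive v (chr m) = ('i%C * a%:C) *: chr m.
  by apply/funext => th; rewrite cderive_chr.
rewrite cderiveZ ?cderive_chr -/a; last exact: csmooth_chr.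
by rewrite !ncM nc_i nc_real nc_chr !mul1r mulr1 -normrM -expr2 ger0_norm// sqr_ge0.
Qed.

(** Translating [f] by [t v] multiplies its coefficient by [chr m (t v)]. Expanding both the
    translate and the character to first order in [t] and comparing gives integration by parts. *)
Lemma FC_dtheta f m x v : ccinf_pred f ->
  FC (cderive (0, v) f) m x = ('i%C * (dotp (map_mx intr m) v)%:C) * FC f m x.
Proof.
move=> cf; have [sf Pf _] := cf; set a := dotp _ v.
have cf1 := ccinf_pred_cderive (0, v) cf.
have [B hB] := ccinf_bounded (ccinf_pred_cderive (0, v) cf1).
apply/esym/eqP; rewrite -subr_eq0; apply/eqP.
apply: (@eq0_of_quadratic R _ (2 * B + 2 * a ^+ 2 * nc (FC f m x))) => t t0.
have cs : ccont (fun th => chr (- m) th * f (x, th + t *: v)).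
  apply: ccontM; first exact: ccont_chr.
  apply: (@ccont_comp R _ _ (fun th => f (x, th)) (fun th => th + t *: v)).
    exact: continuous_addl.
  exact: ccont_slice.
have shiftE : ctorus_int (fun th => chr (- m) th * f (x, th + t *: v)) = chr m (t *: v) * FC f m x.
  rewrite /FC -(cint_shift (t *: v) (ccont_FC m x cf)) -?cintZ.
  - congr ctorus_int; apply/funext => th; rewrite chrD chrN (chrN m (t *: v)).
    have := expiNK (dotp (map_mx intr m) (t *: v)); rewrite expiN -/(chr m _) => e.
    rewrite -[LHS]mul1r -e; set b := (chr m (t *: v))^*; set c := (chr m th)^*.
    by ring.
  - apply: (@ccont_comp R _ _ (fun th => chr (- m) th * f (x, th)) (fun th => th + t *: v)).
      exact: continuous_addl.
    exact: ccont_FC.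
  - by apply: torus_periodicM; [exact: chr_periodic|exact: Pf].
have e1 : nc (chr m (t *: v) * FC f m x - FC f m x - t%:C * FC (cderive (0, v) f) m x) <= 2 * (B * t ^+ 2).
  rewrite -shiftE /FC -cintZ; last exact: ccont_FC.
  rewrite -cintB//; last exact: ccont_FC.
  rewrite -cintB; [|by apply: ccontB => //; exact: ccont_FC|by apply: ccontZ; exact: ccont_FC].
  apply: cint_bound.
    by apply: ccontB; [apply: ccontB => //|apply: ccontZ]; exact: ccont_FC.
  move=> th; rewrite mulrCA -!mulrBr ncM nc_chr mul1r.
  have := @taylor2_scaled R _ f (x, th) (0, v) t B sf t0 hB.
  rewrite (_ : (x, th) + t *: ((0, v) : X) = (x, th + t *: v))//.
  by congr (_, _); rewrite /= scaler0 addr0.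
have e2 := @chr_taylor m v t t0; rewrite -/a in e2.
set F := FC f m x in e1 *; set F' := FC _ m x in e1 *; set z := chr m _ in e1 e2.
rewrite (_ : _ * _ = (z * F - F - t%:C * F') - (z - 1 - t%:C * ('i%C * a%:C)) * F); last by ring.
apply: le_trans (ler_ncB _ _) _; rewrite [leRHS]mulrDl; apply: lerD; first by rewrite -mulrA.
rewrite ncM mulrAC; apply: ler_wpM2r; first exact: nc_ge0.
by rewrite -mulrA.
Qed.

Definition elliptic1 (i : 'I_n) f : X -> R[i] := f - dth i (dth i f).

Lemma ccinf_pred_elliptic1 i f : ccinf_pred f -> ccinf_pred (elliptic1 i f).
Proof.
move=> cf; apply: (ccinf_predB cf).
exact: (ccinf_pred_cderive _ (ccinf_pred_cderive _ cf)).
Qed.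

Lemma dotp_delta (b : 'rV[R]_n) i : dotp b (delta_mx 0 i) = b 0 i.
Proof.
rewrite /dotp (bigD1 i)//= big1 => [|j ji]; first by rewrite mxE !eqxx mulr1 addr0.
by rewrite mxE (negPf ji) andbF mulr0.
Qed.

Lemma FC_dth i f m x : ccinf_pred f ->
  FC (dth i f) m x = ('i%C * ((m 0 i)%:~R)%:C) * FC f m x.
Proof. by move=> cf; rewrite FC_dtheta// dotp_delta mxE. Qed.

Lemma FC_elliptic1 i f m x : ccinf_pred f ->
  FC (elliptic1 i f) m x = (1 + (m 0 i)%:~R ^+ 2)%:C * FC f m x.
Proof.
move=> cf; have cd (h : X -> R[i]) : ccinf_pred h -> ccinf_pred (dth i h) by exact: ccinf_pred_cderive.
have c1 := cd _ cf; have c2 := cd _ c1.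
rewrite FCB// !FC_dth//.
set a := (m 0 i)%:~R; rewrite -[in LHS](mul1r (FC f m x)) !mulrA -mulrBl; congr (_ * _).
by apply/eqP; rewrite eq_complex /=; apply/andP; split; apply/eqP; ring.
Qed.

(** The witness is [f] after [N] applications of the product over [i] of [1 - (d/dtheta_i)^2]. *)
Lemma FC_gain f (N : nat) : ccinf_pred f -> exists2 g, ccinf_pred g &
  forall m x, FC g m x = (iwt R m ^+ N)%:C * FC f m x.
Proof.
move=> cf; elim: N => [|N [g cg gE]].
  by exists f => // m x; rewrite expr0 mul1r.
have [h ch hE] : exists2 h, ccinf_pred h &
    forall m x, FC h m x = (\prod_(i <- enum 'I_n) (1 + (m 0 i)%:~R ^+ 2))%:C * FC g m x.
  elim: (enum 'I_n) => [|i s [h ch hE]].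
    by exists g => // m x; rewrite big_nil mul1r.
  exists (elliptic1 i h); first exact: ccinf_pred_elliptic1.
  by move=> m x; rewrite FC_elliptic1// hE big_cons mulrA -rmorphM.
exists h => // m x; rewrite hE gE mulrA -rmorphM exprS; congr (_%:C * _).
by rewrite /iwt big_enum.
Qed.

(* Passing to the limit in difference quotients; this avoids commuting the
   derivatives in x and theta. *)
Lemma FC_cderive_x f g m (c : R[i]) v x : ccinf_pred f -> ccinf_pred g ->
  (forall x, FC g m x = c * FC f m x) ->
  FC (cderive (v, 0) g) m x = c * FC (cderive (v, 0) f) m x.
Proof.
have T h : ccinf_pred h -> exists B, forall t, 0 < t ->
    nc (FC h m (x + t *: v) - FC h m x - t%:C * FC (cderive (v, 0) h) m x) <= B * t ^+ 2.
  move=> ch; have [sh _ _] := ch.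
  have ch1 := ccinf_pred_cderive (v, 0) ch.
  have [B hB] := ccinf_bounded (ccinf_pred_cderive (v, 0) ch1).
  exists (2 * B) => t t0; rewrite /FC -cintZ; last exact: ccont_FC.
  rewrite -cintB; [|exact: ccont_FC|exact: ccont_FC].
  rewrite -cintB; [|by apply: ccontB; exact: ccont_FC|by apply: ccontZ; exact: ccont_FC].
  apply: cint_bound.
    by apply: ccontB; [apply: ccontB|apply: ccontZ]; exact: ccont_FC.
  move=> th; rewrite mulrCA -!mulrBr ncM nc_chr mul1r -mulrA.
  have := @taylor2_scaled R _ h (x, th) (v, 0) t B sh t0 hB.
  rewrite (_ : (x, th) + t *: ((v, 0) : X) = (x + t *: v, th))//.
  by congr (_, _); rewrite /= scaler0 addr0.
move=> cf cg gE; have [B1 h1] := T _ cf; have [B2 h2] := T _ cg.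
apply/eqP; rewrite -subr_eq0; apply/eqP.
apply: (@eq0_of_quadratic R _ (nc c * B1 + B2)) => t t0.
have {}h1 := h1 t t0; have {}h2 := h2 t t0; rewrite !gE in h2.
set F := FC f m x in h1 h2; set F1 := FC f m _ in h1 h2.
set G' := FC (cderive _ g) m x in h2 *; set F' := FC _ m x in h1 *.
rewrite (_ : _ * _ = c * (F1 - F - t%:C * F') - (c * F1 - c * F - t%:C * G')); last by ring.
apply: le_trans (ler_ncB _ _) _; rewrite [leRHS]mulrDl; apply: lerD => //.
by rewrite ncM -mulrA ler_wpM2l// nc_ge0.
Qed.

Definition l1 v : R := \sum_(i < n) `|v 0 i|.

Lemma l1_ge0 v : 0 <= l1 v. Proof. by apply: sumr_ge0. Qed.

Lemma cderive_v0 f p : csmooth f -> cderive (0 : X) f p = 0.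
Proof. by move=> sf; rewrite -(scale0r (0 : X)) cderive_scale// mul0r. Qed.

Lemma cderive_dx f v p : ccinf_pred f ->
  cderive (v, 0) f p = \sum_(i < n) (v 0 i)%:C * dx i f p.
Proof.
move=> cf; have sf : csmooth f by case: cf.
have -> : ((v, 0) : X) = \sum_(i < n) v 0 i *: ((delta_mx 0 i, 0) : X).
  rewrite [v in LHS]row_sum_delta; elim/big_rec2: _ => // i y1 y2 _ <-.
  by congr (_, _); rewrite /= scaler0 addr0.
elim: (index_enum _) => [|i s IH]; first by rewrite !big_nil cderive_v0.
by rewrite !big_cons cderive_vD// IH cderive_scale.
Qed.

Lemma cderive_dxE f v : ccinf_pred f ->
  cderive (v, 0) f = \sum_(i < n) (v 0 i)%:C *: dx i f.
Proof. by move=> cf; apply/funext => p; rewrite cderive_dx// fct_sumE. Qed.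

Lemma FC_cderive_dx f m x v : ccinf_pred f ->
  FC (cderive (v, 0) f) m x = \sum_(i < n) (v 0 i)%:C * FC (dx i f) m x.
Proof.
move=> cf; rewrite cderive_dxE// FC_sum => [|i].
  by apply: eq_bigr => i _; rewrite FCZ//; exact: ccinf_pred_cderive.
by apply: ccinf_predZ; exact: ccinf_pred_cderive.
Qed.

Lemma cderive_x_bound f : ccinf_pred f -> exists B : R, forall v p,
  nc (cderive (v, 0) f p) <= B * l1 v.
Proof.
move=> cf; have /choice[B hB] i := ccinf_bounded (ccinf_pred_cderive (delta_mx 0 i, 0) cf).
exists (\sum_(i < n) `|B i|) => v p; rewrite cderive_dx//.
apply: le_trans (ler_nc_sum _ _ _) _; rewrite /l1 mulr_sumr; apply: ler_sum => i _.
rewrite ncM nc_real mulrC; apply: ler_wpM2r => //.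
apply: le_trans (hB i p) _; apply: le_trans (ler_norm _) _.
by rewrite (bigD1 i)//= lerDl sumr_ge0.
Qed.

Lemma cderive_xx_bound f : ccinf_pred f -> exists B : R, forall v p,
  nc (cderive (v, 0) (cderive (v, 0) f) p) <= B * l1 v ^+ 2.
Proof.
move=> cf; have cd i : ccinf_pred (dx i f) by exact: ccinf_pred_cderive.
have /choice[B hB] i := cderive_x_bound (cd i).
exists (\sum_(i < n) `|B i|) => v p; rewrite [cderive _ f]cderive_dxE//.
have -> : cderive (v, 0) (\sum_(i < n) (v 0 i)%:C *: dx i f) p =
    \sum_(i < n) (v 0 i)%:C * cderive (v, 0) (dx i f) p.
  have cdZ i : ccinf_pred ((v 0 i)%:C *: dx i f) by exact: ccinf_predZ.
  elim: (index_enum _) => [|i s IH].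
    by rewrite !big_nil; apply: cderive_near0; near=> y; exact: erefl.
  rewrite !big_cons cderiveD ?cderiveZ ?IH//; first by case: (cd i).
    by case: (cdZ i).
  by have [] := ccinf_pred_sum s cdZ.
apply: le_trans (ler_nc_sum _ _ _) _.
apply: (@le_trans _ _ (\sum_(i < n) `|v 0 i| * (`|B i| * l1 v))).
  apply: ler_sum => i _; rewrite ncM nc_real; apply: ler_wpM2l => //.
  apply: le_trans (hB i v p) _; apply: ler_wpM2r; [exact: l1_ge0|exact: ler_norm].
apply: (@le_trans _ _ (\sum_(i < n) `|v 0 i| * ((\sum_(j < n) `|B j|) * l1 v))).
  apply: ler_sum => i _; apply: ler_wpM2l => //; apply: ler_wpM2r; first exact: l1_ge0.
  by rewrite (bigD1 i)//= lerDl sumr_ge0.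
by rewrite -mulr_suml -/(l1 v) mulrCA -expr2.
Unshelve. all: by end_near. Qed.

(** All four bounds are sup bounds for the function [g] of [FC_gain], divided by [iwt R m ^+ N]. The
    same [g] serves the derivative terms because [FC_cderive_x] carries the multiplier through
    x-derivatives. *)
Lemma FC_estimates f (N : nat) : ccinf_pred f -> exists2 C : R, 0 <= C &
  [/\ forall m x, nc (FC f m x) <= C * wt R m ^+ N,
      forall m x v, nc (FC f m (x + v) - FC f m x) <= C * l1 v * wt R m ^+ N,
      forall m x v, nc (FC (cderive (v, 0) f) m x) <= C * l1 v * wt R m ^+ N &
      forall m x v, nc (FC f m (x + v) - FC f m x - FC (cderive (v, 0) f) m x)
        <= C * l1 v ^+ 2 * wt R m ^+ N].
Proof.
move=> cf; have [g cg gE] := FC_gain N cf; have [sg _ _] := cg.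
have dgE m v x : FC (cderive (v, 0) g) m x = (iwt R m ^+ N)%:C * FC (cderive (v, 0) f) m x.
  exact: FC_cderive_x.
have [B0 h0] := ccinf_bounded cg.
have [B1 h1] := cderive_x_bound cg.
have [B2 h2] := cderive_xx_bound cg.
exists (`|B0| + 2 * `|B1| + 2 * `|B2|); first by rewrite !addr_ge0 ?mulr_ge0.
have conv m z (B C : R) : B <= C -> nc ((iwt R m ^+ N)%:C * z) <= B -> nc z <= C * wt R m ^+ N.
  have i0 : 0 < iwt R m ^+ N by rewrite exprn_gt0// iwt_gt0.
  move=> BC; rewrite ncM nc_real gtr0_norm// => h.
  rewrite /wt exprVn ler_pdivlMr// mulrC.
  exact: le_trans h BC.
have a0 := normr_ge0 B0; have a1 := normr_ge0 B1; have a2 := normr_ge0 B2.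
have p1 v (a b : R) : a <= b -> a * l1 v <= b * l1 v by move=> ab; apply: ler_wpM2r => //; exact: l1_ge0.
split.
- move=> m x; apply: (@conv m _ `|B0|); first by lra.
  by rewrite -gE; apply: FC_bound => // p; apply: le_trans (h0 p) _; exact: ler_norm.
- move=> m x v; apply: (@conv m _ (2 * (`|B1| * l1 v))).
    by rewrite mulrA; apply: p1; lra.
  rewrite mulrBr -!gE /FC -cintB; [|exact: ccont_FC|exact: ccont_FC].
  apply: cint_bound; first by apply: ccontB; exact: ccont_FC.
  move=> th; rewrite -mulrBr ncM nc_chr mul1r.
  rewrite (_ : (x + v, th) = (x, th) + (v, 0)); last by congr (_, _); rewrite /= addr0.
  apply: taylor1 => // p; apply: le_trans (h1 v p) _; apply: p1; exact: ler_norm.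
- move=> m x v; apply: (@conv m _ (`|B1| * l1 v)); first by apply: p1; lra.
  rewrite -dgE; apply: FC_bound; first exact: ccinf_pred_cderive.
  by move=> p; apply: le_trans (h1 v p) _; apply: p1; exact: ler_norm.
- move=> m x v; apply: (@conv m _ (2 * (`|B2| * l1 v ^+ 2))).
    by rewrite mulrA; apply: ler_wpM2r; [exact: sqr_ge0|lra].
  have cdg := ccinf_pred_cderive (v, 0) cg.
  rewrite !mulrBr -!gE -dgE /FC -cintB; [|exact: ccont_FC|exact: ccont_FC].
  rewrite -cintB; [|by apply: ccontB; exact: ccont_FC|exact: ccont_FC].
  apply: cint_bound.
    by apply: ccontB; [apply: ccontB|]; exact: ccont_FC.
  move=> th; rewrite -!mulrBr ncM nc_chr mul1r.
  rewrite (_ : (x + v, th) = (x, th) + (v, 0)); last by congr (_, _); rewrite /= addr0.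
  apply: taylor2 => // p; apply: le_trans (h2 v p) _.
  by apply: ler_wpM2r; [exact: sqr_ge0|exact: ler_norm].
Qed.

End FourierCoefficients.

(** * Fourier inversion and matrix bounds *)

Lemma uniform_ccont (R : realType) (V : topologicalType) (u : V -> R[i]) :
  (forall e : R, 0 < e -> exists2 w, ccont w & forall x, nc (w x - u x) <= e) -> ccont u.
Proof.
move=> h; have T (pr : R[i] -> R) : (forall z w, pr (z - w) = pr z - pr w) ->
    (forall z, `|pr z| <= nc z) ->
    (forall w : V -> R[i], ccont w -> continuous (pr \o w)) -> continuous (pr \o u).
  move=> prB prn prc x; apply/cvgrPdist_le => e e0; have e3 : 0 < e / 3 by rewrite divr_gt0.
  have [w cw wu] := h _ e3; have /cvgrPdist_le/(_ _ e3) := prc w cw x.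
  apply: filterS => y /= wxy; have := prn (w x - u x); have := prn (w y - u y).
  move: wxy (wu x) (wu y); rewrite !prB; set a := pr (w x); set b := pr (w y).
  set c := pr (u x); set d := pr (u y) => h1 h2 h3 h4 h5.
  rewrite (_ : c - d = (a - b) - (a - c) + (b - d)); last by ring.
  apply: le_trans (ler_normD _ _) _; apply: le_trans (lerD (ler_normB _ _) (lexx _)) _.
  have := le_trans h4 h3; have := le_trans h5 h2; lra.
split.
  apply: T; [by move=> [? ?] []|exact: normr_Re_le|by move=> w []].
apply: T; [by move=> [? ?] []|exact: normr_Im_le|by move=> w []].
Qed.

Section Inversion.
Variables (R : realType) (n : nat).
Local Notation X := ('rV[R]_n * 'rV[R]_n)%type.
Implicit Types (f g : X -> R[i]) (m l : 'rV[int]_n) (x v th : 'rV[R]_n).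

Lemma FC_absbnd f x : ccinf_pred f -> exists B, absbnd (fun l => FC f l x) B.
Proof.
move=> cf; have [C C0 [h _ _ _]] := FC_estimates 1 cf; exists (C * 8 ^+ n) => Y.
apply: le_trans (ler_sum _ (fun l _ => h l x)) _.
by rewrite -mulr_sumr; apply: ler_wpM2l => //; exact: wt_summable.
Qed.

(** The coefficients are absolutely summable, so the series converges uniformly to a continuous
    periodic [g]. The coefficients of [f (x, .) - g] vanish, and uniqueness gives equality. *)
Lemma fourier_inversion_uniform f x : ccinf_pred f -> forall e : R, 0 < e ->
  exists Y0 : {fset 'rV[int]_n}, forall Y, (Y0 `<=` Y)%fset ->
    forall th, nc (\sum_(l <- Y) FC f l x * chr l th - f (x, th)) <= e.
Proof.
move=> cf; have [B hB] := FC_absbnd x cf; have cfx := ccont_slice x cf.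
have abse th : absbnd (fun l => FC f l x * chr l th) B.
  by move=> Y; apply: le_trans (hB Y); apply: ler_sum => l _; rewrite ncM nc_chr mulr1.
pose g th := cusum (fun l => FC f l x * chr l th).
have unif e : 0 < e -> exists Y0 : {fset 'rV[int]_n}, forall Y, (Y0 `<=` Y)%fset ->
    forall th, nc (\sum_(l <- Y) FC f l x * chr l th - g th) <= e.
  move=> e0; have [Y0 tl] := fset_tail (fun l => nc_ge0 (FC f l x)) hB e0.
  exists Y0 => Y YY th; apply: (hsum_tail_le (hsum_cusum (abse th))) YY => Z /tl.
  by apply: le_trans; apply: ler_sum => l _; rewrite ncM nc_chr mulr1.
have cS Y : ccont (fun th => \sum_(l <- Y) FC f l x * chr l th).
  by apply: ccont_sum => l; apply: ccontZ; exact: ccont_chr.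
have cg : ccont g.
  apply: uniform_ccont => e /unif[Y0 hY]; exists (fun th => \sum_(l <- Y0) FC f l x * chr l th) => // th.
  exact: hY.
suff fg th : f (x, th) - g th = 0.
  move=> e /unif[Y0 hY]; exists Y0 => Y YY th; have /eqP := fg th.
  by rewrite subr_eq0 => /eqP ->; exact: hY.
apply: (@fourier_uniq R n (fun th => f (x, th) - g th)).
- exact: ccontB.
- apply: torus_periodicB; first by case: cf => _ /(_ x).
  move=> et m; rewrite /g; congr cusum; apply/funext => l.
  by rewrite chr_periodic.
move=> m; apply: nc_eq_eps => e e0; rewrite subr0; have [Y0 hY] := unif e e0.
(* With [- m] in [Y], the partial sum [S] has exactly the coefficient of [f] tested by [chr m], so
   only [S - g] contributes. *)
pose Y := (- m |` Y0)%fset; have YY : (Y0 `<=` Y)%fset by exact: fsubsetU1.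
pose S th := \sum_(l <- Y) FC f l x * chr l th.
have cSY : ccont S := cS Y.
have cmm := @ccont_chr R n m.
have -> : ctorus_int (fun th => (f (x, th) - g th) * chr m th) =
    ctorus_int (fun th => (f (x, th) - S th) * chr m th) + ctorus_int (fun th => (S th - g th) * chr m th).
  rewrite -cintD; [|by apply: ccontM => //; exact: ccontB|by apply: ccontM => //; exact: ccontB].
  by congr ctorus_int; apply/funext => et; rewrite -mulrDl; congr (_ * _); ring.
rewrite (_ : ctorus_int (fun th => (f (x, th) - S th) * chr m th) = 0) ?add0r; last first.
  rewrite (_ : (fun th => _) = fun th => chr (- - m) th * f (x, th) - \sum_(l <- Y) FC f l x * chr (l + m) th); last first.
    apply/funext => et; rewrite opprK mulrBl mulrC; congr (_ - _).
    by rewrite /S mulr_suml; apply: eq_bigr => l _; rewrite chrDl mulrA.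
  have cc l : ccont (fun th => FC f l x * chr (l + m) th) by apply: ccontZ; exact: ccont_chr.
  rewrite cintB; [|exact: ccont_FC|exact: ccont_sum].
  rewrite cint_sum// -/(FC f (- m) x) (big_fsetD1 (- m))/=; last by rewrite !inE eqxx.
  rewrite cintZ ?cint_chr ?addNr ?eqxx ?mulr1; last exact: ccont_chr.
  rewrite big_seq big1 ?addr0 ?subrr// => l; rewrite !inE => /andP[lm _].
  rewrite cintZ ?cint_chr; last exact: ccont_chr.
  by rewrite addr_eq0 (negPf lm) mulr0.
apply: cint_bound; first by apply: ccontM => //; exact: ccontB.
by move=> et; rewrite ncM nc_chr mulr1; exact: hY.
Qed.

(** The finite partial sums of the convolution are the coefficients of [g] times a partial Fourier
    sum of [f]; uniform inversion and a bound on [g] control the error. *)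
Lemma FC_mul f g m x : ccinf_pred f -> ccinf_pred g ->
  hsum (fun l => FC f l x * FC g (m - l) x) (FC (f * g) m x).
Proof.
move=> cf cg e e0; have [B hB] := ccinf_bounded cg.
have B0 : 0 < `|B| + 1 by rewrite ltr_wpDl.
have [Y0 hY] := fourier_inversion_uniform x cf (divr_gt0 e0 B0).
exists Y0 => Y YY; have cfx := ccont_slice x cf; have cgx := ccont_slice x cg.
have cS : ccont (fun th => \sum_(l <- Y) FC f l x * chr l th).
  by apply: ccont_sum => l; apply: ccontZ; exact: ccont_chr.
have -> : \sum_(l <- Y) FC f l x * FC g (m - l) x - FC (f * g) m x =
    ctorus_int (fun th => chr (- m) th * g (x, th) * (\sum_(l <- Y) FC f l x * chr l th - f (x, th))).
  rewrite (_ : (fun th => _) = fun th => (\sum_(l <- Y) FC f l x * (chr (- (m - l)) th * g (x, th))) -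
      chr (- m) th * (f * g) (x, th)); last first.
    apply/funext => th; rewrite mulrBr mulr_sumr; congr (_ - _); last by rewrite -mulrA [g _ * _]mulrC.
    by apply: eq_bigr => l _; rewrite opprB addrC chrDl; ring.
  have cc l : ccont (fun th => FC f l x * (chr (- (m - l)) th * g (x, th))).
    by apply: ccontZ; exact: ccont_FC.
  rewrite cintB; [|exact: ccont_sum|by apply: ccont_FC; exact: ccinf_pred_mul].
  rewrite cint_sum//; congr (_ - _); apply: eq_bigr => l _.
  by rewrite cintZ//; exact: ccont_FC.
apply: cint_bound.
  by apply: ccontM; [exact: ccont_FC|exact: ccontB].
move=> th; rewrite !ncM nc_chr mul1r.
apply: (@le_trans _ _ ((`|B| + 1) * (e / (`|B| + 1)))).
  apply: ler_pM; rewrite ?nc_ge0 ?hY//; apply: le_trans (hB _) _.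
  by apply: le_trans (ler_norm _) _; rewrite lerDl.
by rewrite mulrCA mulfV ?mulr1// gt_eqF.
Qed.

End Inversion.

(** * Schur's test and Toeplitz matrices *)

Section MatrixBounds.
Variables (R : realType).

(* |<y, a x>| <= M |y| |x| for finitely supported x and y.  By rescaling x and y
   the arithmetic mean may replace the product of norms, which makes the
   condition additive under decompositions of x and y. *)
Definition mxbound (I : choiceType) (a : I -> I -> R[i]) (M : R) :=
  forall (P Q : {fset I}) (y x : I -> R[i]),
    nc (\sum_(p <- P) \sum_(q <- Q) (y p)^* * a p q * x q) <=
    M * ((\sum_(p <- P) nc (y p) ^+ 2 + \sum_(q <- Q) nc (x q) ^+ 2) / 2).

Lemma mxboundD (I : choiceType) (a b : I -> I -> R[i]) (M N : R) :
  mxbound a M -> mxbound b N -> mxbound (fun p q => a p q + b p q) (M + N).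
Proof.
move=> aM bN P Q y x.
under eq_bigr do under eq_bigr do rewrite mulrDr mulrDl.
under eq_bigr do rewrite big_split.
rewrite big_split /=; apply: le_trans (ler_ncD _ _) _; rewrite [leRHS]mulrDl.
exact: lerD.
Qed.

Lemma eq_mxbound (I : choiceType) (a b : I -> I -> R[i]) (M : R) :
  (forall p q, a p q = b p q) -> mxbound a M -> mxbound b M.
Proof. by move=> ab; have -> : b = a by apply/funext => p; apply/funext => q; rewrite ab. Qed.

Lemma mxbound_le (I : choiceType) (a : I -> I -> R[i]) (M N : R) :
  M <= N -> mxbound a M -> mxbound a N.
Proof.
move=> MN aM P Q y x; apply: le_trans (aM P Q y x) _; apply: ler_wpM2r => //.
by rewrite divr_ge0// addr_ge0// sumr_ge0// => i _; exact: sqr_ge0.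
Qed.

Variable n : nat.
Local Notation I := 'rV[int]_n.

Lemma sum_subr_le (b : I -> R) (M : R) (p : I) (Q : {fset I}) :
  (forall X : {fset I}, \sum_(l <- X) b l <= M) -> \sum_(q <- Q) b (p - q) <= M.
Proof.
move=> bM; apply: le_trans (bM [fset p - q | q in Q]%fset).
by rewrite big_imfset//= => q q' _ _ /addrI /oppr_inj.
Qed.

Lemma sum_subl_le (b : I -> R) (M : R) (q : I) (P : {fset I}) :
  (forall X : {fset I}, \sum_(l <- X) b l <= M) -> \sum_(p <- P) b (p - q) <= M.
Proof.
move=> bM; apply: le_trans (bM [fset p - q | p in P]%fset).
by rewrite big_imfset//= => p p' _ _ /addIr.
Qed.

(** Each product [|y p| |x q|] is split by the arithmetic-geometric mean inequality. Since the
    majorant depends on [p - q] only, row sums and column sums are both sums of [b] over a finite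
    set. *)
Lemma schur_test (a : I -> I -> R[i]) (b : I -> R) (M : R) :
  (forall p q, nc (a p q) <= b (p - q)) ->
  (forall X : {fset I}, \sum_(l <- X) b l <= M) -> mxbound a M.
Proof.
move=> ab bM P Q y x.
have b0 l : 0 <= b l by apply: le_trans (nc_ge0 _) (_ : nc (a l 0) <= _); rewrite -[l in b l]subr0.
apply: (@le_trans _ _ (\sum_(p <- P) \sum_(q <- Q) (b (p - q) * nc (y p) ^+ 2 / 2 + b (p - q) * nc (x q) ^+ 2 / 2))).
  apply: le_trans (ler_nc_sum _ _ _) _; apply: ler_sum => p _.
  apply: le_trans (ler_nc_sum _ _ _) _; apply: ler_sum => q _.
  rewrite !ncM nc_conj (_ : _ * _ * _ = nc (a p q) * (nc (y p) * nc (x q))); last by ring.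
  apply: (@le_trans _ _ (b (p - q) * (nc (y p) * nc (x q)))).
    by apply: ler_wpM2r => //; rewrite mulr_ge0// nc_ge0.
  rewrite -!mulrA -mulrDr; apply: ler_wpM2l => //.
  by have := sqr_ge0 (nc (y p) - nc (x q)); rewrite sqrrB mulr2n; lra.
under eq_bigr do rewrite big_split /=.
rewrite big_split /= mulrDl mulrDr; apply: lerD.
  rewrite mulr_suml mulr_sumr; apply: ler_sum => p _.
  rewrite -!mulr_suml -mulrA; apply: ler_wpM2r; last exact: sum_subr_le.
  by rewrite divr_ge0// sqr_ge0.
rewrite exchange_big /= mulr_suml mulr_sumr; apply: ler_sum => q _.
rewrite -!mulr_suml -mulrA; apply: ler_wpM2r; last exact: sum_subl_le.
by rewrite divr_ge0// sqr_ge0.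
Qed.

(** The form equals the torus integral of [Y^* f(x, .) Z] for the trigonometric polynomials [Y], [Z]
    with coefficients [y], [z]; a pointwise bound and Parseval's identity conclude. *)
Lemma toeplitz_bound (f : 'rV[R]_n * 'rV[R]_n -> R[i]) (x : 'rV[R]_n) (S : R) :
  ccinf_pred f -> (forall p, nc (f p) <= S) ->
  mxbound (fun p q => FC f (p - q) x) S.
Proof.
move=> cf fS P Q y z.
have S0 : 0 <= S by apply: le_trans (fS (0, 0)); exact: nc_ge0.
have cT (Z : {fset I}) (w : I -> R[i]) : ccont (fun th => \sum_(p <- Z) w p * @chr R n p th).
  by apply: ccont_sum => p; apply: ccontZ; exact: ccont_chr.
have cfx := ccont_slice x cf.
have cn (Z : {fset I}) (w : I -> R[i]) : continuous (fun th => nc (\sum_(p <- Z) w p * @chr R n p th) ^+ 2).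
  exact: ccont_nc_sqr.
have -> : \sum_(p <- P) \sum_(q <- Q) (y p)^* * FC f (p - q) x * z q =
    ctorus_int (fun th => (\sum_(p <- P) y p * chr p th)^* * f (x, th) * \sum_(q <- Q) z q * chr q th).
  rewrite (_ : (fun th => _) = fun th => \sum_(p <- P) \sum_(q <- Q)
      ((y p)^* * z q) * (chr (- (p - q)) th * f (x, th))); last first.
    apply/funext => th; rewrite rmorph_sum /= !mulr_suml; apply: eq_bigr => p _.
    rewrite mulr_sumr; apply: eq_bigr => q _.
    by rewrite rmorphM /= opprB chrDl chrN; ring.
  have cc p q : ccont (fun th => ((y p)^* * z q) * (chr (- (p - q)) th * f (x, th))).
    by apply: ccontZ; exact: ccont_FC.
  rewrite cint_sum => [|p]; last exact: ccont_sum.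
  apply: eq_bigr => p _; rewrite cint_sum//; apply: eq_bigr => q _.
  by rewrite cintZ -/(FC f (p - q) x); [ring|exact: ccont_FC].
rewrite -!parseval_fset -(torus_intD (cn P y) (cn Q z)) mulrA mulrAC -torus_intZ; last first.
  by move=> th; exact: (cvgD (cn P y th) (cn Q z th)).
apply: cint_le.
- by apply: ccontM => //; apply: ccontM => //; exact: ccont_conj.
- by apply: continuous_scale => th; exact: (cvgD (cn P y th) (cn Q z th)).
move=> th; rewrite !ncM nc_conj; set a := nc _; set b := nc (\sum_(q <- Q) _).
rewrite mulrAC mulrC; apply: (@le_trans _ _ (S * (a * b))).
  by apply: ler_wpM2r => //; rewrite mulr_ge0// nc_ge0.
rewrite -[leRHS]mulrA; apply: ler_wpM2l => //.
by have := sqr_ge0 (a - b); rewrite sqrrB mulr2n; lra.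
Qed.

End MatrixBounds.

(** * Norm estimates *)

Section Windows.
Variables (R : realType) (n : nat).
Local Notation I := 'rV[int]_n.
Implicit Types (p q l z : I).

Definition inbox (L : nat) p : bool := [forall i, (0 <= p 0 i) && (p 0 i < L%:Z)].

Lemma inbox_boxv L (j : {ffun 'I_n -> 'I_L}) : inbox L (boxv 0 j).
Proof. by apply/forallP => i; rewrite mxE add0r /= ltz_nat ltn_ord. Qed.

Lemma inboxP L p : inbox L p -> exists j : {ffun 'I_n -> 'I_L}, p = boxv 0 j.
Proof.
move=> /forallP pL; have lt i : (absz (p 0%R i) < L)%N by have := pL i; lia.
exists [ffun i => Ordinal (lt i)]; apply/rowP => i; rewrite mxE ffunE /=.
by have := pL i; lia.
Qed.

Lemma window_sum (V : nzRingType) L p (h : I -> V) (Z : {fset I}) :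
  (forall j : {ffun 'I_n -> 'I_L}, p - boxv 0 j \in Z) ->
  \sum_(z <- Z) (inbox L (p - z))%:R * h z = \sum_(j : {ffun 'I_n -> 'I_L}) h (p - boxv 0 j).
Proof.
move=> hZ; pose Z' := [fset p - boxv 0 j | j in {ffun 'I_n -> 'I_L}]%fset.
have ZZ : (Z' `<=` Z)%fset by apply/fsubsetP => _ /imfsetP[j _ ->].
transitivity (\sum_(z <- Z') (inbox L (p - z))%:R * h z).
  apply/esym; apply: big_fset_incl => // z zZ zZ'.
  rewrite (_ : inbox L (p - z) = false) ?mul0r//; apply/negP => /inboxP[j pz].
  by move/negP: zZ'; apply; apply/imfsetP; exists j => //=; rewrite -pz subKr.
rewrite big_imfset /=; last by move=> j j' _ _ /addrI /oppr_inj; exact: boxv_inj.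
rewrite big_enum /=; apply: eq_bigr => j _.
by rewrite subKr inbox_boxv mul1r.
Qed.

(* The proportion of the translates of the box that contain 0 and also l. *)
Definition kappa (L : nat) l : R :=
  (L%:R ^+ n)^-1 * \sum_(j : {ffun 'I_n -> 'I_L}) (inbox L (boxv 0 j + l))%:R.

Definition kappa1 (L : nat) (d : int) : R :=
  L%:R^-1 * \sum_(t < L) ((0 <= (t : nat)%:Z + d) && ((t : nat)%:Z + d < L%:Z))%:R.

Lemma kappaE L l : kappa L l = \prod_(i < n) kappa1 L (l 0 i).
Proof.
rewrite /kappa1 big_split /= prodr_const card_ord exprVn; congr (_ * _).
rewrite (bigA_distr_bigA (fun (i : 'I_n) (t : 'I_L) =>
  ((0 <= (t : nat)%:Z + l 0 i) && ((t : nat)%:Z + l 0 i < L%:Z))%:R : R)).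
apply: eq_bigr => j _; have [/forallP h|] := boolP (inbox L (boxv 0 j + l)).
  by rewrite big1// => i _; have := h i; rewrite !mxE add0r => ->.
rewrite negb_forall => /existsP[i hi]; rewrite (bigD1 i)//=.
by move: hi; rewrite !mxE add0r => /negPf ->; rewrite mul0r.
Qed.

Lemma sum_ltn_le (L e : nat) : (\sum_(t < L) (t < e) <= e)%N.
Proof.
rewrite -(big_mkord xpredT (fun t => (t < e)%N : nat)).
elim: L => [|L IH]; first by rewrite big_geq.
rewrite big_nat_recr //=; have [Le|eL] := ltnP L e; last by rewrite addn0.
apply: leq_trans (_ : \sum_(0 <= i < L) 1 + 1 <= e)%N; last by rewrite sum_nat_const_nat; lia.
by rewrite leq_add2r; apply: leq_sum => i _; case: (i < e)%N.
Qed.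

(** The deficit counts the [t] that [d] pushes out of [[0, L)]: at most [|d|] of them, at the top
    end if [d >= 0], whence the reversal of the index, and at the bottom end otherwise. *)
Lemma kappa1_bounds L (d : int) : (0 < L)%N ->
  0 <= kappa1 L d <= 1 /\ 1 - kappa1 L d <= `|d%:~R| / L%:R.
Proof.
move=> L0; have L0R : 0 < L%:R :> R by rewrite ltr0n.
pose b (t : 'I_L) := (0 <= (t : nat)%:Z + d) && ((t : nat)%:Z + d < L%:Z).
have kE : 1 - kappa1 L d = L%:R^-1 * \sum_(t < L) (~~ b t)%:R.
  have -> : \sum_(t < L) (~~ b t)%:R = L%:R - \sum_(t < L) (b t)%:R :> R.
    have cL : \sum_(t < L) 1 = L%:R :> R by rewrite sumr_const card_ord.
    rewrite -cL -sumrB; apply: eq_bigr => t _.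
    by case: (b t); rewrite ?subrr ?subr0.
  by rewrite mulrBr mulVf ?gt_eqF.
have k0 : 0 <= kappa1 L d by rewrite mulr_ge0 ?invr_ge0 ?sumr_ge0// ltW.
have k1 : 0 <= 1 - kappa1 L d by rewrite kE mulr_ge0 ?invr_ge0 ?sumr_ge0// ltW.
split; first by apply/andP; split=> //; lra.
rewrite kE mulrC ler_pM2r ?invr_gt0// -natr_sum.
apply: (@le_trans _ _ (absz d)%:R); last by rewrite -intr_norm natr_absz.
rewrite ler_nat; have [d0|d0] := leP 0 d.
  rewrite (reindex_inj rev_ord_inj) /=; apply: leq_trans (sum_ltn_le L _).
  apply: leq_sum => t _; rewrite /b /=; have := ltn_ord t.
  by case: (ltnP t `|d|%N) => h tL; [case: (~~ _)|rewrite (_ : _ && _ = true)//; lia].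
apply: leq_trans (sum_ltn_le L _); apply: leq_sum => t _; rewrite /b; have := ltn_ord t.
by case: (ltnP t `|d|%N) => h tL; [case: (~~ _)|rewrite (_ : _ && _ = true)//; lia].
Qed.

(** A union bound over coordinates; its inductive step is [0 <= (1 - a i) * (1 - y)]. *)
Lemma one_sub_prod (a : 'I_n -> R) : (forall i, 0 <= a i <= 1) ->
  0 <= \prod_(i < n) a i <= 1 /\ 1 - \prod_(i < n) a i <= \sum_(i < n) (1 - a i).
Proof.
move=> h; elim/big_rec2: _ => [|i s y _ [/andP[y0 y1] ys]]; first by rewrite ler01 lexx subrr.
have /andP[a0 a1] := h i; split; first by rewrite mulr_ge0//= mulr_ile1.
apply: le_trans (lerD (lexx (1 - a i)) ys).
have : 0 <= (1 - a i) * (1 - y) by rewrite mulr_ge0// subr_ge0.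
by rewrite mulrBr mulr1 mulrBl mul1r; lra.
Qed.

Lemma kappa_bounds L l : (0 < L)%N ->
  0 <= 1 - kappa L l <= n%:R / L%:R * iwt R l.
Proof.
move=> L0; have h i := (kappa1_bounds (l 0 i) L0).1.
have [/andP[_ k1] k2] := one_sub_prod h.
rewrite kappaE subr_ge0 k1 /=; apply: le_trans k2 _.
apply: (@le_trans _ _ (\sum_(i < n) (`|(l 0 i)%:~R| / L%:R))).
  by apply: ler_sum => i _; exact: (kappa1_bounds (l 0 i) L0).2.
rewrite -mulr_suml mulrAC; apply: ler_wpM2r; first by rewrite invr_ge0.
exact: l1norm_le_iwt.
Qed.

Lemma kappa_sum L l : (0 < L)%N ->
  \sum_(j : {ffun 'I_n -> 'I_L}) (inbox L (boxv 0 j + l))%:R = L%:R ^+ n * kappa L l.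
Proof.
by move=> L0; rewrite mulrA mulfV ?mul1r// expf_neq0// pnatr_eq0 -lt0n.
Qed.

Lemma card_box L : #|{ffun 'I_n -> 'I_L}|%:R = L%:R ^+ n :> R.
Proof. by rewrite card_ffun !card_ord natrX. Qed.

End Windows.

(** * Upper and lower norm bounds for the Weyl matrix *)

Section WeylMatrix.
Variables (R : realType) (n : nat).
Local Notation I := 'rV[int]_n.
Local Notation X := ('rV[R]_n * 'rV[R]_n)%type.
Implicit Types (p q l z : I) (f g : X -> R[i]).

Definition midpt (k : nat) p q : 'rV[R]_n :=
  2^-1 *: (k%:R^-1 *: map_mx intr p + k%:R^-1 *: map_mx intr q).

Definition weylmx k f p q : R[i] := FC f (p - q) (midpt k p q).

(** The tolerance 1 on [k x - z] covers both uses: [x = z / k] exactly, and [z] the integer part of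
    [k x]. It accounts for the [+ 1] in [L.+1]. *)
Lemma midpt_near (k L : nat) p q z (x : 'rV[R]_n) : (0 < k)%N ->
  inbox L (p - z) -> inbox L (q - z) ->
  (forall i, `|k%:R * x 0 i - (z 0 i)%:~R| <= 1) ->
  l1 (midpt k p q - x) <= n%:R * (L.+1%:R / k%:R).
Proof.
move=> k0 /forallP pL /forallP qL xz; have k0R : 0 < k%:R :> R by rewrite ltr0n.
rewrite -[n in n%:R](card_ord n) mulr_natl -sumr_const; apply: ler_sum => i _.
rewrite ler_pdivlMr// -[X in _ * X <= _](gtr0_norm k0R) -normrM !mxE.
have -> : (2^-1 * (k%:R^-1 * (p 0 i)%:~R + k%:R^-1 * (q 0 i)%:~R) - x 0 i) * k%:R =
   (((p - z) 0 i)%:~R + ((q - z) 0 i)%:~R) / 2 - (k%:R * x 0 i - (z 0 i)%:~R) :> R.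
  by rewrite !mxE !rmorphB /=; field; rewrite pnatr_eq0 -lt0n k0.
apply: le_trans (ler_normB _ _) _; rewrite -[L.+1%:R]natr1; apply: lerD => //.
have := pL i; have := qL i; rewrite -(ler0z R) -(ler0z R) => /andP[q0 q1] /andP[p0 p1].
have p1' : ((p - z) 0 i)%:~R <= L%:R :> R.
  by rewrite -[L%:R]/((L%:Z)%:~R) ler_int ltW.
have q1' : ((q - z) 0 i)%:~R <= L%:R :> R.
  by rewrite -[L%:R]/((L%:Z)%:~R) ler_int ltW.
by rewrite ger0_norm; lra.
Qed.

Lemma nc_nat (b : bool) : nc (b%:R : R[i]) = b%:R :> R.
Proof. by case: b; rewrite ?nc1 ?nc0. Qed.

Lemma weylmx_upper f (S : R) : ccinf_pred f -> (forall w, nc (f w) <= S) ->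
  exists2 C : R, 0 <= C & forall L k, (0 < L)%N -> (0 < k)%N ->
    mxbound (weylmx k f) (S + C * (L%:R^-1 + L.+1%:R / k%:R)).
Proof.
(* Of the two powers of [wt], one absorbs the [iwt] in the bound on [1 - kappa], the other is
   summed. *)
move=> cf fS; have [C C0 [h0 h1 _ _]] := FC_estimates 2 cf.
exists (C * n%:R * 8 ^+ n) => [|L k L0 k0]; first by rewrite !mulr_ge0 ?exprn_ge0.
have L0R : 0 < L%:R :> R by rewrite ltr0n.
have k0R : 0 < k%:R :> R by rewrite ltr0n.
have N0 : 0 < L%:R ^+ n :> R by rewrite exprn_gt0.
pose A := weylmx k f; pose K p q : R[i] := (kappa R L (q - p))%:C.
rewrite mulrDr addrA addrAC.
(* The multiplier [1 - K] is at most [n / L * iwt (q - p)], so the second summand is [O(1/L)] by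
   Schur's test. The first one is an average of matrices truncated to boxes. *)
apply: (@eq_mxbound _ _ (fun p q => K p q * A p q + (1 - K p q) * A p q)) => [p q|].
  by rewrite -mulrDl addrC subrK mul1r.
apply: mxboundD; last first.
  apply: (@schur_test R n _ (fun l => C * n%:R / L%:R * wt R l)) => [p q|Y]; last first.
    rewrite -mulr_sumr mulrAC; apply: ler_wpM2r; first by rewrite invr_ge0 ltW.
    by apply: ler_wpM2l; [rewrite mulr_ge0|exact: wt_summable].
  rewrite ncM (_ : 1 - K p q = (1 - kappa R L (q - p))%:C) ?nc_real; last by rewrite rmorphB.
  have /andP[k1 k2] := kappa_bounds R (q - p) L0.
  rewrite ger0_norm//; apply: le_trans (ler_pM k1 (nc_ge0 _) k2 (h0 (p - q) _)) _.
  rewrite -opprB iwtN [leLHS](_ : _ = C * n%:R / L%:R * wt R (p - q) * (wt R (p - q) * iwt R (p - q))).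
    by rewrite iwtK mulr1.
  by ring.
set M := S + _; move=> P Q y x.
(* All corners of boxes that meet [P] or [Q], which makes the average over translates a finite
   sum. *)
pose Z := [fset p - boxv 0 j | p in (P `|` Q)%fset, j in {ffun 'I_n -> 'I_L}]%fset.
have ZP p (j : {ffun 'I_n -> 'I_L}) : p \in (P `|` Q)%fset -> p - boxv 0 j \in Z.
  by move=> pPQ; apply/imfset2P; exists p => //; exists j.
pose T z p q : R[i] := (inbox L (p - z))%:R * (inbox L (q - z))%:R * A p q.
have KE p q : p \in P -> K p q * A p q = ((L%:R ^+ n)^-1)%:C * \sum_(z <- Z) T z p q.
  move=> pP; under eq_bigr do rewrite /T -mulrA.
  rewrite window_sum => [|j]; last by apply: ZP; rewrite inE pP.
  rewrite -mulr_suml mulrA; congr (_ * _); rewrite /K /kappa rmorphM rmorph_sum; congr (_ * _).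
  apply: eq_bigr => j _; rewrite opprB addrCA; by case: (inbox _ _).
have -> : \sum_(p <- P) \sum_(q <- Q) (y p)^* * (K p q * A p q) * x q =
    ((L%:R ^+ n)^-1)%:C * \sum_(z <- Z) \sum_(p <- P) \sum_(q <- Q) (y p)^* * T z p q * x q.
  rewrite (exchange_big _ Z) /= mulr_sumr; apply: eq_big_seq => p pP.
  rewrite (exchange_big _ Z) /= mulr_sumr; apply: eq_bigr => q _.
  have -> : \sum_(z <- Z) (y p)^* * T z p q * x q = (y p)^* * (\sum_(z <- Z) T z p q) * x q.
    by rewrite mulr_sumr mulr_suml.
  by rewrite KE//; ring.
(* On the box with corner [z] the base point is frozen at [z / k]: [T z] is a Toeplitz matrix plus
   the error [D], tested on [y] and [x] cut off to the box. *)
have Mz z : nc (\sum_(p <- P) \sum_(q <- Q) (y p)^* * T z p q * x q) <=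
    M * ((\sum_(p <- P) (inbox L (p - z))%:R * nc (y p) ^+ 2
        + \sum_(q <- Q) (inbox L (q - z))%:R * nc (x q) ^+ 2) / 2).
  pose xz : 'rV[R]_n := k%:R^-1 *: map_mx intr z.
  pose D p q : R[i] := (inbox L (p - z))%:R * (inbox L (q - z))%:R * (A p q - FC f (p - q) xz).
  have DM : mxbound D (C * n%:R * 8 ^+ n * (L.+1%:R / k%:R)).
    have Ck : 0 <= C * (n%:R * (L.+1%:R / k%:R)) by rewrite !mulr_ge0// invr_ge0 ltW.
    apply: (@schur_test R n _ (fun l => C * (n%:R * (L.+1%:R / k%:R)) * wt R l ^+ 2)) => [p q|Y]; last first.
      apply: (@le_trans _ _ (C * (n%:R * (L.+1%:R / k%:R)) * 8 ^+ n)); last first.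
        by rewrite le_eqVlt; apply/orP; left; apply/eqP; ring.
      rewrite -mulr_sumr; apply: ler_wpM2l => //; apply: le_trans (wt_summable R Y).
      by apply: ler_sum => l _; rewrite expr2 ler_piMr ?wt_ge0 ?wt_le1.
    have rhs0 : 0 <= C * (n%:R * (L.+1%:R / k%:R)) * wt R (p - q) ^+ 2.
      by rewrite mulr_ge0// exprn_ge0// wt_ge0.
    rewrite !ncM !nc_nat; case pz: (inbox L (p - z)); last by rewrite !mul0r.
    case qz: (inbox L (q - z)); last by rewrite mulr0 mul0r.
    rewrite !mul1r /A /weylmx (_ : midpt k p q = xz + (midpt k p q - xz)); last by rewrite addrC subrK.
    apply: le_trans (h1 _ _ _) _; apply: ler_wpM2r; first by rewrite exprn_ge0// wt_ge0.
    apply: ler_wpM2l => //; apply: (@midpt_near k L p q z) => // i.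
    by rewrite !mxE mulVKf ?gt_eqF// subrr normr0.
  have := mxboundD (toeplitz_bound xz cf fS) DM.
  move=> /(_ P Q (fun p => (inbox L (p - z))%:R * y p) (fun q => (inbox L (q - z))%:R * x q)).
  have E2 (Y : {fset I}) (w : I -> R[i]) : \sum_(p <- Y) nc ((inbox L (p - z))%:R * w p) ^+ 2 =
      \sum_(p <- Y) (inbox L (p - z))%:R * nc (w p) ^+ 2.
    by apply: eq_bigr => p _; rewrite ncM nc_nat; case: (inbox _ _); rewrite ?mul1r ?mul0r ?expr0n.
  rewrite !E2 -/M; apply: le_trans; rewrite le_eqVlt; apply/orP; left; apply/eqP; congr nc.
  apply: eq_bigr => p _; apply: eq_bigr => q _.
  rewrite /T /D; case: (inbox L (p - z)); case: (inbox L (q - z)); rewrite ?mul1r ?mulr1 ?mul0r ?mulr0 ?mul0r.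
  - by rewrite [_ + (_ - _)]addrC subrK.
  - by [].
  - by rewrite rmorph0 ?mul0r.
  - by rewrite ?rmorph0 ?mul0r ?mulr0 ?mul0r.
(* Each point lies in exactly [L ^ n] of the boxes; this cancels the normalization, so averaging
   loses nothing. *)
have wsum (Y : {fset I}) (w : I -> R) : (Y `<=` P `|` Q)%fset ->
    \sum_(z <- Z) \sum_(p <- Y) (inbox L (p - z))%:R * w p = L%:R ^+ n * \sum_(p <- Y) w p.
  move=> YPQ; rewrite exchange_big /= mulr_sumr; apply: eq_big_seq => p pY.
  rewrite (window_sum (fun=> w p)) => [|j]; last by apply: ZP; exact: (fsubsetP YPQ).
  by rewrite sumr_const -[LHS]mulr_natl card_box.
rewrite ncM nc_real gtr0_norm ?invr_gt0// [leLHS]mulrC ler_pdivrMr//.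
apply: le_trans (ler_nc_sum _ _ _) _; apply: le_trans (ler_sum _ (fun z _ => Mz z)) _.
rewrite -mulr_sumr -mulr_suml big_split /= !wsum ?fsubsetUl ?fsubsetUr//.
by rewrite -mulrDr le_eqVlt; apply/orP; left; apply/eqP; ring.
Qed.

Lemma weylmx_lower f : ccinf_pred f ->
  exists2 C : R, 0 <= C & forall L k (M : R) (w : X), (0 < L)%N -> (0 < k)%N ->
    mxbound (weylmx k f) M -> nc (f w) <= M + C * (L%:R^-1 + L.+1%:R / k%:R).
Proof.
move=> cf; have [C C0 [h0 h1 _ _]] := FC_estimates 2 cf.
exists (C * n%:R * 8 ^+ n) => [|L k M [x0 th] L0 k0 AM]; first by rewrite !mulr_ge0 ?exprn_ge0.
have L0R : 0 < L%:R :> R by rewrite ltr0n.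
have k0R : 0 < k%:R :> R by rewrite ltr0n.
have N0 : 0 < L%:R ^+ n :> R by rewrite exprn_gt0.
pose p0 : I := \row_i Num.floor (k%:R * x0 0 i).
pose b (j : {ffun 'I_n -> 'I_L}) : I := p0 + boxv 0 j.
have bI : injective b by move=> j j' /addrI; exact: boxv_inj.
pose Bx := [fset b j | j in {ffun 'I_n -> 'I_L}]%fset.
have sumB (V : nmodType) (h : I -> V) : \sum_(p <- Bx) h p = \sum_j h (b j).
  by rewrite big_imfset/= ?big_enum//= => j j' _ _; exact: bI.
have wt2 p : \sum_j wt R (p - b j) ^+ 2 <= 8 ^+ n.
  rewrite -(sumB _ (fun q => wt R (p - q) ^+ 2)).
  apply: (@sum_subr_le R n (fun l => wt R l ^+ 2)) => Y; apply: le_trans (wt_summable R Y).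
  by apply: ler_sum => l _; rewrite expr2 ler_piMr ?wt_ge0 ?wt_le1.
pose g l := FC f l x0 * chr l th.
pose G := \sum_j \sum_j' g (b j - b j').
have e1 : nc (\sum_j \sum_j' chr (b j) th * weylmx k f (b j) (b j') * chr (- b j') th) <= M * L%:R ^+ n.
  have := AM Bx Bx (fun p => chr (- p) th) (fun p => chr (- p) th).
  have sN : \sum_(p <- Bx) nc (@chr R n (- p) th) ^+ 2 = L%:R ^+ n.
    rewrite sumB; under eq_bigr do rewrite nc_chr expr1n.
    by rewrite sumr_const card_box.
  rewrite sN -mulr2n -[_ *+ 2]mulr_natr mulfK ?pnatr_eq0//; apply: le_trans.
  rewrite sumB le_eqVlt; apply/orP; left; apply/eqP; congr nc; apply: eq_bigr => j _.
  have cE : (chr (- b j) th)^* = chr (b j) th by rewrite -chrN opprK.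
  by rewrite sumB; apply: eq_bigr => j' _; congr (_ * _ * _); exact: esym cE.
have e2 : nc (G - \sum_j \sum_j' chr (b j) th * weylmx k f (b j) (b j') * chr (- b j') th) <=
    L%:R ^+ n * (C * (n%:R * (L.+1%:R / k%:R)) * 8 ^+ n).
  have Ck : 0 <= C * (n%:R * (L.+1%:R / k%:R)) by rewrite !mulr_ge0// invr_ge0 ltW.
  rewrite /G -sumrB; apply: le_trans (ler_nc_sum _ _ _) _.
  rewrite -card_box mulr_natl -sumr_const; apply: ler_sum => j _.
  rewrite -sumrB; apply: le_trans (ler_nc_sum _ _ _) _.
  apply: le_trans (ler_wpM2l Ck (wt2 (b j))); rewrite mulr_sumr; apply: ler_sum => j' _.
  rewrite (_ : _ - _ = chr (b j - b j') th * (FC f (b j - b j') x0 - weylmx k f (b j) (b j'))).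
    rewrite ncM nc_chr mul1r ncBC /weylmx (_ : midpt k (b j) (b j') = x0 + (midpt k (b j) (b j') - x0)); last by rewrite addrC subrK.
    apply: le_trans (h1 _ _ _) _; apply: ler_wpM2r; first by rewrite exprn_ge0// wt_ge0.
    apply: ler_wpM2l => //; apply: (@midpt_near k L _ _ p0); rewrite ?/b ?[p0 + _]addrC ?addrK ?inbox_boxv//.
    move=> i; rewrite mxE ler_norml; have := floor_itv (k%:R * x0 0 i).
    by rewrite rmorphD /= => /andP[? ?]; apply/andP; split; lra.
  by rewrite /g chrDl; ring.
have e3 : nc (G - (L%:R ^+ n)%:C * f (x0, th)) <= L%:R ^+ n * (C * n%:R * 8 ^+ n / L%:R).
  apply/ler_addgt0Pr => e e0; have eN : 0 < e / L%:R ^+ n by rewrite divr_gt0.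
  have [Y0 hY] := fourier_inversion_uniform x0 cf eN.
  (* The differences of box points make the rewriting of [G] exact; [Y0] makes the partial Fourier
     sum close to [f]. *)
  pose Y := (Y0 `|` [fset b j - b j' | j in {ffun 'I_n -> 'I_L}, j' in {ffun 'I_n -> 'I_L}])%fset.
  have YY : (Y0 `<=` Y)%fset by exact: fsubsetUl.
  have {}hY := hY Y YY th.
  have GE : G = (L%:R ^+ n)%:C * \sum_(l <- Y) (kappa R L (- l))%:C * g l.
    rewrite /G; transitivity (\sum_(j : {ffun 'I_n -> 'I_L}) \sum_(l <- Y) (inbox L (boxv 0 j - l))%:R * g l).
      apply: eq_bigr => j _; transitivity (\sum_(j' : {ffun 'I_n -> 'I_L}) g (boxv 0 j - boxv 0 j')).
        by apply: eq_bigr => j' _; rewrite /b opprD addrACA subrr add0r.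
      rewrite -(@window_sum n R[i] L (boxv 0 j) g Y)// => j'.
      rewrite inE; apply/orP; right; apply/imfset2P; exists j => //; exists j' => //.
      by rewrite /b opprD addrACA subrr add0r.
    rewrite exchange_big mulr_sumr /=; apply: eq_bigr => l _.
    rewrite -mulr_suml mulrA; congr (_ * _); rewrite -rmorphM -kappa_sum// rmorph_sum.
    by apply: eq_bigr => j _; case: (inbox _ _).
  rewrite GE -mulrBr ncM nc_real gtr0_norm//.
  have eE : e = L%:R ^+ n * (e / L%:R ^+ n) by rewrite mulrC divfK// gt_eqF.
  rewrite [leRHS](_ : _ = L%:R ^+ n * (C * n%:R * 8 ^+ n / L%:R + e / L%:R ^+ n)); last by rewrite mulrDr -eE.
  apply: ler_wpM2l; first exact: ltW.
  rewrite (_ : _ - _ = (\sum_(l <- Y) g l - f (x0, th)) - \sum_(l <- Y) (1 - (kappa R L (- l))%:C) * g l); last first.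
    rewrite addrAC -sumrB; congr (_ - _); apply: eq_bigr => l _.
    by rewrite mulrBl mul1r subKr.
  apply: le_trans (ler_ncB _ _) _; rewrite addrC; apply: lerD; last exact: hY.
  apply: le_trans (ler_nc_sum _ _ _) _.
  apply: (@le_trans _ _ (\sum_(l <- Y) C * n%:R / L%:R * wt R l)).
    apply: ler_sum => l _; rewrite ncM (_ : 1 - _ = (1 - kappa R L (- l))%:C) ?nc_real; last by rewrite rmorphB.
    have /andP[k1 k2] := kappa_bounds R (- l) L0.
    rewrite /g ncM nc_chr mulr1 ger0_norm//.
    apply: le_trans (ler_pM k1 (nc_ge0 _) k2 (h0 l _)) _.
    rewrite iwtN [leLHS](_ : _ = C * n%:R / L%:R * wt R l * (wt R l * iwt R l)); last by ring.
    by rewrite iwtK mulr1.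
  rewrite -mulr_sumr [leRHS]mulrAC; apply: ler_wpM2l; last exact: wt_summable.
  by rewrite !mulr_ge0// invr_ge0 ltW.
rewrite -(ler_pM2l N0) -[L%:R ^+ n in leLHS](gtr0_norm N0) -nc_real -ncM.
set S := \sum_j _ in e1 e2.
rewrite (_ : _%:C * _ = S + (G - S) - (G - (L%:R ^+ n)%:C * f (x0, th))); last by ring.
apply: le_trans (ler_ncB _ _) _; apply: le_trans (lerD (ler_ncD _ _) (lexx _)) _.
apply: le_trans (lerD (lerD e1 e2) e3) _.
by rewrite le_eqVlt; apply/orP; left; apply/eqP; ring.
Qed.

End WeylMatrix.

(** * The commutator estimate *)

Section CommutatorEstimate.
Variables (R : realType) (n : nat).
Local Notation I := 'rV[int]_n.
Local Notation X := ('rV[R]_n * 'rV[R]_n)%type.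
Implicit Types (p q r l m : I) (f g : X -> R[i]).

(* F and G are evaluated at x, Fp, Gp and Fm, Gm at the points displaced by + and
   - the increment, Fu and Gv are the first-order terms. *)
Lemma commutator_term (F Fp Fm Fu G Gp Gm Gv : R[i]) (U V a b : R) :
  nc F <= a -> nc (Fp - F) <= U * a -> nc (Fm - F) <= U * a -> nc Fu <= U * a ->
  nc (Fp - F - Fu) <= U ^+ 2 * a -> nc (Fm - F + Fu) <= U ^+ 2 * a ->
  nc G <= b -> nc (Gp - G) <= V * b -> nc (Gm - G) <= V * b -> nc Gv <= V * b ->
  nc (Gp - G - Gv) <= V ^+ 2 * b -> nc (Gm - G + Gv) <= V ^+ 2 * b ->
  nc (Fp * Gm - Gp * Fm - 2%:R * (Fu * G) + 2%:R * (F * Gv)) <=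
    (2 * U ^+ 2 * V + 2 * U ^+ 2 + 4 * (U * V) + 2 * U * V ^+ 2 + 2 * V ^+ 2) * (a * b).
Proof.
move=> F0 F1 F2 F3 F4 F5 G0 G1 G2 G3 G4 G5.
(* Twice [Fp * Gm - Gp * Fm] is [(Fp - Fm) * (Gp + Gm) + (Fp + Fm) * (Gm - Gp)]. Here [al] and [de]
   are the odd differences minus their linear parts, of second order; [be] and [ga] are the even
   sums minus their values at [x], for which first order suffices since they meet another small
   factor. *)
pose al := (Fp - F - Fu) - (Fm - F + Fu); pose be := (Gp - G) + (Gm - G).
pose ga := (Fp - F) + (Fm - F); pose de := (Gm - G + Gv) - (Gp - G - Gv).
have al_le : nc al <= 2 * U ^+ 2 * a by apply: le_trans (ler_ncB _ _) _; lra.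
have be_le : nc be <= 2 * V * b by apply: le_trans (ler_ncD _ _) _; lra.
have ga_le : nc ga <= 2 * U * a by apply: le_trans (ler_ncD _ _) _; lra.
have de_le : nc de <= 2 * V ^+ 2 * b by apply: le_trans (ler_ncB _ _) _; lra.
have M (x y : R[i]) (u v : R) : nc x <= u -> nc y <= v -> nc (x * y) <= u * v.
  by move=> xu yv; rewrite ncM; apply: ler_pM; rewrite ?nc_ge0.
have h : nc (2^-1%:C : R[i]) <= 2^-1 by rewrite nc_real ger0_norm.
have h2 : 2%:R * 2^-1%:C = 1 :> R[i].
  have -> : 2%:R = (2%:R : R)%:C :> R[i] by rewrite rmorph_nat.
  by rewrite -rmorphM mulfV ?pnatr_eq0// rmorph1.
have -> : Fp * Gm - Gp * Fm - 2%:R * (Fu * G) + 2%:R * (F * Gv) =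
   2^-1%:C * (al * be) + al * G + Fu * be + 2^-1%:C * (ga * de) - ga * Gv + F * de.
  rewrite -[Fp * Gm]mul1r -[Gp * Fm]mul1r -h2.
  have e1 : al * be + ga * de = 2%:R * (Fp * Gm - Gp * Fm - al * G - Fu * be - 2%:R * (Fu * G) + ga * Gv - F * de + 2%:R * (F * Gv)).
    by rewrite /al /be /ga /de; ring.
  have e2 : 2^-1%:C * (al * be) + 2^-1%:C * (ga * de) = Fp * Gm - Gp * Fm - al * G - Fu * be - 2%:R * (Fu * G) + ga * Gv - F * de + 2%:R * (F * Gv).
    by rewrite -mulrDr e1 mulrA [_%:C * _]mulrC h2 mul1r.
  rewrite h2 !mul1r; move: e2; set x := 2^-1%:C * _; set y := 2^-1%:C * _ => e2.
  rewrite (_ : x + al * G + Fu * be + y - ga * Gv + F * de = (x + y) + al * G + Fu * be - ga * Gv + F * de); last by ring.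
  by rewrite e2; ring.
apply: le_trans (ler_ncD _ _) _; apply: le_trans (lerD (ler_ncB _ _) (lexx _)) _.
apply: le_trans (lerD (lerD (ler_ncD _ _) (lexx _)) (lexx _)) _.
apply: le_trans (lerD (lerD (lerD (ler_ncD _ _) (lexx _)) (lexx _)) (lexx _)) _.
apply: le_trans (lerD (lerD (lerD (lerD (ler_ncD _ _) (lexx _)) (lexx _)) (lexx _)) (lexx _)) _.
have m1 := M _ _ _ _ h (M _ _ _ _ al_le be_le).
have m2 := M _ _ _ _ al_le G0.
have m3 := M _ _ _ _ F3 be_le.
have m4 := M _ _ _ _ h (M _ _ _ _ ga_le de_le).
have m5 := M _ _ _ _ ga_le G3.
have m6 := M _ _ _ _ F0 de_le.
apply: le_trans (lerD (lerD (lerD (lerD (lerD m1 m2) m3) m4) m5) m6) _.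
by rewrite le_eqVlt; apply/orP; left; apply/eqP; field.
Qed.

(** [U] and [V] are both at most [W = N t A B]. Quadratic terms are bounded by [W ^+ 2] and cubic
    ones by [W ^+ 3], which [t <= 1] also puts below [E]; the coefficients 2, 2, 4, 2, 2 add up to
    12. *)
Lemma commutator_coef (U V A B N t : R) : 0 <= U -> 0 <= V -> 1 <= A -> 1 <= B ->
  1 <= N -> 0 < t -> t <= 1 -> U <= N * t * B -> V <= N * t * A ->
  2 * U ^+ 2 * V + 2 * U ^+ 2 + 4 * (U * V) + 2 * U * V ^+ 2 + 2 * V ^+ 2
    <= 12 * (N ^+ 3 * t ^+ 2 * (A * B) ^+ 3).
Proof.
move=> U0 V0 A1 B1 N1 t0 t1 UB VA.
have A0 : 0 <= A by lra.
have B0 : 0 <= B by lra.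
have N0 : 0 <= N by lra.
have AB1 : 1 <= A * B by rewrite -[1]mulr1; apply: ler_pM.
have AB0 : 0 <= A * B by lra.
pose W := N * t * (A * B).
have Nt0 : 0 <= N * t by rewrite mulr_ge0// ltW.
have UW : U <= W by apply: le_trans UB _; apply: ler_wpM2l => //; exact: ler_peMl.
have VW : V <= W by apply: le_trans VA _; apply: ler_wpM2l => //; exact: ler_peMr.
have W0 : 0 <= W by apply: le_trans UW.
set E := N ^+ 3 * t ^+ 2 * (A * B) ^+ 3.
have P0 : 0 <= N ^+ 2 * t ^+ 2 * (A * B) ^+ 2.
  by rewrite -!exprMn exprn_ge0// mulr_ge0.
have W2 : W ^+ 2 <= E.
  have -> : W ^+ 2 = N ^+ 2 * t ^+ 2 * (A * B) ^+ 2 * 1 by rewrite /W; ring.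
  have -> : E = N ^+ 2 * t ^+ 2 * (A * B) ^+ 2 * (N * (A * B)) by rewrite /E; ring.
  by apply: ler_wpM2l => //; rewrite -[1]mulr1; apply: ler_pM.
have W3 : W ^+ 3 <= E.
  have E0 : 0 <= E by apply: le_trans W2; exact: sqr_ge0.
  have -> : W ^+ 3 = E * t by rewrite /W /E; ring.
  by rewrite -[leRHS]mulr1; apply: ler_wpM2l.
have U2 : U ^+ 2 <= W ^+ 2 by rewrite lerXn2r ?nnegrE.
have V2 : V ^+ 2 <= W ^+ 2 by rewrite lerXn2r ?nnegrE.
have UV : U * V <= W ^+ 2 by rewrite (expr2 W); apply: ler_pM.
have UUV : U ^+ 2 * V <= W ^+ 3 by rewrite (exprSr W 2); apply: ler_pM; rewrite ?sqr_ge0.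
have UVV : U * V ^+ 2 <= W ^+ 3 by rewrite (exprS W 2); apply: ler_pM; rewrite ?sqr_ge0.
lra.
Qed.

Definition halfstep (k : nat) l : 'rV[R]_n := (2^-1 * k%:R^-1) *: map_mx intr l.

(** The constant is taken as [n.+1] so that it is at least 1, as [commutator_coef] requires of [N],
    even for [n = 0]. *)
Lemma l1_halfstep k l : (0 < k)%N -> l1 (halfstep k l) <= (n.+1%:R) * k%:R^-1 * iwt R l.
Proof.
move=> k0; have k0R : 0 < k%:R^-1 :> R by rewrite invr_gt0 ltr0n.
have -> : l1 (halfstep k l) = 2^-1 * k%:R^-1 * \sum_(i < n) `|(l 0 i)%:~R|.
  rewrite /l1 mulr_sumr; apply: eq_bigr => i _; rewrite !mxE normrM gtr0_norm//.
  by rewrite mulr_gt0.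
apply: le_trans (ler_wpM2l _ (l1norm_le_iwt R l)) _; first by rewrite mulr_ge0// ltW.
have i0 := ltW (iwt_gt0 R l); have n0 : 0 <= n%:R :> R by [].
rewrite -[n.+1%:R]natr1 [leLHS](_ : _ = (2^-1 * n%:R) * k%:R^-1 * iwt R l); last by ring.
by apply: ler_wpM2r => //; apply: ler_wpM2r; [exact: ltW|lra].
Qed.

Lemma l1N (v : 'rV[R]_n) : l1 (- v) = l1 v.
Proof. by apply: eq_bigr => i _; rewrite mxE normrN. Qed.

Lemma FC_poisson f g m x : ccinf_pred f -> ccinf_pred g ->
  hsum (fun l => \sum_(i < n)
      (FC (dx i f) l x * ('i%C * (((m - l) 0 i)%:~R)%:C * FC g (m - l) x) -
       'i%C * ((l 0 i)%:~R)%:C * FC f l x * FC (dx i g) (m - l) x))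
    (FC (poisson_fun f g) m x).
Proof.
move=> cf cg; have cx i (h : X -> R[i]) : ccinf_pred h -> ccinf_pred (dx i h) by exact: ccinf_pred_cderive.
have ct i (h : X -> R[i]) : ccinf_pred h -> ccinf_pred (dth i h) by exact: ccinf_pred_cderive.
have cfi i := cx i f cf; have cgi i := cx i g cg; have tfi i := ct i f cf; have tgi i := ct i g cg.
have c1 i := ccinf_pred_mul (cfi i) (tgi i); have c2 i := ccinf_pred_mul (tfi i) (cgi i).
rewrite /poisson_fun (FC_sum _ _ _ (fun i => ccinf_predB (c1 i) (c2 i))).
apply: hsum_sum => i; rewrite (FCB m x (c1 i) (c2 i)).
apply: hsumB.
  apply: eq_hsum (FC_mul m x (cfi i) (tgi i)) => l.
  by rewrite FC_dth.
apply: eq_hsum (FC_mul m x (tfi i) (cgi i)) => l.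
by rewrite FC_dth.
Qed.

Lemma weylmx_commutator f g : ccinf_pred f -> ccinf_pred g ->
  exists2 C : R, 0 <= C & forall k p r S1 S2, (0 < k)%N ->
    hsum (fun q => weylmx k f p q * weylmx k g q r) S1 ->
    hsum (fun q => weylmx k g p q * weylmx k f q r) S2 ->
    nc (S1 - S2 + 'i%C * (k%:R^-1)%:C * weylmx k (poisson_fun f g) p r)
      <= C * k%:R ^- 2 * wt R (p - r).
Proof.
(* Five powers: three absorb the factor [(A * B) ^+ 3] of [commutator_coef], one gives decay in [m]
   by Peetre's inequality and one is summed over [l]. *)
move=> cf cg; have [Cf Cf0 [f0 f1 f2 f3]] := FC_estimates 5 cf.
have [Cg Cg0 [g0 g1 g2 g3]] := FC_estimates 5 cg.
exists (12 * n.+1%:R ^+ 3 * (Cf * Cg) * 2 ^+ n * 8 ^+ n) => [|k p r S1 S2 k0 h1 h2].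
  by rewrite !mulr_ge0// exprn_ge0.
pose m := p - r; pose x := midpt R k p r.
have k0R : 0 < k%:R :> R by rewrite ltr0n.
have t0 : 0 < k%:R^-1 :> R by rewrite invr_gt0.
have t1 : k%:R^-1 <= 1 :> R by rewrite invf_le1// ler1n.
have kn : k%:R != 0 :> R by rewrite gt_eqF.
have {}h1 : hsum (fun l => FC f l (x + halfstep k (m - l)) * FC g (m - l) (x - halfstep k l)) S1.
  have := @hsum_bij R _ _ (fun l => p - l) (fun l => p - l) _ _ (subKr p) (subKr p) h1.
  apply: eq_hsum => l /=; rewrite /weylmx subKr; congr (FC f l _ * FC g _ _).
  - by apply/rowP => i; rewrite !mxE !rmorphB /=; field.
  - by rewrite /m addrAC.
  - by apply/rowP => i; rewrite !mxE !rmorphB /=; field.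
have {}h2 : hsum (fun l => FC g (m - l) (x + halfstep k l) * FC f l (x - halfstep k (m - l))) S2.
  (* The first product is reindexed by [q = p - l], the second by [q = r + l], so that [f] has
     frequency [l] and [g] has [m - l] in both. *)
  have u1 : cancel (fun l => r + l) (fun q => q - r) by move=> l; rewrite addrAC subrr add0r.
  have u2 : cancel (fun q => q - r) (fun l => r + l) by move=> l; rewrite addrC subrK.
  have := @hsum_bij R _ _ _ _ _ _ u1 u2 h2.
  apply: eq_hsum => l /=; rewrite /weylmx; congr (FC g _ _ * FC f _ _).
  - by rewrite /m opprD addrA.
  - by apply/rowP => i; rewrite !mxE !rmorphD /=; field.
  - by rewrite addrAC subrr add0r.
  - by apply/rowP => i; rewrite !mxE !rmorphB ?rmorphD /=; field.
have h3 := hsumZ ('i%C * (k%:R^-1)%:C) (FC_poisson m x cf cg).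
have := hsumD (hsumB h1 h2) h3; apply: hsum_abs_le => Y.
pose K : R := 12 * n.+1%:R ^+ 3 * (Cf * Cg) * 2 ^+ n * k%:R ^- 2 * wt R m.
have K0 : 0 <= K by rewrite !mulr_ge0// ?exprn_ge0// ?wt_ge0// invr_ge0 exprn_ge0// ltW.
apply: (@le_trans _ _ (\sum_(l <- Y) K * wt R l)); last first.
  rewrite -mulr_sumr; apply: le_trans (ler_wpM2l K0 (wt_summable R Y)) _.
  by rewrite le_eqVlt; apply/orP; left; apply/eqP; rewrite /K /m; ring.
apply: ler_sum => l _; pose u := halfstep k (m - l); pose v := halfstep k l.
(* The square of ['i] gives the sign, and [j / k] is twice [halfstep k j]: the Poisson bracket term
   cancels exactly the first-order terms of the commutator. *)
have pE : 'i%C * (k%:R^-1)%:C * (\sum_(i < n)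
      (FC (dx i f) l x * ('i%C * (((m - l) 0 i)%:~R)%:C * FC g (m - l) x) -
       'i%C * ((l 0 i)%:~R)%:C * FC f l x * FC (dx i g) (m - l) x)) =
   - (2%:R * (FC (cderive (u, 0) f) l x * FC g (m - l) x))
   + 2%:R * (FC f l x * FC (cderive (v, 0) g) (m - l) x).
  have ii : 'i%C * 'i%C = -1 :> R[i] by rewrite -expr2 sqr_i.
  have uE (j : I) i : (k%:R^-1)%:C * ((j 0 i)%:~R)%:C = 2%:R * (halfstep k j 0 i)%:C.
    have -> : 2%:R = (2%:R : R)%:C :> R[i] by rewrite rmorph_nat.
    by rewrite -!rmorphM !mxE; congr (_%:C); field.
  rewrite (FC_cderive_dx _ _ _ cf) (FC_cderive_dx _ _ _ cg) mulr_suml !mulr_sumr -sumrN -big_split /=.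
  apply: eq_bigr => i _; have := uE (m - l) i; have := uE l i; rewrite -/u -/v.
  set a := (k%:R^-1)%:C; set b := ((l 0 i)%:~R)%:C; set c := (((m - l) 0 i)%:~R)%:C => e1 e2.
  set F := FC f l x; set G := FC g _ x; set Fi := FC (dx i f) l x; set Gi := FC (dx i g) _ x.
  rewrite [LHS](_ : _ = ('i%C * 'i%C) * ((a * c) * (Fi * G) - (a * b) * (F * Gi))); last by ring.
  by rewrite ii e1 e2; ring.
rewrite pE addrA; set U := l1 u; set V := l1 v.
have U0 : 0 <= U := l1_ge0 u.
have V0 : 0 <= V := l1_ge0 v.
have cN (h : X -> R[i]) j w : ccinf_pred h -> FC (cderive (- w, 0) h) j x = - FC (cderive (w, 0) h) j x.
  by move=> ch; rewrite !(FC_cderive_dx _ _ _ ch) -sumrN; apply: eq_bigr => i _; rewrite mxE rmorphN mulNr.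
have cmm (h : X -> R[i]) (C : R) j w : ccinf_pred h ->
    (forall m x v, nc (FC h m (x + v) - FC h m x - FC (cderive (v, 0) h) m x) <= C * l1 v ^+ 2 * wt R m ^+ 5) ->
    nc (FC h j (x - w) - FC h j x + FC (cderive (w, 0) h) j x) <= C * l1 w ^+ 2 * wt R j ^+ 5.
  by move=> ch hh; have := hh j x (- w); rewrite (cN _ _ _ ch) opprK l1N.
have wf0 : 0 <= Cf * wt R l ^+ 5 by rewrite mulr_ge0// exprn_ge0// wt_ge0.
have wg0 : 0 <= Cg * wt R (m - l) ^+ 5 by rewrite mulr_ge0// exprn_ge0// wt_ge0.
have AC (a b c : R) : a * b * c = b * (a * c) by ring.
have f1' w := f1 l x w; have f2' w := f2 l x w; have f3' w := f3 l x w.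
have g1' w := g1 (m - l) x w; have g2' w := g2 (m - l) x w; have g3' w := g3 (m - l) x w.
have f1n := f1' (- u); have g1n := g1' (- v); rewrite l1N in f1n; rewrite l1N in g1n.
have le : nc (FC f l (x + u) * FC g (m - l) (x - v) - FC g (m - l) (x + v) * FC f l (x - u)
    - 2%:R * (FC (cderive (u, 0) f) l x * FC g (m - l) x)
    + 2%:R * (FC f l x * FC (cderive (v, 0) g) (m - l) x))
    <= (2 * U ^+ 2 * V + 2 * U ^+ 2 + 4 * (U * V) + 2 * U * V ^+ 2 + 2 * V ^+ 2) *
       (Cf * wt R l ^+ 5 * (Cg * wt R (m - l) ^+ 5)).
  by apply: commutator_term => //; rewrite -AC //; exact: cmm.
apply: le_trans le _.
have le2 := @commutator_coef U V (iwt R l) (iwt R (m - l)) n.+1%:R k%:R^-1 U0 V0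
  (iwt_ge1 R l) (iwt_ge1 R (m - l)) _ t0 t1 (l1_halfstep (m - l) k0) (l1_halfstep l k0).
have {}le2 := le2 (ler1n _ _).
apply: le_trans (ler_wpM2r _ le2) _; first exact: mulr_ge0.
set wl := wt R l; set wm := wt R (m - l).
have e1 : wl * iwt R l = 1 := iwtK R l. have e2 : wm * iwt R (m - l) = 1 := iwtK R (m - l).
rewrite [leLHS](_ : _ = 12 * n.+1%:R ^+ 3 * (Cf * Cg) * k%:R^-1 ^+ 2 * ((wl * wm) ^+ 2) * (wl * iwt R l) ^+ 3 * (wm * iwt R (m - l)) ^+ 3); last by ring.
rewrite e1 e2 !expr1n !mulr1.
have wlm : (wl * wm) ^+ 2 <= 2 ^+ n * wt R m * wl.
  rewrite expr2; apply: ler_pM; rewrite ?mulr_ge0 ?wt_ge0//.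
    exact: wt_peetre.
  by rewrite ler_piMr ?wt_ge0 ?wt_le1.
have c0 : 0 <= 12 * n.+1%:R ^+ 3 * (Cf * Cg) * k%:R^-1 ^+ 2.
  by rewrite !mulr_ge0// exprn_ge0// ltW.
apply: le_trans (ler_wpM2l c0 wlm) _.
by rewrite le_eqVlt; apply/orP; left; apply/eqP; rewrite /K exprVn; ring.
Qed.

End CommutatorEstimate.

(** * Coordinates on the Hilbert space *)

(* The bound is tested on y = t T, with t = 1/M. *)
Lemma matrix_apply (R : realType) (I : choiceType) (a : I -> I -> R[i]) (M B : R)
    (x T : I -> R[i]) : mxbound a M -> 0 <= M ->
  (forall b, hsum (fun c => a b c * x c) (T b)) ->
  (forall Q : {fset I}, \sum_(c <- Q) nc (x c) ^+ 2 <= B) ->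
  forall P : {fset I}, \sum_(b <- P) nc (T b) ^+ 2 <= M ^+ 2 * B.
Proof.
move=> aM M0 hT xB P; set S := \sum_(b <- P) _.
have S0 : 0 <= S by apply: sumr_ge0 => i _; exact: sqr_ge0.
have key (t : R) : 0 <= t -> t * S <= M * ((t ^+ 2 * S + B) / 2).
  move=> t0; pose y b := t%:C * T b.
  have hs : hsum (fun c => \sum_(b <- P) (y b)^* * (a b c * x c)) (\sum_(b <- P) (y b)^* * T b).
    by apply: hsum_sum => b; exact: hsumZ.
  have E : \sum_(b <- P) (y b)^* * T b = (t * S)%:C.
    rewrite rmorphM rmorph_sum mulr_sumr; apply: eq_bigr => b _.
    rewrite /y nc_sqr; case: (T b) => u v; apply/eqP; rewrite eq_complex /=.
    by apply/andP; split; apply/eqP; ring.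
  have yS : \sum_(b <- P) nc (y b) ^+ 2 = t ^+ 2 * S.
    rewrite mulr_sumr; apply: eq_bigr => b _.
    by rewrite ncM nc_real ger0_norm// exprMn.
  have := @hsum_le R I _ _ (M * ((t ^+ 2 * S + B) / 2)) _ hs.
  rewrite E nc_real ger0_norm; last exact: mulr_ge0.
  apply => Q; rewrite exchange_big /=.
  have := aM P Q y x; rewrite yS => le.
  rewrite (_ : \sum_(b <- P) _ = \sum_(p <- P) \sum_(q <- Q) (y p)^* * a p q * x q); last first.
    by apply: eq_bigr => b _; apply: eq_bigr => c _; rewrite mulrA.
  apply: le_trans le _; apply: ler_wpM2l => //; apply: ler_wpM2r => //.
  by apply: lerD => //; exact: xB.
move: M0; rewrite le_eqVlt => /predU1P[M0|M0].
  by have := key 1 ler01; rewrite -M0 expr0n !mul0r mul1r.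
have := key M^-1; rewrite invr_ge0 ltW// => /(_ isT).
rewrite -(ler_pM2l M0) mulVKf ?gt_eqF// => le.
have e : M * (M * ((M^-1 ^+ 2 * S + B) / 2)) = (S + M ^+ 2 * B) / 2.
  by field; rewrite gt_eqF.
rewrite e in le; lra.
Qed.

Section HilbertCoordinates.
Variables (R : realType) (n k : nat).
Local Notation bs := (bs_points R n k).
Local Notation H := (hilb R n k).
Implicit Types (s t : H) (b c : bs) (A B : bop R n k) (X Y P Q : {fset bs}).

Lemma hilb_predP s : hilb_pred s.
Proof. by case: s => s /= /asboolP. Qed.

Lemma hilb_flat s b : flat_section k (\val b) (s b).
Proof. by have [] := hilb_predP s. Qed.

Lemma section_dot_coord s t b : section_dot (s b) (t b) = (s b 0)^* * t b 0.
Proof. by apply: section_dot_flat; exact: hilb_flat. Qed.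

Lemma Re_section_dot s b : complex.Re (section_dot (s b) (s b)) = nc (s b 0) ^+ 2.
Proof. by rewrite section_dot_coord nc_sqr; case: (s b 0) => x y /=; ring. Qed.

Lemma hilb_esum s : (\esum_(b in [set: bs]) (nc (s b 0) ^+ 2)%:E < +oo)%E.
Proof.
have [_] := hilb_predP s; rewrite /summable.
rewrite (_ : \esum_(_ in _) _ = \esum_(b in [set: bs]) (nc (s b 0) ^+ 2)%:E)//.
by apply: eq_esum => b _; rewrite Re_section_dot gee0_abs// lee_fin sqr_ge0.
Qed.

Lemma hnorm_esum s : hnorm s = Num.sqrt (fine (\esum_(b in [set: bs]) (nc (s b 0) ^+ 2)%:E)).
Proof.
rewrite /hnorm /family_norm /family_dot /cusum /=; congr Num.sqrt.
rewrite (_ : _ \o _ = fun b => nc (s b 0) ^+ 2).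
  by rewrite usum_ge0E// => b; exact: sqr_ge0.
by apply/funext => b; exact: Re_section_dot.
Qed.

Lemma hnorm_ge s X : \sum_(b <- X) nc (s b 0) ^+ 2 <= hnorm s ^+ 2.
Proof.
have E0 : (0 <= \esum_(b in [set: bs]) (nc (s b 0) ^+ 2)%:E)%E.
  by apply: esum_ge0 => b _; rewrite lee_fin sqr_ge0.
rewrite hnorm_esum sqr_sqrtr ?fine_ge0//.
by apply: sum_le_esum => [|b]; [exact: hilb_esum|exact: sqr_ge0].
Qed.

Lemma hnorm_le s (M : R) : 0 <= M ->
  (forall X, \sum_(b <- X) nc (s b 0) ^+ 2 <= M ^+ 2) -> hnorm s <= M.
Proof.
move=> M0 h; rewrite hnorm_esum -[M]ger0_norm// -sqrtr_sqr ler_wsqrtr//.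
have le := esum_le_bound h; rewrite -lee_fin fineK// ge0_fin_numE.
  exact: hilb_esum.
by apply: esum_ge0 => b _; rewrite lee_fin sqr_ge0.
Qed.

Lemma coord_le_hnorm s b : nc (s b 0) <= hnorm s.
Proof.
rewrite -(@ler_pXn2r _ 2)// ?nnegrE ?nc_ge0 ?hnorm_ge0//.
by have := hnorm_ge s [fset b]%fset; rewrite big_seq_fset1.
Qed.

(** A parallel section is determined by its value at 0, so [s b 0] serves as the coordinate of [s]
    along [psi b]. *)
Lemma hilb_ext s t : (forall b, s b 0 = t b 0) -> s = t.
Proof.
move=> st; apply: val_inj; apply/funext => b; apply/funext => th.
rewrite -[LHS]/(s b th) -[RHS]/(t b th).
by rewrite (flat_sectionE (hilb_flat s b)) (flat_sectionE (hilb_flat t b)) st.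
Qed.

Lemma hilbD s t b : (s + t) b 0 = s b 0 + t b 0. Proof. by []. Qed.

Lemma hilbZ (a : R[i]) s b : (a *: s) b 0 = a * s b 0. Proof. by []. Qed.

Lemma hilbB s t b : (s - t) b 0 = s b 0 - t b 0. Proof. by []. Qed.

Lemma hilb_sum (J : Type) (r : seq J) (F : J -> H) b :
  (\sum_(j <- r) F j) b 0 = \sum_(j <- r) F j b 0.
Proof. by elim: r => [|j r IH]; rewrite ?big_nil// !big_cons hilbD IH. Qed.

Lemma psiE b c : psi b c 0 = (c == b)%:R.
Proof.
rewrite /psi /=; case: eqP => // _; rewrite [dotp _ _]big1 ?mulr0 ?expi0// => i _.
by rewrite mxE mulr0.
Qed.

(** A weighted arithmetic-geometric mean replaces the Cauchy-Schwarz inequality; a suitable [tau]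
    still gives a small bound when only one of the two vectors is small. *)
Lemma hdot_absbnd s t (tau : R) : 0 < tau ->
  absbnd (fun b => (s b 0)^* * t b 0) ((tau * hnorm s ^+ 2 + tau^-1 * hnorm t ^+ 2) / 2).
Proof.
move=> tau0 X; apply: (@le_trans _ _ ((tau * (\sum_(b <- X) nc (s b 0) ^+ 2) +
    tau^-1 * (\sum_(b <- X) nc (t b 0) ^+ 2)) / 2)).
  rewrite !mulr_sumr -big_split /= mulr_suml; apply: ler_sum => b _.
  rewrite ncM nc_conj; set x := nc _; set y := nc _.
  rewrite ler_pdivlMr// -subr_ge0.
  have -> : tau * x ^+ 2 + tau^-1 * y ^+ 2 - x * y * 2 = tau^-1 * (tau * x - y) ^+ 2.
    by field; rewrite gt_eqF.
  by rewrite mulr_ge0 ?sqr_ge0// invr_ge0 ltW.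
apply: ler_wpM2r => //; apply: lerD; apply: ler_wpM2l; rewrite ?hnorm_ge// ?invr_ge0; exact: ltW.
Qed.

Lemma hdot_hsum s t : hsum (fun b => (s b 0)^* * t b 0) (hdot s t).
Proof.
rewrite /hdot /family_dot (_ : (fun b => _) = fun b => section_dot (s b) (t b)).
  apply: hsum_cusum; rewrite (_ : (fun b => _) = fun b => (s b 0)^* * t b 0); first exact: (hdot_absbnd s t ltr01).
  by apply/funext => b; rewrite section_dot_coord.
by apply/funext => b; rewrite section_dot_coord.
Qed.

Lemma hdot_bound s t (tau : R) : 0 < tau ->
  nc (hdot s t) <= (tau * hnorm s ^+ 2 + tau^-1 * hnorm t ^+ 2) / 2.
Proof. by move=> tau0; apply: hsum_abs_le (hdot_hsum s t); exact: hdot_absbnd. Qed.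

Lemma hdot_psi b t : hdot (psi b) t = t b 0.
Proof.
apply: (hsum_uniq (hdot_hsum _ _)).
have := @hsum_fin R bs (fun c => (psi b c 0)^* * t c 0) [fset b]%fset.
rewrite big_seq_fset1 (psiE b b) eqxx rmorph1 mul1r; apply => c; rewrite in_fset1 => cb.
by rewrite psiE (negPf cb) rmorph0 mul0r.
Qed.

Definition hilb_trunc s X : H := \sum_(b <- X) s b 0 *: psi b.

Lemma hilb_truncE s X b : hilb_trunc s X b 0 = if b \in X then s b 0 else 0.
Proof.
rewrite hilb_sum; case: ifPn => bX.
  rewrite (big_fsetD1 b)// hilbZ psiE eqxx mulr1 big_seq big1 => [|c]; first by rewrite /= addr0.
  by rewrite !inE => /andP[cb _]; rewrite hilbZ psiE eq_sym (negPf cb) mulr0.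
rewrite big_seq big1// => c cX; rewrite hilbZ psiE.
by case: eqP => [E|_]; [rewrite E cX in bX|rewrite mulr0].
Qed.

Lemma hilb_trunc_approx s (e : R) : 0 < e -> exists X, forall Y, (X `<=` Y)%fset ->
  hnorm (s - hilb_trunc s Y) <= e.
Proof.
move=> e0; have [X tl] := fset_tail (fun b => sqr_ge0 (nc (s b 0))) (hnorm_ge s) (exprn_gt0 2 e0).
exists X => Y XY; apply: hnorm_le (ltW e0) _ => Z.
rewrite (_ : \sum_(b <- Z) _ = \sum_(b <- (Z `\` Y)%fset) nc (s b 0) ^+ 2).
  by apply: tl; apply/fdisjointP => b bX; rewrite !inE (fsubsetP XY).
rewrite -(fsetID Y Z) sum_fsetU_disjoint; last first.
  by apply/fdisjointP => b; rewrite !inE => /andP[_ ->].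
rewrite fsetID big_seq big1 ?add0r => [|b]; last first.
  by rewrite !inE => /andP[_ bY]; rewrite hilbB hilb_truncE bY subrr nc0 expr0n.
rewrite big_seq [RHS]big_seq; apply: eq_bigr => b; rewrite !inE => /andP[bY _].
by rewrite hilbB hilb_truncE (negPf bY) subr0.
Qed.

Lemma bopP A : bounded_operator A.
Proof. by case: A => A /= /asboolP. Qed.

Lemma bop_linear A : linear A. Proof. by have [] := bopP A. Qed.

Lemma bopB A s t : A (s - t) = A s - A t.
Proof. by rewrite -[in LHS]scaleN1r addrC bop_linear scaleN1r addrC. Qed.

Lemma bop0 A : A 0 = 0. Proof. by rewrite -[X in A X](subrr 0) bopB subrr. Qed.

Lemma bop_lsum A (J : Type) (r : seq J) (z : J -> R[i]) (F : J -> H) :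
  A (\sum_(j <- r) z j *: F j) = \sum_(j <- r) z j *: A (F j).
Proof. by elim: r => [|j r IH]; rewrite ?big_nil ?bop0// !big_cons bop_linear IH. Qed.

Definition bop_coef A b c : R[i] := A (psi c) b 0.

Lemma bop_coef_hdot A b c : bop_coef A b c = hdot (psi b) (A (psi c)).
Proof. by rewrite hdot_psi. Qed.

Lemma bop_bounded A : exists2 M : R, 0 < M & forall s, hnorm (A s) <= M * hnorm s.
Proof.
have [_ [M hM]] := bopP A; exists (`|M| + 1) => [|s]; first by rewrite ltr_wpDl.
apply: le_trans (hM s) _; apply: ler_wpM2r; first exact: hnorm_ge0.
by apply: le_trans (ler_norm _) _; rewrite lerDl.
Qed.

Lemma bop_trunc A s X b : A (hilb_trunc s X) b 0 = \sum_(c <- X) bop_coef A b c * s c 0.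
Proof. by rewrite bop_lsum hilb_sum; apply: eq_bigr => c _; rewrite hilbZ mulrC. Qed.

(** [A] acts on a finite truncation through finitely many matrix coefficients, and its boundedness
    carries the convergence of truncations over to [A s]. *)
Lemma bop_hsum A s b : hsum (fun c => bop_coef A b c * s c 0) (A s b 0).
Proof.
move=> e e0; have [M M0 hM] := bop_bounded A.
have [X hX] := hilb_trunc_approx s (divr_gt0 e0 M0); exists X => Y /hX le.
rewrite -bop_trunc ncBC -hilbB -bopB; apply: le_trans (coord_le_hnorm _ _) _.
by apply: le_trans (hM _) _; rewrite mulrC -ler_pdivlMr.
Qed.

Lemma opnorm_le A (M : R) : 0 <= M -> mxbound (bop_coef A) M -> opnorm A <= M.
Proof.
move=> M0 AM; apply: ge_sup.
  by exists (hnorm (A 0)), 0 => //=; rewrite hnorm0.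
move=> _ [s /= s1 <-]; apply: hnorm_le => // P.
rewrite -[leRHS]mulr1; apply: (matrix_apply AM M0 (bop_hsum A s)) => Q.
apply: le_trans (hnorm_ge s Q) _; rewrite -(expr1n _ 2) lerXn2r ?nnegrE//.
exact: hnorm_ge0.
Qed.

Lemma hnormZ_le (r : R) s : 0 <= r -> hnorm (r%:C *: s) <= r * hnorm s.
Proof.
move=> r0; apply: hnorm_le; first by rewrite mulr_ge0// hnorm_ge0.
move=> X; rewrite exprMn; apply: le_trans (ler_wpM2l (sqr_ge0 r) (hnorm_ge s X)).
rewrite mulr_sumr; apply: ler_sum => b _.
by rewrite hilbZ ncM nc_real ger0_norm// exprMn.
Qed.

Lemma le_opnorm A s : hnorm (A s) <= opnorm A * hnorm s.
Proof.
have [M M0 hM] := bop_bounded A.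
have ub t : hnorm t <= 1 -> hnorm (A t) <= opnorm A.
  move=> t1; apply: ub_le_sup; last by exists t.
  exists M => _ [u /= u1 <-]; apply: le_trans (hM u) _.
  by rewrite -[leRHS]mulr1 ler_pM2l.
have [s0|s0] := leP (hnorm s) 0.
  have e : hnorm s = 0 by apply/eqP; rewrite eq_le s0 hnorm_ge0.
  by have := hM s; rewrite e !mulr0.
have r0 : 0 <= (hnorm s)^-1 by rewrite invr_ge0 ltW.
have sE : s = (hnorm s)%:C *: ((hnorm s)^-1%:C *: s).
  by rewrite scalerA -rmorphM mulfV ?gt_eqF// scale1r.
have AE : A s = (hnorm s)%:C *: A ((hnorm s)^-1%:C *: s).
  by rewrite [in LHS]sE -[in LHS](addr0 (_ *: _)) bop_linear bop0 addr0.
rewrite AE; apply: le_trans (hnormZ_le _ (ltW s0)) _; rewrite mulrC.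
apply: ler_wpM2r; first exact: ltW.
apply: ub; apply: le_trans (hnormZ_le _ r0) _.
by rewrite mulVf// gt_eqF.
Qed.

Lemma opnorm_ge0 A : 0 <= opnorm A.
Proof.
have [M M0 hM] := bop_bounded A.
apply: le_trans (hnorm_ge0 (A 0)) _; apply: ub_le_sup; last by exists 0 => //=; rewrite hnorm0.
exists M => _ [u /= u1 <-]; apply: le_trans (hM u) _.
by rewrite -[leRHS]mulr1 ler_pM2l.
Qed.

Lemma mxbound_opnorm A : mxbound (bop_coef A) (opnorm A).
Proof.
move=> P Q y x; pose s : H := \sum_(c <- Q) x c *: psi c.
have opn0 := opnorm_ge0 A.
have As b : A s b 0 = \sum_(c <- Q) bop_coef A b c * x c.
  by rewrite bop_lsum hilb_sum; apply: eq_bigr => c _; rewrite hilbZ mulrC.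
have sx : hnorm s ^+ 2 <= \sum_(c <- Q) nc (x c) ^+ 2.
  have Q0 : 0 <= \sum_(c <- Q) nc (x c) ^+ 2 by apply: sumr_ge0 => c _; exact: sqr_ge0.
  rewrite -[leRHS]sqr_sqrtr//; rewrite lerXn2r ?nnegrE ?hnorm_ge0 ?sqrtr_ge0//.
  apply: hnorm_le; first exact: sqrtr_ge0.
  move=> X; rewrite sqr_sqrtr//.
  have sE b : s b 0 = if b \in Q then x b else 0.
    rewrite hilb_sum; case: ifPn => bX.
      rewrite (big_fsetD1 b)// hilbZ psiE eqxx mulr1 big_seq big1 => [|c]; first by rewrite /= addr0.
      by rewrite !inE => /andP[cb _]; rewrite hilbZ psiE eq_sym (negPf cb) mulr0.
    rewrite big_seq big1// => c cX; rewrite hilbZ psiE.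
    by case: eqP => [E|_]; [rewrite E cX in bX|rewrite mulr0].
  rewrite -(fsetID Q X) sum_fsetU_disjoint; last first.
    by apply/fdisjointP => b; rewrite !inE => /andP[_ ->].
  rewrite [X in _ + X]big_seq [X in _ + X]big1 ?addr0 => [|b]; last first.
    by rewrite !inE => /andP[bQ _]; rewrite sE (negPf bQ) nc0 expr0n.
  rewrite big_seq (eq_bigr (fun b => nc (x b) ^+ 2)) => [|b]; last first.
    by rewrite !inE => /andP[_ bQ]; rewrite sE bQ.
  rewrite -big_seq; apply: sum_fset_sub; last exact: fsubsetIr.
  by move=> b; exact: sqr_ge0.
set Y2 := \sum_(p <- P) nc (y p) ^+ 2; set X2 := \sum_(q <- Q) nc (x q) ^+ 2 in sx *.
have Y20 : 0 <= Y2 by apply: sumr_ge0 => c _; exact: sqr_ge0.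
have X20 : 0 <= X2 by apply: sumr_ge0 => c _; exact: sqr_ge0.
(* A number strictly above [opnorm A] is positive even if the norm is 0, hence can serve as the
   weight in the mean inequality; then it decreases to the norm. *)
suff key mu : opnorm A < mu -> nc (\sum_(p <- P) \sum_(q <- Q) (y p)^* * bop_coef A p q * x q) <= mu * ((Y2 + X2) / 2).
  apply/ler_addgt0Pr => e e0; pose d := (Y2 + X2) / 2 + 1.
  have d0 : 0 < d by rewrite ltr_wpDl// divr_ge0// addr_ge0.
  have lt : opnorm A < opnorm A + e / d by rewrite ltrDl divr_gt0.
  apply: le_trans (key _ lt) _; rewrite mulrDl lerD2l mulrAC ler_pdivrMr//.
  by apply: ler_wpM2l; [exact: ltW|rewrite /d lerDl].
move=> lmu; have mu0 : 0 < mu by apply: le_lt_trans lmu.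
apply: (@le_trans _ _ (\sum_(p <- P) (mu * nc (y p) ^+ 2 / 2 + mu^-1 * nc (A s p 0) ^+ 2 / 2))).
  apply: le_trans (ler_nc_sum _ _ _) _; apply: ler_sum => p _.
  rewrite (_ : \sum_(q <- Q) _ = (y p)^* * A s p 0); last first.
    by rewrite As mulr_sumr; apply: eq_bigr => q _; rewrite mulrA.
  rewrite ncM nc_conj; set u := nc _; set v := nc _; rewrite -subr_ge0.
  have -> : mu * u ^+ 2 / 2 + mu^-1 * v ^+ 2 / 2 - u * v = mu^-1 / 2 * (mu * u - v) ^+ 2.
    by field; rewrite gt_eqF.
  by rewrite mulr_ge0 ?sqr_ge0// divr_ge0// invr_ge0 ltW.
rewrite big_split /= -!mulr_suml -!mulr_sumr -/Y2 mulrDl mulrDr mulrA lerD2l mulrA.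
apply: ler_wpM2r => //; rewrite mulrC ler_pdivrMr//.
apply: le_trans (hnorm_ge (A s) P) _.
apply: le_trans (_ : (mu * hnorm s) ^+ 2 <= _).
  rewrite lerXn2r ?nnegrE ?hnorm_ge0 ?mulr_ge0 ?hnorm_ge0//; first exact: ltW.
  apply: le_trans (le_opnorm A s) _; apply: ler_wpM2r; [exact: hnorm_ge0|exact: ltW].
rewrite exprMn expr2 mulrAC; apply: ler_wpM2r; first exact: ltW.
by apply: ler_wpM2l => //; exact: ltW.
Qed.

Lemma hdotBl s s' t : hdot (s - s') t = hdot s t - hdot s' t.
Proof.
apply: (hsum_uniq (hdot_hsum _ _)).
apply: eq_hsum (hsumB (hdot_hsum s t) (hdot_hsum s' t)) => b.
by rewrite hilbB rmorphB mulrBl.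
Qed.

Lemma hdot_suml (J : Type) (r : seq J) (z : J -> R[i]) (F : J -> H) t :
  hdot (\sum_(j <- r) z j *: F j) t = \sum_(j <- r) (z j)^* * hdot (F j) t.
Proof.
apply: (hsum_uniq (hdot_hsum _ _)).
apply: eq_hsum (hsum_sum r (fun j => hsumZ (z j)^* (hdot_hsum (F j) t))) => b.
rewrite hilb_sum rmorph_sum mulr_suml; apply: eq_bigr => j _.
by rewrite hilbZ rmorphM mulrA.
Qed.

Lemma is_adjoint_coef A B : (forall b c, bop_coef A b c = (bop_coef B c b)^*) -> is_adjoint A B.
Proof.
move=> AB s t; apply: nc_eq_eps => e e0.
have adj_psi c : hdot (A (psi c)) t = B t c 0.
  apply: (hsum_uniq (hdot_hsum _ _)); apply: eq_hsum (bop_hsum B t c) => b.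
  by rewrite -/(bop_coef A b c) AB; congr (_ * _); exact: esym (conjcK _).
have adj_trunc X : hdot (A (hilb_trunc s X)) t = hdot (hilb_trunc s X) (B t).
  rewrite bop_lsum !hdot_suml; apply: eq_bigr => c _.
  by rewrite adj_psi hdot_psi.
have [M M0 hM] := bop_bounded A.
(* Chosen so that the two applications of [hdot_bound] with [tau = d^-1] add up to [d * K = e]. *)
pose K := (M ^+ 2 + hnorm t ^+ 2 + 1 + hnorm (B t) ^+ 2) / 2.
have K0 : 0 < K.
  by rewrite divr_gt0// ltr_pwDl ?sqr_ge0// ltr_wpDl// addr_ge0 ?sqr_ge0.
have [X /(_ X (fsubset_refl _)) hX] := hilb_trunc_approx s (divr_gt0 e0 K0).
set d := e / K in hX; have d0 : 0 < d by rewrite divr_gt0.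
have -> : hdot (A s) t - hdot s (B t) = hdot (A (s - hilb_trunc s X)) t - hdot (s - hilb_trunc s X) (B t).
  by rewrite bopB !hdotBl adj_trunc; ring.
set w := s - _ in hX *; have dv0 : 0 < d^-1 by rewrite invr_gt0.
have w2 : hnorm w ^+ 2 <= d ^+ 2 by rewrite lerXn2r ?nnegrE ?hnorm_ge0// ltW.
have Aw2 : hnorm (A w) ^+ 2 <= M ^+ 2 * d ^+ 2.
  have Md0 : 0 <= M * d by rewrite mulr_ge0// ltW.
  rewrite -exprMn lerXn2r ?nnegrE ?hnorm_ge0//.
  by apply: le_trans (hM w) _; rewrite ler_pM2l.
apply: le_trans (ler_ncB _ _) _.
apply: le_trans (lerD (hdot_bound (A w) t dv0) (hdot_bound w (B t) dv0)) _.
rewrite invrK -mulrDl.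
have -> : e = (d^-1 * (M ^+ 2 * d ^+ 2) + d * hnorm t ^+ 2 + (d^-1 * d ^+ 2 + d * hnorm (B t) ^+ 2)) / 2.
  have -> : e = d * K by rewrite /d divfK// gt_eqF.
  by rewrite /K; field; rewrite gt_eqF.
apply: ler_wpM2r => //; apply: lerD; rewrite lerD2r; apply: ler_wpM2l => //; exact: ltW.
Qed.

Lemma hilb_exists (z : bs -> R[i]) (B : R) :
  (forall X, \sum_(b <- X) nc (z b) ^+ 2 <= B) -> exists s : H, forall b, s b 0 = z b.
Proof.
move=> zB; pose s b := z b *: (psi b b : 'rV[R]_n -> R[i]).
have s0 b : s b 0 = z b.
  by rewrite -[LHS]/(z b * psi b b 0) psiE eqxx mulr1.
have fl b : flat_section k (\val b) (s b).
  rewrite /s -[X in flat_section _ _ X]addr0; apply: flat_sectionD; first exact: hilb_flat.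
  exact: flat_section0.
have hs : s \in @hilb_set R n k.
  apply/asboolP; split=> //; rewrite /summable.
  rewrite (_ : \esum_(_ in _) _ = \esum_(b in [set: bs]) (nc (z b) ^+ 2)%:E).
    exact: le_lt_trans (esum_le_bound zB) (ltry _).
  apply: eq_esum => b _; rewrite (section_dot_flat (fl b) (fl b)) s0.
  rewrite (_ : complex.Re _ = nc (z b) ^+ 2) ?gee0_abs ?lee_fin ?sqr_ge0//.
  by rewrite nc_sqr; case: (z b) => x y /=; ring.
by exists (Hilb hs) => b; exact: s0.
Qed.

(** [B], a bound on the row sums, makes every coordinate of the image an absolutely convergent sum;
    [M] makes the image square summable and the operator bounded. *)
Lemma bop_exists (a : bs -> bs -> R[i]) (M B : R) : mxbound a M -> 0 <= M ->
  (forall b Q, \sum_(c <- Q) nc (a b c) <= B) ->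
  exists A, forall s b, A s b 0 = cusum (fun c => a b c * s c 0).
Proof.
move=> aM M0 aB.
have ab s b : absbnd (fun c => a b c * s c 0) (B * hnorm s).
  move=> Q; apply: le_trans (ler_wpM2r (hnorm_ge0 s) (aB b Q)).
  rewrite mulr_suml; apply: ler_sum => c _; rewrite ncM.
  by apply: ler_wpM2l; [exact: nc_ge0|exact: coord_le_hnorm].
have hs s b := hsum_cusum (ab s b).
have bnd s := matrix_apply aM M0 (hs s) (hnorm_ge s).
have /choice[A hA] s := hilb_exists (bnd s).
have bA : A \in @bop_set R n k.
  apply/asboolP; split=> [z s t|].
    apply: hilb_ext => b; rewrite hilbD hilbZ !hA.
    apply: (hsum_uniq (hs (z *: s + t) b)).
    apply: eq_hsum (hsumD (hsumZ z (hs s b)) (hs t b)) => c.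
    by rewrite hilbD hilbZ mulrDr mulrCA.
  exists M => s; apply: hnorm_le; first by rewrite mulr_ge0// hnorm_ge0.
  move=> X; rewrite exprMn; apply: le_trans (bnd s X).
  by apply: ler_sum => b _; rewrite hA.
by exists (Bop bA).
Qed.

Lemma bop_ext A B : (forall b c, bop_coef A b c = bop_coef B b c) -> A = B.
Proof.
move=> AB; apply: val_inj; apply/funext => s; apply: hilb_ext => b.
apply: (hsum_uniq (bop_hsum A s b)); apply: eq_hsum (bop_hsum B s b) => c.
by rewrite AB.
Qed.

Lemma bop_coefD A B b c : bop_coef (A + B) b c = bop_coef A b c + bop_coef B b c. Proof. by []. Qed.

Lemma bop_coefB A B b c : bop_coef (A - B) b c = bop_coef A b c - bop_coef B b c. Proof. by []. Qed.

Lemma bop_coefZ (z : R[i]) A b c : bop_coef (z *: A) b c = z * bop_coef A b c. Proof. by []. Qed.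

Lemma bop_coef_comp A B b c : hsum (fun d => bop_coef A b d * bop_coef B d c) (bop_coef (bop_comp A B) b c).
Proof. exact: (bop_hsum A (B (psi c)) b). Qed.

End HilbertCoordinates.

(** * The Weyl quantization *)

(** Moves matrix bounds between integer vectors and points of [B_k]; the left inverse [v] transports
    the test vectors. *)
Lemma mxbound_comp (R : realType) (I J : choiceType) (u : I -> J) (v : J -> I)
    (a : J -> J -> R[i]) (M : R) : cancel u v ->
  mxbound a M -> mxbound (fun p q => a (u p) (u q)) M.
Proof.
move=> uv aM P Q y x.
have E (V : nmodType) (Y : {fset I}) (h : J -> V) :
    \sum_(j <- (u @` Y)%fset) h j = \sum_(i <- Y) h (u i).
  by rewrite big_imfset//= => i i' _ _; exact: (can_inj uv).
have := aM (u @` P)%fset (u @` Q)%fset (y \o v) (x \o v).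
rewrite !E /=; congr (nc _ <= M * ((_ + _) / 2)).
- by apply: eq_bigr => p _; rewrite E uv; apply: eq_bigr => q _; rewrite uv.
- by apply: eq_bigr => p _; rewrite uv.
- by apply: eq_bigr => p _; rewrite uv.
Qed.

(** * Points of [B_k] as integer vectors *)

Section LatticePoints.
Variables (R : realType) (n k : nat).
Local Notation I := 'rV[int]_n.
Local Notation bs := (bs_points R n k).

Lemma lattice_pt_subproof (p : I) : k%:R^-1 *: map_mx intr p \in bs.
Proof. by apply/mem_set; exists p. Qed.

Definition lattice_pt (p : I) : bs := exist (fun b => b \in bs) _ (lattice_pt_subproof p).

Lemma bs_index_ex (b : bs) : exists p : I, \val b = k%:R^-1 *: map_mx intr p.
Proof. by case: b => b /= /set_mem. Qed.

(** A chosen preimage. For [k = 0] the inverse [k%:R^-1] is 0, so all integer vectors give the same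
    point; injectivity of [lattice_pt] therefore needs [0 < k]. *)
Definition bs_index (b : bs) : I := sval (cid (bs_index_ex b)).

Lemma bs_indexK : cancel bs_index lattice_pt.
Proof. by move=> b; apply: val_inj; rewrite /= /bs_index; case: cid. Qed.

Lemma lattice_ptK : (0 < k)%N -> cancel lattice_pt bs_index.
Proof.
move=> k0 p; rewrite /bs_index; case: cid => q /= /rowP e; apply/rowP => i.
have := e i; rewrite !mxE => /(mulfI _) h; apply/esym/eqP.
by rewrite -(eqr_int R); apply/eqP/h; rewrite invr_eq0 pnatr_eq0 -lt0n.
Qed.

End LatticePoints.

Section WeylQuantization.
Variables (R : realType) (n : nat).
Implicit Types (f g : ccinf R n).

Lemma weyl_coef_lattice k f (b c : bs_points R n k) : (0 < k)%N ->
  weyl_coef k f (\val b) (\val c) = weylmx k f (bs_index b) (bs_index c).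
Proof.
move=> k0; rewrite -[in LHS](bs_indexK b) -[in LHS](bs_indexK c).
exact: weyl_coefE.
Qed.

Lemma weylmx_decay f : exists2 C : R, 0 <= C & forall k p q, nc (weylmx k f p q) <= C * wt R (p - q).
Proof.
have [C C0 [h _ _ _]] := FC_estimates 1 (ccinfP f); exists C => // k p q.
by have := h (p - q) (midpt R k p q); rewrite expr1.
Qed.

Lemma weyl_op_exists k f : (0 < k)%N -> exists A : bop R n k, forall s b,
  A s b 0 = cusum (fun c => weyl_coef k f (\val b) (\val c) * s c 0).
Proof.
move=> k0; have [C C0 hC] := weylmx_decay f.
have sumC (p : 'rV[int]_n) (Q : {fset 'rV[int]_n}) : \sum_(q <- Q) C * wt R (p - q) <= C * 8 ^+ n.
  rewrite -mulr_sumr; apply: ler_wpM2l => //.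
  by apply: (@sum_subr_le R n (fun l => wt R l)); exact: wt_summable.
apply: (@bop_exists R n k _ (C * 8 ^+ n) (C * 8 ^+ n)).
- apply: (@eq_mxbound _ _ (fun b c => weylmx k f (bs_index b) (bs_index c))) => [b c|].
    by rewrite weyl_coef_lattice.
  apply: (mxbound_comp (@bs_indexK R n k)).
  apply: (@schur_test R n _ (fun l => C * wt R l)) => // X.
  by rewrite -mulr_sumr; apply: ler_wpM2l => //; exact: wt_summable.
- by rewrite mulr_ge0// exprn_ge0.
move=> b Q.
have le (c : bs_points R n k) : nc (weyl_coef k f (\val b) (\val c)) <= C * wt R (bs_index b - bs_index c).
  by rewrite weyl_coef_lattice.
apply: le_trans (sumC (bs_index b) [fset bs_index c | c in Q]%fset).
rewrite big_imfset/=; last by move=> c c' _ _; exact: (can_inj (@bs_indexK R n k)).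
by apply: ler_sum => c _; exact: le.
Qed.

(** The family must be defined for every natural [k]; the value 0 at [k = 0] keeps it linear
    there. *)
Lemma weyl_op_total k f : exists A : bop R n k, ((0 < k)%N -> forall s b,
  A s b 0 = cusum (fun c => weyl_coef k f (\val b) (\val c) * s c 0)) /\ (k = 0%N -> A = 0).
Proof.
have [k0|k0] := ltnP 0 k.
  by have [A hA] := weyl_op_exists f k0; exists A; split=> // E; rewrite E in k0.
by exists 0; split => //; rewrite ltnNge k0.
Qed.

Definition weyl_op k f : bop R n k := sval (cid (weyl_op_total k f)).

Lemma coef_weyl_op k f b c : (0 < k)%N ->
  bop_coef (weyl_op k f) b c = weyl_coef k f (\val b) (\val c).
Proof.
move=> k0; rewrite /bop_coef /weyl_op; case: cid => A /= [/(_ k0) -> _].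
apply: (@cusumE _ _ _ _ (nc (weyl_coef k f (\val b) (\val c)))).
  move=> X; apply: (@le_trans _ _ (\sum_(d <- (c |` X)%fset) nc (weyl_coef k f (\val b) (\val d) * psi c d 0))).
    by apply: sum_fset_sub; [move=> d; exact: nc_ge0|exact: fsubsetU1].
  rewrite (big_fsetD1 c); last by rewrite !inE eqxx.
  rewrite psiE eqxx mulr1 big_seq big1 => [|d]; first by rewrite /= addr0.
  rewrite in_fsetD1 => /andP[dc _].
  by rewrite psiE (negPf dc) mulr0 nc0.
have := @hsum_fin R _ (fun d => weyl_coef k f (\val b) (\val d) * psi c d 0) [fset c]%fset.
rewrite big_seq_fset1 (psiE c c) eqxx mulr1; apply => d; rewrite in_fset1 => dc.
by rewrite psiE (negPf dc) mulr0.
Qed.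

Lemma weyl_coef_linear k (z : R[i]) f g b c :
  weyl_coef k (z *: f + g) b c = z * weyl_coef k f b c + weyl_coef k g b c.
Proof.
have ce (h : ccinf R n) : ccont (fun th => expi (- (k%:R * dotp (b - c) th)) * h (2^-1 *: (b + c), th)).
  apply: ccontM; last by apply: ccont_slice; exact: ccinfP.
  apply: ccont_expi => x; exact: (cvgN (@continuous_scale R 'rV[R]_n k%:R _ (@dotp_continuous R n (b - c)) x)).
rewrite /weyl_coef -cintZ; last exact: ce.
rewrite -cintD; [|by apply: ccontZ; exact: ce|exact: ce].
congr ctorus_int; apply/funext => th.
by rewrite -[(z *: f + g : ccinf R n) _]/(z * f _ + g _); ring.
Qed.

Lemma weyl_op_is_linear k : linear (weyl_op k).
Proof.
move=> z f g; have [k0|k0] := ltnP 0 k; last first.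
  have {k0} k0 : k = 0%N by apply/eqP; rewrite -leqn0.
  have w0 h : weyl_op k h = 0 by rewrite /weyl_op; case: cid => A /= [_ ->].
  by rewrite !w0 scaler0 addr0.
apply: bop_ext => b c; rewrite bop_coefD bop_coefZ !coef_weyl_op//.
exact: weyl_coef_linear.
Qed.

HB.instance Definition _ k :=
  GRing.isLinear.Build R[i] (ccinf R n) (bop R n k) _ (weyl_op k) (@weyl_op_is_linear k).

Lemma ctorus_int_conj (u : 'rV[R]_n -> R[i]) : ccont u ->
  ctorus_int (fun th => (u th)^*) = (ctorus_int u)^*.
Proof.
move=> [cr ci]; rewrite /ctorus_int /=; congr (_ +i* _).
  by congr torus_int; apply/funext => th /=; case: (u th).
rewrite -[RHS]mulN1r -(torus_intZ (-1) ci); congr torus_int; apply/funext => th /=.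
by case: (u th) => x y /=; rewrite mulN1r.
Qed.

Lemma weyl_coef_conj k f b c :
  weyl_coef k (ccinf_conj f) b c = (weyl_coef k f c b)^*.
Proof.
rewrite /weyl_coef -ctorus_int_conj; last first.
  apply: ccontM; last by apply: ccont_slice; exact: ccinfP.
  apply: ccont_expi => x; exact: (cvgN (@continuous_scale R 'rV[R]_n k%:R _ (@dotp_continuous R n (c - b)) x)).
congr ctorus_int; apply/funext => th.
have E : (expi (- (k%:R * dotp (c - b) th)))^* = expi (- (k%:R * dotp (b - c) th)).
  by rewrite -expiN opprK -(opprB c b) dotpNl mulrN opprK.
by rewrite rmorphM /= [c + b]addrC; congr (_ * _); exact: esym E.
Qed.

Lemma weyl_op_coefficients k : (0 < k)%N -> weyl_coefficients (weyl_op k).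
Proof. by move=> k0 f b c; rewrite hdot_psi -/(bop_coef _ b c) coef_weyl_op. Qed.

Lemma weyl_op_adjoint k : (0 < k)%N -> adjoint_preserving (weyl_op k).
Proof.
move=> k0 f; apply: is_adjoint_coef => b c.
by rewrite !coef_weyl_op// weyl_coef_conj.
Qed.

Lemma sup_norm_ub f p : nc (f p) <= sup_norm f.
Proof.
have [B hB] := ccinf_bounded (ccinfP f).
by apply: ub_le_sup; [exists B => _ [q _ <-]|exists p].
Qed.

(** * Norm limit and commutator estimate for any maps with the Weyl coefficients *)

Section Quantization.
Variable phi : forall k : nat, {linear ccinf R n -> bop R n k}.
Hypothesis phiW : forall k, (0 < k)%N -> weyl_coefficients (phi k).

Lemma coef_phi k f b c : (0 < k)%N ->
  bop_coef (phi k f) b c = weylmx k f (bs_index b) (bs_index c).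
Proof. by move=> k0; rewrite bop_coef_hdot phiW// weyl_coef_lattice. Qed.

Lemma opnorm_phi_le k f (M : R) : (0 < k)%N -> 0 <= M ->
  mxbound (weylmx k f) M -> opnorm (phi k f) <= M.
Proof.
move=> k0 M0 fM; apply: opnorm_le => //.
apply: (@eq_mxbound _ _ (fun b c => weylmx k f (bs_index b) (bs_index c))) => [b c|].
  by rewrite coef_phi.
exact: (mxbound_comp (@bs_indexK R n k)).
Qed.

Lemma mxbound_phi k f : (0 < k)%N -> mxbound (weylmx k f) (opnorm (phi k f)).
Proof.
move=> k0; have := mxbound_comp (@lattice_ptK R n k k0) (mxbound_opnorm (phi k f)).
by apply: eq_mxbound => p q; rewrite coef_phi// !lattice_ptK.
Qed.

Lemma opnorm_phi_cvg f : opnorm (phi k f) @[k --> \oo] --> sup_norm f.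
Proof.
have S0 : 0 <= sup_norm f by apply: le_trans (sup_norm_ub f 0); exact: nc_ge0.
have [C C0 hC] := weylmx_upper (ccinfP f) (sup_norm_ub f).
have [D D0 hD] := weylmx_lower (ccinfP f).
apply/cvgrPdist_le => e e0; have e2 : 0 < e / 2 by rewrite divr_gt0.
have K0 : 0 <= C + D by rewrite addr_ge0.
have inv_le (x : R) : 0 <= x -> exists N : nat, forall m, (N < m)%N -> x / m%:R <= e / 2.
  move=> x0; exists (Num.bound (x / (e / 2))) => m Nm.
  have m0 : 0 < m%:R :> R by rewrite ltr0n (leq_ltn_trans _ Nm).
  rewrite ler_pdivrMr// mulrC -ler_pdivrMr//.
  apply: ltW; apply: lt_le_trans (archi_boundP _) _; first by rewrite divr_ge0// ltW.
  by rewrite ler_nat ltnW.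
(* The order of choices matters: [L] is fixed from [e] first, then [k] is taken large depending on
   [L]. *)
have [L0 hL] := inv_le _ K0; pose L := L0.+1.
have [N hN] := inv_le ((C + D) * L.+1%:R) (mulr_ge0 K0 (ler0n _ _)).
exists N.+1 => // k /= Nk; have k0 : (0 < k)%N by apply: leq_ltn_trans Nk.
have := hN k Nk; have := hL L (ltnSn _) => h1 h2.
have del : (C + D) * (L%:R^-1 + L.+1%:R / k%:R) <= e.
  by rewrite mulrDr mulrA [leRHS]splitr; exact: lerD.
have d0 : 0 <= L%:R^-1 + L.+1%:R / k%:R :> R.
  by rewrite addr_ge0 ?invr_ge0// mulr_ge0// invr_ge0.
have Cd : C * (L%:R^-1 + L.+1%:R / k%:R) <= e.
  by apply: le_trans del; apply: ler_wpM2r => //; rewrite lerDl.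
have Dd : D * (L%:R^-1 + L.+1%:R / k%:R) <= e.
  by apply: le_trans del; apply: ler_wpM2r => //; rewrite lerDr.
have up : opnorm (phi k f) <= sup_norm f + e.
  apply: opnorm_phi_le => //; first by rewrite addr_ge0// ltW.
  by apply: mxbound_le (hC L k (ltn0Sn _) k0); rewrite lerD2l.
have lo : sup_norm f <= opnorm (phi k f) + e.
  apply: ge_sup; first by exists (nc (f 0)), 0.
  move=> _ [p _ <-]; apply: le_trans (hD L k _ p (ltn0Sn _) k0 (mxbound_phi f k0)) _.
  by rewrite lerD2l.
by rewrite ler_norml; apply/andP; split; lra.
Qed.

Lemma commutator_phi_bigO f g :
  (fun k => opnorm (commutator (phi k f) (phi k g) +
                    ('i%C * (k%:R^-1)%:C) *: phi k (poisson f g)))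
    =O_\oo (fun k => k%:R ^- 2 : R).
Proof.
have [C C0 hC] := weylmx_commutator (ccinfP f) (ccinfP g).
(* The added 1 makes the constant of the [O] strictly positive even if [C] is 0. *)
apply/eqO_exP; exists (C * 8 ^+ n + 1); first by rewrite ltr_wpDl// mulr_ge0// exprn_ge0.
exists 1%N => // k /= k0; rewrite ger0_norm ?opnorm_ge0// ger0_norm ?invr_ge0 ?exprn_ge0//.
have k2 : 0 <= k%:R ^- 2 :> R by rewrite invr_ge0 exprn_ge0.
apply: (@le_trans _ _ (C * k%:R ^- 2 * 8 ^+ n)); last first.
  by rewrite mulrAC; apply: ler_wpM2r => //; rewrite lerDl.
have B0 : 0 <= C * k%:R ^- 2 by rewrite mulr_ge0.
apply: opnorm_le; first by rewrite mulr_ge0// exprn_ge0.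
set E := bop_coef _; apply: (@eq_mxbound _ _ (fun b c =>
   (fun p q => E (lattice_pt R k p) (lattice_pt R k q)) (bs_index b) (bs_index c))) => [b c|].
  by rewrite !bs_indexK.
apply: (@mxbound_comp R _ _ _ _ (fun p q => E (lattice_pt R k p) (lattice_pt R k q)) _ (@bs_indexK R n k)).
apply: (@schur_test R n _ (fun l => C * k%:R ^- 2 * wt R l)) => [p r|X]; last first.
  by rewrite -mulr_sumr; apply: ler_wpM2l => //; exact: wt_summable.
rewrite /E bop_coefD bop_coefB bop_coefZ coef_phi// !lattice_ptK//.
have comp (u w : ccinf R n) : hsum (fun q => weylmx k u p q * weylmx k w q r)
    (bop_coef (bop_comp (phi k u) (phi k w)) (lattice_pt R k p) (lattice_pt R k r)).
  have := hsum_bij (@lattice_ptK R n k k0) (@bs_indexK R n k)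
    (bop_coef_comp (phi k u) (phi k w) (lattice_pt R k p) (lattice_pt R k r)).
  by apply: eq_hsum => q /=; rewrite !coef_phi// !lattice_ptK.
exact: (hC k p r _ _ k0 (comp f g) (comp g f)).
Qed.

End Quantization.

End WeylQuantization.

(** The existence part keeps the universal part from being vacuous; the latter follows from the
    matrix coefficients alone, so no particular construction of the maps enters. *)
Theorem theorem19 (R : realType) (n : nat) :
  (exists phi : forall k : nat, {linear ccinf R n -> bop R n k},
     forall k : nat, (0 < k)%N ->
       adjoint_preserving (phi k) /\ weyl_coefficients (phi k)) /\
  (forall phi : forall k : nat, {linear ccinf R n -> bop R n k},
     (forall k : nat, (0 < k)%N ->
        adjoint_preserving (phi k) /\ weyl_coefficients (phi k)) ->
     strict_deformation_quantization phi).
Proof.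
split.
  exists (fun k => (@weyl_op R n k : {linear ccinf R n -> bop R n k})) => k k0.
  by split; [exact: weyl_op_adjoint|exact: weyl_op_coefficients].
move=> phi hphi; have phiW k (k0 : (0 < k)%N) := (hphi k k0).2.
split.
- by move=> k k0; exact: (hphi k k0).1.
- by move=> f; exact: opnorm_phi_cvg.
- by move=> f g; exact: commutator_phi_bigO.
Qed.
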